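(* Let $d\ge2$ and $\gamma>d$. Let $\alpha_{\min}=2^{(\gamma-1)/(\gamma-d)}$. Let $0<\Omega<\Omega_{\max}=(4\alpha_{\min})^{1-d}$ and define $\alpha_{\max}=\Omega^{-\frac{1}{d-1}}/4$. Choose $\alpha$ such that $\alpha_{\min}<\alpha<\alpha_{\max}$ (in particular $\alpha>1$). Then there is a $T_1$ depending only on $\alpha,\Omega,\gamma$ and $d$ such that the following holds. Let $A$ and $F$ be two subsets of $\mathbb{R}^d$ such that, for some $r>0$: (i) $A$ is connected; (ii) from any $x\in A^{r/(\alpha-1)}$, the solid angle $\mu^{(o)}_{d-1}([F-x])$ of $F$ is less than $\Omega$; (iii) $A$ may be covered by $\mathring N$ balls of radius $r$. Then, writing $\varepsilon_{\max}=1/(2\mathring N(2\alpha+1)^d)$, for any $0<\varepsilon<\varepsilon_{\max}$, with probability at least $1-\varepsilon/\varepsilon_{\max}$, the diameter of $A$ on $\Pi_{[A^{r/(\alpha-1)}]\setminus[F]}$ satisfies $$T_{A,F}:=\sup_{x,y\in A}\ \inf_{\xi\in\Pi^{xy}_{[A^{r/(\alpha-1)}]\setminus[F]}}T(\xi)\ \le\ T_{r,\mathring N}\Bigl(\ln\frac1\varepsilon\Bigr)^{\frac1{\gamma-1}},\qquad T_{r,\mathring N}=\mathring N\,T_1\,r^{\frac{\gamma-d}{\gamma-1}}.$$ In particular, for any $\delta<T_{r,\mathring N}^{-(\gamma-1)}$, $$\mathbb{E}\bigl[\exp\bigl(\delta\,T_{A,F}^{\gamma-1}\bigr)\bigr]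<\infty.$$
   Context: Lines in $\mathbb{R}^d$ are undirected. For $K\subset\mathbb{R}^d$, $[K]$ is the set of lines hitting $K$. Let $\mu_d$ be the measure on the space of lines of $\mathbb{R}^d$ invariant under Euclidean isometries, normalized so that $\mu_d([B(x,r)])=\frac{\omega_{d-1}}{2}r^{d-1}$, where $B(x,r)$ is the ball of centre $x$ and radius $r$ and $\omega_{d-1}$ is the hyperarea of the unit sphere $\mathbb{S}^{d-1}$. $\Pi$ is the Poisson process of marked lines $(l,v)$, $v>0$, with intensity measure $\mathrm{d}\mu_d(l)\,(\gamma-1)v^{-\gamma}\,\mathrm{d}v$; $v$ is the speed limit of $l$. A finite-time $\Pi$-path is a locally Lipschitz function $\xi:[0,T]\to\mathbb{R}^d$, $T<\infty$, such that for almost every $t\in[0,T]$ either $\xi'(t)=0$, or there is $v\ge|\xi'(t)|$ with $(\xi(t)+\xi'(t)\mathbb{R},v)\in\Pi$. Its time length is $T(\xi)=T$. The support of $\xi$ is the set of lines $l$ of $\Pi$ such that $l\cap\xi([0,T])$ has positive one-dimensional Hausdorff measure. For a set $\mathcal{L}$ of lines, $\Pi_{\mathcal{L}}$ is the restriction of $\Pi$ to lines of $\mathcal{L}$, and $\Pi^{xy}_{\mathcal{L}}$ denotes the set of finite-time $\Pi$-paths $\xi$ from $x$ to $y$ (i.e. $\xi(0)=x$, $\xi(T(\xi))=y$) whose support is included in $\mathcal{L}$. For $s>0$, $A^s=A\oplus B(0,s)$ (Minkowski sum). $\mu^{(o)}_{d-1}$ is the rotation-invariant probability measure on the set of directions (lines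 through the origin of $\mathbb{R}^d$, i.e. the sphere $\mathbb{S}^{d-1}$ with antipodal points identified); $\mu^{(o)}_{d-1}([F-x])$ is the measure of the set of directions of lines through the origin hitting $F-x$, i.e. of lines through $x$ hitting $F$.
   Formalization: The set [F] of lines hitting F is assumed measurable for the completion of μ_d (true for every Borel F), so that the restriction of Π to lines avoiding F is a well-defined Poisson process; the English takes F arbitrary. *)

(* Defs.v *)
From HB Require Import structures.
From mathcomp Require Import all_boot all_order all_algebra.
From mathcomp Require Import all_classical all_reals all_analysis.
From mathcomp Require Import measurable_realfun.

Set Implicit Arguments.
Unset Strict Implicit.
Unset Printing Implicit Defensive.
Import Order.TTheory GRing.Theory Num.Theory.
Import numFieldNormedType.Exports.
Local Open Scope classical_set_scope.
Local Open Scope ring_scope.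

Section euclidean_space.
Context {R : realType} {d : nat}.
Implicit Types (x y : 'rV[R]_d) (A : set 'rV[R]_d) (r : R).

(* The library norm on row vectors is the sup norm. *)
Definition enorm x : R := Num.sqrt (\sum_i x 0 i ^+ 2).

(* Thickenings use open balls and coverings use closed ones: among the possible
   conventions this makes the hypotheses weakest and the allowed set of lines
   smallest. *)
Definition eball x r : set 'rV[R]_d := [set y | enorm (y - x) < r].

Definition closed_eball x r : set 'rV[R]_d := [set y | enorm (y - x) <= r].

Definition thickening A r : set 'rV[R]_d :=
  [set a + b | a in A & b in eball 0 r].

Definition translate A x : set 'rV[R]_d := [set y + x | y in A].

Definition isometry (f : 'rV[R]_d -> 'rV[R]_d) : Prop :=
  forall x y, enorm (f x - f y) = enorm (x - y).

Definition rotation (f : 'rV[R]_d -> 'rV[R]_d) : Prop :=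
  exists Q : 'M[R]_d, [/\ Q *m Q^T = 1%:M, \det Q = 1 & f = mulmx^~ Q].

Definition is_line (l : set 'rV[R]_d) : Prop :=
  exists x u, u != 0 /\ l = [set x + t *: u | t in setT].

Local Open Scope ereal_scope.

(* The element 0 makes the diameter of the empty set 0 instead of -oo. *)
Definition diam A : \bar R :=
  ereal_sup ([set 0] `|` [set (enorm (x - y)%R)%:E | x in A & y in A]).

(* One-dimensional Hausdorff (outer) measure. *)
Definition hausdorff1 A : \bar R :=
  ereal_sup [set ereal_inf
      [set \sum_(0 <= i <oo) diam (U i) | U in
         [set U : nat -> set 'rV[R]_d |
            A `<=` \bigcup_i U i /\ forall i, diam (U i) <= delta%:E]]
    | delta in [set delta : R | (0 < delta)%R]].

End euclidean_space.

(* Hyperarea of the unit sphere of dimension m: |S^0| = 2, |S^1| = 2 pi and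
   |S^(m+2)| = 2 pi / (m+1) |S^m|. *)
Fixpoint sphere_area (R : realType) (m : nat) : R :=
  match m with
  | 0 => 2
  | 1 => 2 * pi
  | (m'.+1 as k).+1 => 2 * pi / k%:R * sphere_area R m'
  end.

Record line (R : realType) (d : nat) :=
  Line { line_set :> set 'rV[R]_d ; line_setP : is_line line_set }.

Lemma is_line_axis (R : realType) (n : nat) :
  is_line [set 0 + t *: (const_mx 1 : 'rV[R]_n.+1) | t in setT].
Proof.
exists 0, (const_mx 1); split => //.
by apply/eqP => /rowP /(_ ord0) /eqP; rewrite !mxE oner_eq0.
Qed.

HB.instance Definition _ (R : realType) (d : nat) := gen_eqMixin (line R d).
HB.instance Definition _ (R : realType) (d : nat) := gen_choiceMixin (line R d).
(* Measurable types are pointed, hence the restriction to positive dimension. *)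
HB.instance Definition _ (R : realType) (n : nat) :=
  isPointed.Build (line R n.+1) (Line (is_line_axis R n)).

Definition hitting {R : realType} {d : nat} (K : set 'rV[R]_d) : set (line R d) :=
  [set l : line R d | l `&` K !=set0].

(* The sigma-algebra generated by the sets of lines hitting an open set, which
   is the Borel sigma-algebra of the usual topology on the space of lines. *)
Definition open_hittings (R : realType) (d : nat) : set (set (line R d)) :=
  [set hitting G | G in open].

HB.instance Definition _ (R : realType) (n : nat) :=
  @isMeasurable.Build (sigma_display (@open_hittings R n.+1)) (line R n.+1)
    <<s @open_hittings R n.+1 >> (@sigma_algebra0 _ setT _)
    (@sigma_algebraC _ _) (@sigma_algebra_bigcup _ setT _).

Section line_measures.
Context {R : realType} {n : nat}.
Local Notation d := n.+1.
Local Open Scope ereal_scope.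

Definition line_preimage (f : 'rV[R]_d -> 'rV[R]_d) (B : set (line R d)) :
    set (line R d) :=
  [set l | exists2 l' : line R d, B l' & l' = f @` l :> set 'rV[R]_d].

Definition is_invariant_line_measure
    (mu : {measure set (line R d) -> \bar R}) : Prop :=
  (forall f B, isometry f -> measurable B -> mu (line_preimage f B) = mu B) /\
  (forall x r, (0 < r)%R ->
     mu (hitting (eball x r)) = (sphere_area R d.-1 / 2 * r ^+ d.-1)%:E).

(* Directions are lines through the origin. *)
Definition is_uniform_direction (sigma : probability (line R d) R) : Prop :=
  sigma (hitting [set 0%R]) = 1 /\
  forall f B, rotation f -> measurable B -> sigma (line_preimage f B) = sigma B.

(* The library's mu_ext is the outer measure induced by sigma; it agrees with
   sigma on measurable sets. *)
Definition solid_angle (sigma : probability (line R d) R) (F : set 'rV[R]_d)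
    (x : 'rV[R]_d) : \bar R :=
  mu_ext sigma (hitting (translate F (- x))).

(* Measurability with respect to the completion of mu. *)
Definition mu_measurable (mu : {measure set (line R d) -> \bar R})
    (L : set (line R d)) : Prop :=
  exists2 B, measurable B & mu.-negligible ((L `\` B) `|` (B `\` L)).

Definition marked_line_intensity (mu : {measure set (line R d) -> \bar R})
    (gamma : R) (B : set (line R d * R)) : \bar R :=
  \int[mu]_l \int[lebesgue_measure]_(v in `]0%R, +oo[)
    (\1_B (l, v) * ((gamma - 1) * v `^ (- gamma)))%:E.

End line_measures.

Section probability.
Context {R : realType} {dO : measure_display} {Omega : measurableType dO}.
Variable P : probability Omega R.
Local Open Scope ereal_scope.

Definition point_count {T : choiceType} (Pi : Omega -> set T) (B : set T)
    (w : Omega) : \bar R :=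
  counting (Pi w `&` B).

Definition is_poisson_process {dT : measure_display} {T : measurableType dT}
    (Pi : Omega -> set T) (Lambda : set T -> \bar R) : Prop :=
  [/\ forall B, measurable B -> measurable_fun setT (point_count Pi B),
      forall B (k : nat), measurable B -> Lambda B \is a fin_num ->
        P (point_count Pi B @^-1` [set k%:R%:E]) =
        (fine (Lambda B) ^+ k / k`!%:R * expR (- fine (Lambda B)))%:E,
      forall B, measurable B -> Lambda B = +oo ->
        P (point_count Pi B @^-1` [set +oo]) = 1
    & forall m (B : 'I_m -> set T) (Y : 'I_m -> set (\bar R)),
        (forall i, measurable (B i)) -> trivIset setT B ->
        (forall i, measurable (Y i)) ->
        P (\bigcap_(i in [set: 'I_m]) (point_count Pi (B i) @^-1` Y i)) =
        \prod_(i < m) P (point_count Pi (B i) @^-1` Y i)].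

(* Inner probability of a possibly non-measurable event. *)
Definition inner_probability (E : set Omega) : \bar R :=
  ereal_sup [set P D | D in [set D | measurable D /\ D `<=` E]].

(* Upper expectation of a nonnegative, possibly non-measurable function. *)
Definition upper_expectation (X : Omega -> \bar R) : \bar R :=
  ereal_inf [set \int[P]_w Y w | Y in
    [set Y : Omega -> \bar R | measurable_fun setT Y /\ forall w, X w <= Y w]].

End probability.

Section pi_paths.
Context {R : realType} {d : nat}.
Variable Pi : set (line R d * R).

(* xi : [0, T] -> R^d is represented by a function on R whose values outside
   [0, T] are irrelevant. Lipschitz continuity refers to the sup norm, which is
   equivalent to the Euclidean one; speeds are Euclidean. *)
Definition pi_path (T : R) (xi : R -> 'rV[R]_d) : Prop :=
  [/\ 0 <= T,
      forall t, t \in `[0, T] -> exists2 U, nbhs t U &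
        [lipschitz xi s | s in `[0, T]%classic `&` U]
    & {ae lebesgue_measure, forall t : R, t \in `[0, T] ->
        derivable xi t 1 /\
        (xi^`()%classic t = 0 \/
         exists (l : line R d) (v : R),
           [/\ Pi (l, v), enorm (xi^`()%classic t) <= v &
               l = [set xi t + s *: xi^`()%classic t | s in setT] :> set _])}].

Definition path_support (T : R) (xi : R -> 'rV[R]_d) : set (line R d) :=
  [set l | (exists v, Pi (l, v)) /\
           (0 < hausdorff1 (l `&` xi @` `[0%R, T]%classic))%E].

Definition path_times (L : set (line R d)) (x y : 'rV[R]_d) : set R :=
  [set T | exists xi, [/\ pi_path T xi, xi 0 = x, xi T = y &
                          path_support T xi `<=` L]].

Definition time_diameter (L : set (line R d)) (A : set 'rV[R]_d) : \bar R :=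
  ereal_sup [set ereal_inf [set T%:E | T in path_times L x y]
            | x in A & y in A].

End pi_paths.

(* Main.v *)
From HB Require Import structures.
Require Import Defs.
From mathcomp Require Import all_boot all_order all_algebra.
From mathcomp Require Import all_classical all_reals all_analysis.
From mathcomp Require Import measurable_realfun.
From mathcomp Require Import ring lra.
Set Implicit Arguments.
Unset Strict Implicit.
Unset Printing Implicit Defensive.
Import Order.TTheory GRing.Theory Num.Theory.
Import numFieldNormedType.Exports.
Local Open Scope classical_set_scope.
Local Open Scope ring_scope.

(* Pick alpha_min < al < alpha and 2 / al < beta < al^(-(d-1)/(gamma-1)), which is possible
   because al^((gamma-d)/(gamma-1)) > 2. At level k consider nodes on a grid of mesh a fixed fraction of the scale
   r / (4 alpha al^k), and call two of them linked when a line of speed at least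
   v_k = v0 * beta^k avoiding F passes at distance less than the next scale from both.

   Linking. Around a point z, the directions of the lines through z passing close to a given
   point at distance comparable to the scale contain a cap of sine s = 1 / alpha. A maximal
   separated family of directions has at most (4 / s)^(d-1) members and its caps cover the
   sphere, so each cap has angle at least (s / 4)^(d-1) > Omega and is not exhausted by the
   directions of lines hitting F. Averaging translates over a small cube turns this
   into a lower bound of order scale^(d-1) for the measure of the linking lines, hence into a
   Poisson mean of order v_k^(1-gamma) scale_k^(d-1), which grows geometrically in k. With v0
   tuned to ln (1/eps), a union bound over levels and pairs of nodes shows that all pairs are
   linked with probability at least 1 - eps.

   Path. When all pairs are linked, two points at distance at most scale_k are joined by a
   straight piece of length at most 3 scale_k on a line of speed v_k, and two recursive calls
   at level k + 1. The times add up to a geometric series of ratio 2 / (al * beta) < 1, the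
   unresolved time intervals have total length tending to 0, and the limit curve is a
   Pi-path. Chaining along a grid of cells covering the connected set A gives the bound. *)

(** * Euclidean geometry and measurability in the space of lines *)

(** The hypothesis on F concerns directions through one point, while a Poisson mean is a [mu]-mass
    of lines. The bridge is that, under [mu], the direction of a line hitting a fixed ball is
    distributed as a multiple of [sigma]; this uniqueness is proved by comparing masses of caps,
    which rotation invariance makes equal. Since [F] is measurable only up to a [mu]-null set, and
    the set of its directions through a point perhaps not at all, directions are compared in outer
    measure. Grid nodes are used because lines must be found for uncountably many pairs of points by
    countably many Poisson events. The gap between 1 / [alpha] and 1 / [al] pays for rounding to the
    grid. Successive entry and exit points drift away from A, but by less than the first scale r /
    (4 [alpha]), which is below r / ([alpha] - 1), so the angle hypothesis applies at every node
    used. The constant T1 cannot depend on N: as eps is below 1 / (2 N), the N^2 pairs of balls cost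
    at most eps^(-2), paid by a larger multiple of ln (1 / eps) in the Poisson means. N enters the
    final bound only through the length of the chain. *)

Section euclid.
Context {R : realType} {d : nat}.
Implicit Types (x y z u : 'rV[R]_d) (a b : R).

Definition dot x y : R := \sum_i x 0 i * y 0 i.

Lemma dotC x y : dot x y = dot y x.
Proof. by apply: eq_bigr => i _; rewrite mulrC. Qed.

Lemma dotDl x y z : dot (x + y) z = dot x z + dot y z.
Proof. by rewrite -big_split; apply: eq_bigr => i _; rewrite !mxE mulrDl. Qed.

Lemma dotZl a x y : dot (a *: x) y = a * dot x y.
Proof. by rewrite mulr_sumr; apply: eq_bigr => i _; rewrite !mxE mulrA. Qed.

Lemma dotDr x y z : dot z (x + y) = dot z x + dot z y.
Proof. by rewrite dotC dotDl !(dotC z). Qed.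

Lemma dotZr a x y : dot x (a *: y) = a * dot x y.
Proof. by rewrite dotC dotZl dotC. Qed.

Lemma dotNl x y : dot (- x) y = - dot x y.
Proof. by rewrite -scaleN1r dotZl mulN1r. Qed.

Lemma dotNr x y : dot x (- y) = - dot x y.
Proof. by rewrite dotC dotNl dotC. Qed.

Lemma dot0l x : dot 0 x = 0.
Proof. by rewrite -(scale0r x) dotZl mul0r. Qed.

Lemma dotxx_ge0 x : 0 <= dot x x.
Proof. by apply: sumr_ge0 => i _; rewrite -expr2 sqr_ge0. Qed.

Lemma dotxx_eq0 x : (dot x x == 0) = (x == 0).
Proof.
apply/idP/eqP => [|->]; last by rewrite dot0l.
rewrite psumr_eq0 => [/allP h|i _]; last by rewrite -expr2 sqr_ge0.
apply/rowP => i; rewrite mxE; apply/eqP.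
by have := h i (mem_index_enum i); rewrite /= mulf_eq0 orbb.
Qed.

Lemma dotxx_gt0 x : (0 < dot x x) = (x != 0).
Proof. by rewrite lt_def dotxx_ge0 andbT dotxx_eq0. Qed.

Lemma enormE x : enorm x = Num.sqrt (dot x x).
Proof. by congr Num.sqrt; apply: eq_bigr => i _; rewrite expr2. Qed.

Lemma enorm_ge0 x : 0 <= enorm x.
Proof. exact: sqrtr_ge0. Qed.

Lemma sqr_enorm x : enorm x ^+ 2 = dot x x.
Proof. by rewrite enormE sqr_sqrtr // dotxx_ge0. Qed.

Lemma enorm_eq0 x : (enorm x == 0) = (x == 0).
Proof. by rewrite -sqrf_eq0 sqr_enorm dotxx_eq0. Qed.

Lemma enorm0 : enorm (0 : 'rV[R]_d) = 0.
Proof. by apply/eqP; rewrite enorm_eq0. Qed.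

Lemma enorm_gt0 x : (0 < enorm x) = (x != 0).
Proof. by rewrite lt_def enorm_ge0 andbT enorm_eq0. Qed.

Lemma enormZ a x : enorm (a *: x) = `|a| * enorm x.
Proof.
by rewrite !enormE dotZl dotZr mulrA -expr2 sqrtrM ?sqr_ge0 // sqrtr_sqr.
Qed.

Lemma enormN x : enorm (- x) = enorm x.
Proof. by rewrite -scaleN1r enormZ normrN1 mul1r. Qed.

Lemma enormB x y : enorm (x - y) = enorm (y - x).
Proof. by rewrite -enormN opprB. Qed.

Lemma cauchy_schwarz x y : dot x y ^+ 2 <= dot x x * dot y y.
Proof.
have [->|y0] := eqVneq y 0; first by rewrite dotC !dot0l mulr0 expr0n.
have y1 : 0 < dot y y by rewrite dotxx_gt0.
have := dotxx_ge0 (dot y y *: x - dot x y *: y).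
rewrite dotDl !dotDr !dotNl !dotNr !dotZl !dotZr (dotC y x) => h.
have : 0 <= dot y y * (dot x x * dot y y - dot x y ^+ 2) by nra.
by rewrite pmulr_rge0 // subr_ge0.
Qed.

Lemma ler_enormD x y : enorm (x + y) <= enorm x + enorm y.
Proof.
rewrite -(@ler_pXn2r _ 2) ?nnegrE ?addr_ge0 ?enorm_ge0 //.
rewrite sqrrD !sqr_enorm dotDl !dotDr (dotC y x).
suff : dot x y <= enorm x * enorm y by rewrite -mulr_natr; lra.
rewrite (le_trans (ler_norm _)) // -(@ler_pXn2r _ 2) ?nnegrE ?mulr_ge0 ?enorm_ge0 //.
by rewrite real_normK ?num_real // exprMn !sqr_enorm cauchy_schwarz.
Qed.

Lemma ler_enormB x y z : enorm (x - z) <= enorm (x - y) + enorm (y - z).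
Proof. by apply: le_trans (ler_enormD _ _); rewrite addrA subrK. Qed.

Lemma coord_le_enorm x i : `|x 0 i| <= enorm x.
Proof.
rewrite -(@ler_pXn2r _ 2) ?nnegrE ?enorm_ge0 // real_normK ?num_real //.
rewrite sqr_enorm expr2 /dot (bigD1 i) //= lerDl.
by apply: sumr_ge0 => j _; rewrite -expr2 sqr_ge0.
Qed.

Lemma enorm_le_coord x a : (forall i, `|x 0 i| <= a) -> enorm x <= d%:R * a.
Proof.
move=> xa; have [a0|a0] := leP 0 a.
  rewrite -(@ler_pXn2r _ 2) ?nnegrE ?enorm_ge0 ?mulr_ge0 // sqr_enorm.
  apply: (@le_trans _ _ (\sum_(i < d) a ^+ 2)).
    apply: ler_sum => i _; rewrite -expr2 -[leLHS]real_normK ?num_real //.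
    by rewrite ler_pXn2r ?nnegrE.
  rewrite sumr_const card_ord exprMn -[leLHS]mulr_natl ler_wpM2r ?sqr_ge0 //.
  by rewrite -natrX ler_nat; case: (d) => // k; rewrite leq_pmulr.
have d0 : forall i : 'I_d, False.
  by move=> i; have := le_lt_trans (xa i) a0; rewrite ltNge normr_ge0.
have -> : x = 0 by apply/rowP => i; case: (d0 i).
rewrite enorm0; case: {+}d d0 => [|k] h; first by rewrite mul0r.
by case: (h ord0).
Qed.

Lemma mx_norm_le_enorm x : `|x| <= enorm x.
Proof.
rewrite /Num.norm /= mx_normE.
elim/big_ind: _ => [|a b ha hb|[i j] _ /=]; first exact: enorm_ge0.
  by rewrite num_max // ge_max ha.
by rewrite (ord1 i) coord_le_enorm.
Qed.

Lemma enorm_le_mx_norm x : enorm x <= d%:R * `|x|.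
Proof.
apply: enorm_le_coord => i; rewrite {2}/Num.norm /= mx_normE.
exact: (le_bigmax _ (fun ij : 'I_1 * 'I_d => `|x ij.1 ij.2|%:nng) (0, i)).
Qed.

End euclid.

Section hits.
Context {R : realType} {d : nat}.
Local Notation E := ('rV[R]_d).

(** A base of the topology indexed by a countable type; it turns conditions on open sets into
    countable unions. The balls are those of the sup norm, so membership is a condition on each
    coordinate. *)
Definition rat_ball (i : 'rV[rat]_d * nat) : set E :=
  ball (map_mx ratr i.1 : E) (i.2.+1%:R^-1).

Lemma rat_ball_open i : open (rat_ball i).
Proof. exact: ball_open. Qed.

Lemma rat_ball_nbhs (x : E) (U : set E) :
  nbhs x U -> exists2 i, rat_ball i x & rat_ball i `<=` U.
Proof.
move=> /nbhs_ballP [e /= e0 xU].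
have e20 : 0 < e / 2 by rewrite divr_gt0.
have [k kP] : exists k : nat, (k.+1%:R : R)^-1 < e / 2.
  exists (Num.bound ((e / 2)^-1)).
  rewrite invf_plt ?posrE // (lt_trans (archi_boundP _)) ?invr_ge0 ?(ltW e20) //.
  by rewrite ltr_nat.
have k0 : 0 < (k.+1%:R : R)^-1 by rewrite invr_gt0.
have /choice [c cP] : forall j : 'I_d, exists q : rat,
    ratr q \in `]x 0 j - k.+1%:R^-1, x 0 j + k.+1%:R^-1[.
  by move=> j; apply: rat_in_itvoo; rewrite ltrD2l gtrN.
have cx : ball (map_mx ratr (\row_j c j) : E) (k.+1%:R^-1) x.
  split => // i j; rewrite (ord1 i) !mxE /ball /= ltr_norml.
  have := cP j; rewrite in_itv /= => /andP[h1 h2]; apply/andP; split; [rewrite ltrBrDl; exact: h1|rewrite ltrBlDl; exact: h2].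
exists (\row_j c j, k) => // y cy; apply: xU.
apply: (@le_ball _ _ _ (k.+1%:R^-1 + k.+1%:R^-1)); first by rewrite [leRHS]splitr lerD // ltW.
by apply: ball_triangle cy; exact: ball_sym.
Qed.

End hits.

Section hit_measurability.
Context {R : realType} {d : nat}.
Local Notation E := ('rV[R]_d).
Context d1 d2 (T1 : measurableType d1) (T2 : measurableType d2).

(** An open set of pairs is the countable union of the products of rational balls that it contains,
    and hitting such a product is a condition on each factor separately. The measurability of
    closeness of directions, of [dir] and of translations rests on this. *)
Lemma measurable_hit2 (h1 : T1 -> set E) (h2 : T2 -> set E) (W : set (E * E)) :
  (forall G, open G -> measurable [set t | h1 t `&` G !=set0]) ->
  (forall G, open G -> measurable [set t | h2 t `&` G !=set0]) ->
  open W ->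
  measurable [set t : T1 * T2 | exists p q, [/\ h1 t.1 p, h2 t.2 q & W (p, q)]].
Proof.
move=> m1 m2 oW.
pose F (ij : ('rV[rat]_d * nat) * ('rV[rat]_d * nat)) : set (T1 * T2) :=
  if `[< rat_ball ij.1 `*` rat_ball ij.2 `<=` W >] then
    [set t | h1 t `&` rat_ball ij.1 !=set0] `*` [set t | h2 t `&` rat_ball ij.2 !=set0]
  else set0.
rewrite (_ : [set t | _] = \bigcup_ij F ij).
  apply: countable_bigcupT_measurable => [|ij]; first exact: countableP.
  rewrite /F; case: ifP => _ //.
  by apply: measurableX; [apply: m1|apply: m2]; exact: rat_ball_open.
apply/seteqP; split => [[t1 t2] /= [p [q [h1p h2q Wpq]]]|[t1 t2] [ij _]].
  have /= [[U V] /= [pU qV] UV] := open_nbhs_nbhs (conj oW Wpq).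
  have [i ip iU] := rat_ball_nbhs pU; have [j jq jV] := rat_ball_nbhs qV.
  exists (i, j) => //; rewrite /F; case: asboolP => [_|] /=.
    by split; [exists p|exists q].
  by case => -[a b] [/= /iU Ua /jV Vb]; exact: UV.
rewrite /F; case: asboolP => //= sW [[p [h1p ip]] [q [h2q jq]]].
by exists p, q; split => //; exact: sW.
Qed.

End hit_measurability.

Section line_sigma.
Context {R : realType} {n : nat}.
Local Notation d := n.+1.
Local Notation E := ('rV[R]_d).

Lemma measurable_hitting (G : set E) : open G -> measurable (@hitting R d G).
Proof. by move=> oG; apply: sub_sigma_algebra; exists G. Qed.

Lemma measurable_to_line dT (T : measurableType dT) (f : T -> line R d) :
  (forall G, open G -> measurable [set t | f t `&` G !=set0]) ->
  measurable_fun setT f.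
Proof.
move=> mf; apply: (measurability (@open_hittings R d)) => //.
by move=> _ [_ [G oG <-] <-]; rewrite setTI; exact: mf.
Qed.

End line_sigma.

Notation "p \on l" := (line_set l p) (at level 70, l at level 69).

Section lines.
Context {R : realType} {d : nat}.
Local Notation E := ('rV[R]_d).
Implicit Types (l u : line R d) (p q z : E).

Lemma line_inj l l' : l = l' :> set E -> l = l'.
Proof.
case: l l' => [s sP] [s' s'P] /= e; subst s'; congr Line.
exact: Prop_irrelevance.
Qed.

(** The parallel line through the origin. Taking all differences of points avoids the choice of a
    direction vector and makes measurability an instance of [measurable_hit2]. *)
Definition dir_set l : set E := [set z | exists p q, [/\ p \on l, q \on l & z = q - p]].

Lemma dir_setE l p v : l = [set p + t *: v | t in setT] :> set E ->
  dir_set l = [set t *: v | t in setT].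
Proof.
move=> lE; apply/seteqP; split => z /=.
  move=> [q [q' []]]; rewrite lE => -[t _ <-] [t' _ <-] ->.
  by exists (t' - t) => //; rewrite opprD addrACA subrr add0r scalerBl.
move=> [t _ <-]; exists p, (p + t *: v); split; last by rewrite addrC addKr.
  by rewrite lE; exists 0 => //; rewrite scale0r addr0.
by rewrite lE; exists t.
Qed.

Lemma dir_is_line l : is_line (dir_set l).
Proof.
case: (line_setP l) => p [v [v0 lE]]; exists 0, v; split => //.
rewrite (dir_setE lE); apply/seteqP.
by split => _ [t _ <-]; exists t => //; rewrite add0r.
Qed.

Definition dir l : line R d := Line (dir_is_line l).

Lemma line_paramE l p v : p \on l -> v \on dir l -> v != 0 ->
  l = [set p + t *: v | t in setT] :> set E.
Proof.
case: (line_setP l) => p0 [v0 [v00 lE]].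
rewrite /= (dir_setE lE) lE => -[s _ <-] [t _ <-] tv0.
have t0 : t != 0 by apply: contraNneq tv0 => ->; rewrite scale0r.
apply/seteqP; split => _ [r _ <-].
  exists ((r - s) / t) => //.
  by rewrite scalerA divfK // -addrA -scalerDl [s + _]addrC subrK.
by exists (s + r * t) => //; rewrite scalerDl addrA scalerA.
Qed.

Lemma lineP l p : p \on l ->
  exists2 v, v != 0 & l = [set p + t *: v | t in setT] :> set E.
Proof.
move=> lp; case: (line_setP l) => p0 [v [v0 lE]]; exists v => //.
by apply: line_paramE => //; rewrite /= (dir_setE lE); exists 1 => //; rewrite scale1r.
Qed.

Lemma line_neq0 l : exists p, p \on l.
Proof.
by case: (line_setP l) => p [v [_ ->]]; exists p, 0 => //; rewrite scale0r addr0.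
Qed.

Lemma dirP l p q : p \on l -> q \on l <-> q - p \on dir l.
Proof.
move=> lp; split => [lq|]; first by exists p, q.
have [v v0 lE] := lineP lp.
rewrite /= (dir_setE lE) lE => -[t _ tE]; exists t => //.
by rewrite tE addrC subrK.
Qed.

Definition thru0 : set (line R d) := hitting [set 0].

Lemma thru0P u : thru0 u <-> 0 \on u.
Proof. by split => [[p [up /= p0]]|u0]; [rewrite -p0|exists 0]. Qed.

Lemma thru0_dir l : thru0 (dir l).
Proof. by apply/thru0P; have [p lp] := line_neq0 l; exists p, p; rewrite subrr. Qed.

Lemma dir_thru0 u : thru0 u -> dir u = u.
Proof.
move=> /thru0P u0; have h z : z \on u <-> z \on dir u.
  by rewrite -{2}(subr0 z); exact: dirP.
by apply: line_inj; apply/seteqP; split => z /h.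
Qed.

Lemma thru0_scale u p v : thru0 u -> p \on u -> p != 0 -> v \on u <-> exists t, v = t *: p.
Proof.
move=> u0 up p0; have /thru0P u00 := u0.
rewrite (line_paramE u00 _ p0) ?dir_thru0 //; split => [[t _ <-]|[t ->]].
  by exists t; rewrite add0r.
by exists t => //; rewrite add0r.
Qed.

Lemma thru0_neq0 u : thru0 u -> exists2 p, p \on u & p != 0.
Proof.
move=> /thru0P /lineP[v v0 uE]; exists v => //.
by rewrite uE; exists 1 => //; rewrite scale1r add0r.
Qed.

Lemma is_line_span q : q != 0 -> is_line [set t *: q | t in setT].
Proof.
move=> q0; exists 0, q; split => //; apply/seteqP.
by split => _ [t _ <-]; exists t => //; rewrite add0r.
Qed.

Definition span_line q (q0 : q != 0) : line R d := Line (is_line_span q0).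

Lemma thru0_span q (q0 : q != 0) : thru0 (span_line q0).
Proof. by apply/thru0P; exists 0 => //; rewrite scale0r. Qed.

Lemma span_line_id q (q0 : q != 0) : q \on span_line q0.
Proof. by exists 1 => //; rewrite scale1r. Qed.

Lemma is_line_shift z l : is_line [set z + p | p in l].
Proof.
case: (line_setP l) => p [v [v0 lE]]; exists (z + p), v; split => //.
rewrite lE; apply/seteqP; split => y.
  by move=> [_ [t _ <-] <-]; exists t => //; rewrite addrA.
by move=> [t _ <-]; exists (p + t *: v); rewrite ?addrA //; exists t.
Qed.

Definition line_shift z l : line R d := Line (is_line_shift z l).

Lemma shiftP z l p : p \on line_shift z l <-> p - z \on l.
Proof.
split => [[q lq <-]|lp]; first by rewrite addrC addKr.
by exists (p - z) => //; rewrite addrC subrK.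
Qed.

Lemma shift_shift z z' l : line_shift z (line_shift z' l) = line_shift (z + z') l.
Proof.
apply: line_inj; apply/seteqP; split => p.
  by move=> /shiftP /shiftP h; apply/shiftP; rewrite opprD addrA.
by move=> /shiftP h; apply/shiftP/shiftP; rewrite -addrA -opprD.
Qed.

Lemma shift_dir l p : p \on l -> line_shift p (dir l) = l.
Proof.
move=> lp; apply: line_inj; apply/seteqP; split => q.
  by move=> /shiftP /(dirP q lp).
by move=> lq; apply/shiftP/(dirP q lp).
Qed.

(* [near_dir s] holds for two lines through 0 when the sine of their angle is less than s. *)
Definition near_dir (s : R) (u u' : line R d) : Prop := exists p q,
  [/\ p \on u, q \on u' & (1 - s ^+ 2) * (dot p p * dot q q) < dot p q ^+ 2].

Lemma near_dirC s u u' : near_dir s u u' <-> near_dir s u' u.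
Proof.
by split => -[p [q [up uq h]]]; exists q, p; split => //; rewrite dotC (mulrC (dot q q)).
Qed.

(** Both sides are homogeneous of degree two in [p] and in [q], so a single pair of nonzero vectors
    decides; strictness prevents the pair witnessing [near_dir] from containing zero. *)
Lemma near_dirP s u u' p q : thru0 u -> thru0 u' -> p \on u -> q \on u' ->
  p != 0 -> q != 0 ->
  near_dir s u u' <-> (1 - s ^+ 2) * (dot p p * dot q q) < dot p q ^+ 2.
Proof.
move=> u0 u0' up uq p0 q0; split; last by exists p, q.
move=> [p' [q' []]] /(thru0_scale _ u0 up p0)[a ->].
move=> /(thru0_scale _ u0' uq q0)[b ->].
rewrite !dotZl !dotZr.
rewrite [ltRHS](_ : _ = (a ^+ 2 * b ^+ 2) * dot p q ^+ 2); last ring.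
rewrite [ltLHS](_ : _ = (a ^+ 2 * b ^+ 2) * ((1 - s ^+ 2) * (dot p p * dot q q))); last ring.
move=> h.
have ab0 : 0 <= a ^+ 2 * b ^+ 2 by rewrite mulr_ge0 ?sqr_ge0.
have ab : 0 < a ^+ 2 * b ^+ 2.
  rewrite lt_def ab0 andbT; apply/eqP => e.
  by move: h; rewrite e !mul0r ltxx.
by rewrite ltr_pM2l in h.
Qed.

(* The point is the orthogonal projection of [p] on [u']. *)
Lemma near_dir_close s u u' p : 0 <= s -> thru0 u -> thru0 u' -> p \on u -> p != 0 ->
  near_dir s u u' -> exists2 q, q \on u' & enorm (q - p) < s * enorm p.
Proof.
move=> s0 u0 u0' up p0; have [e ue e0] := thru0_neq0 u0'.
move=> /(near_dirP _ u0 u0' up ue p0 e0) h.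
have ee : 0 < dot e e by rewrite dotxx_gt0.
exists ((dot p e / dot e e) *: e).
  by apply/(thru0_scale _ u0' ue e0); exists (dot p e / dot e e).
rewrite -(@ltr_pXn2r _ 2) ?nnegrE ?mulr_ge0 ?enorm_ge0 // exprMn !sqr_enorm.
rewrite dotDl !dotDr !dotNl !dotNr !dotZl !dotZr (dotC e p) -(ltr_pM2l ee).
rewrite [ltLHS](_ : _ = dot p p * dot e e - dot p e ^+ 2); last by field; rewrite gt_eqF.
lra.
Qed.

End lines.
Arguments thru0 {R d}.

(** * Rotations as products of two reflections *)

Section rotations.
Context {R : realType} {d : nat}.
Local Notation E := ('rV[R]_d).
Implicit Types (x y w : E).

Lemma dotE x y : dot x y = (x *m y^T) 0 0.
Proof. by rewrite mxE; apply: eq_bigr => i _; rewrite mxE. Qed.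

Lemma dot_orth (Q : 'M[R]_d) x y : Q *m Q^T = 1%:M -> dot (x *m Q) (y *m Q) = dot x y.
Proof. by move=> QQ; rewrite !dotE trmx_mul mulmxA -(mulmxA x) QQ mulmx1. Qed.

Lemma orth_isometry (Q : 'M[R]_d) : Q *m Q^T = 1%:M -> Defs.isometry (mulmx^~ Q).
Proof. by move=> QQ x y; rewrite -mulmxBl !enormE dot_orth. Qed.

(** The reflection in the hyperplane orthogonal to [w], acting on row vectors. *)
Definition householder w : 'M[R]_d := 1%:M - (2 / dot w w) *: (w^T *m w).

Lemma mul_householder x w : x *m householder w = x - (2 * dot x w / dot w w) *: w.
Proof.
rewrite mulmxBr mulmx1 -scalemxAr mulmxA [x *m w^T]mx11_scalar mul_scalar_mx -dotE.
by rewrite scalerA mulrAC.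
Qed.

Lemma tr_householder w : (householder w)^T = householder w.
Proof. by rewrite raddfB /= linearZ /= trmx_mul trmxK trmx1. Qed.

Lemma householder_invol w : w != 0 -> householder w *m householder w = 1%:M.
Proof.
move=> w0; have ww : dot w w != 0 by rewrite dotxx_eq0.
apply/row_matrixP => i; rewrite rowE mulmxA !mul_householder [RHS]rowE mulmx1.
rewrite dotDl dotNl dotZl -addrA -opprD -scalerDl.
rewrite [X in X *: _](_ : _ = 0) ?scale0r ?subr0 //.
by field.
Qed.

Lemma householder_swap x y : dot x x = dot y y -> x != y ->
  x *m householder (x - y) = y.
Proof.
rewrite -subr_eq0 => e xy; rewrite mul_householder.
rewrite (_ : _ / _ = 1); first by rewrite scale1r subKr.
have := xy; rewrite -dotxx_eq0 => h; apply: (mulIf h).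
rewrite mul1r divfK // !dotDl !dotDr !dotNl !dotNr (dotC y x) e; ring.
Qed.

Lemma householderZ a w : a != 0 -> householder (a *: w) = householder w.
Proof.
move=> a0; have [->|w0] := eqVneq w 0; first by rewrite scaler0.
have ww : dot w w != 0 by rewrite dotxx_eq0.
apply/row_matrixP => i; rewrite !rowE !mul_householder !dotZl !dotZr scalerA.
by congr (_ - _ *: _); field; rewrite a0 ww.
Qed.

(** The value -1 of the determinant is never computed: two reflections are conjugate by an
    involution, hence have the same determinant, and its square is 1. *)
Lemma det_householder2 w w' : w != 0 -> w' != 0 ->
  \det (householder w) * \det (householder w') = 1.
Proof.
wlog: w w' / dot w w = 1 /\ dot w' w' = 1 => [hw w0 w0'|[w1 w1'] w0 w0'].
  have n (x : E) : x != 0 -> dot ((enorm x)^-1 *: x) ((enorm x)^-1 *: x) = 1.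
    move=> x0; rewrite dotZl dotZr -sqr_enorm mulrA -expr2 -exprMn mulVf ?expr1n //.
    by rewrite enorm_eq0.
  have ni (x : E) : x != 0 -> (enorm x)^-1 != 0 by move=> x0; rewrite invr_eq0 enorm_eq0.
  rewrite -(householderZ w (ni _ w0)) -(householderZ w' (ni _ w0')).
  by apply: hw; rewrite ?scaler_eq0 ?negb_or ?ni ?n.
have sq v : v != 0 -> \det (householder v) * \det (householder v) = 1.
  by move=> v0; rewrite -det_mulmx householder_invol // det1.
suff -> : \det (householder w') = \det (householder w) by exact: sq.
have [->//|ww'] := eqVneq w w'.
have O0 : w - w' != 0 by rewrite subr_eq0.
have [H [HH HT wH]] : exists H : 'M[R]_d, [/\ H *m H = 1%:M, H^T = H & w *m H = w'].
  exists (householder (w - w')).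
  by rewrite householder_invol // tr_householder householder_swap // w1 w1'.
have -> : householder w' = H *m householder w *m H.
  apply/row_matrixP => i; rewrite !rowE !mulmxA !mul_householder.
  rewrite mulmxBl -scalemxAl -mulmxA HH mulmx1 w1 w1'.
  rewrite wH; congr (_ - (2 * _ / _) *: _).
  by rewrite -wH -{1}(mulmx1 (delta_mx 0 i)) -HH mulmxA dot_orth ?HT.
by rewrite !det_mulmx mulrAC -det_mulmx HH det1 mul1r.
Qed.

(** Two reflections compose to determinant 1: the first sends [x] to the multiple of [y] of the same
    length, the second only changes its sign, which is harmless because only the line spanned by [y]
    matters. *)
Lemma rotation_exists x y : x != 0 -> y != 0 ->
  exists Q : 'M[R]_d, [/\ Q *m Q^T = 1%:M, \det Q = 1 & exists a, x *m Q = a *: y].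
Proof.
move=> x0 y0; pose c := enorm x / enorm y.
have ex : enorm x != 0 by rewrite enorm_eq0.
have ey : enorm y != 0 by rewrite enorm_eq0.
have c0 : c != 0 by rewrite mulf_neq0 // invr_eq0.
have cy0 : c *: y != 0 by rewrite scaler_eq0 negb_or c0.
have e : dot x x = dot (c *: y) (c *: y).
  by rewrite dotZl dotZr -!sqr_enorm /c; field.
have [xy|xy] := eqVneq x (c *: y).
  exists 1%:M; split; [by rewrite trmx1 mulmx1|exact: det1|].
  by exists c; rewrite mulmx1.
exists (householder (x - c *: y) *m householder (c *: y)).
have xy0 : x - c *: y != 0 by rewrite subr_eq0.
split.
- rewrite trmx_mul !tr_householder mulmxA -(mulmxA (householder (x - _))).
  by rewrite householder_invol // mulmx1 householder_invol.
- by rewrite det_mulmx det_householder2.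
exists (- c); rewrite mulmxA (householder_swap e xy) mul_householder.
rewrite (_ : _ / _ = 2); last by rewrite mulfK // dotxx_eq0.
by rewrite scaleNr scaler_nat mulr2n opprD addNKr.
Qed.

End rotations.

(** * Caps, rotations and the invariant measures *)

Section measure_helpers.
Local Open Scope ereal_scope.
Context d (T : measurableType d) (R : realType).

(** The copy has the same values but carries the structure that the theorems on product measures ask
    for. *)
Lemma sigma_finite_pack (m : {measure set T -> \bar R}) : sigma_finite setT m ->
  exists m' : {sigma_finite_measure set T -> \bar R}, forall A, m' A = m A.
Proof.
move=> sf.
pose H1 := isSFinite.Build _ _ _ _ (sfinite_measure_sigma_finite sf).
pose H2 := isSigmaFinite.Build _ _ _ _ sf.
pose m' := HB.pack_for (SigmaFiniteMeasure.type T R) (Measure.sort m) H1 H2.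
by exists m'.
Qed.

Lemma pushforward_pack d' (T' : measurableType d') (m : {measure set T -> \bar R})
    (f : T -> T') : measurable_fun setT f ->
  exists m' : {measure set T' -> \bar R}, forall A, m' A = m (f @^-1` A).
Proof.
move=> mf.
by exists (measure_function_pushforward__canonical__measure_function_Measure m mf).
Qed.

Lemma scale_pack (m : {measure set T -> \bar R}) (r : R) : (0 <= r)%R ->
  exists m' : {measure set T -> \bar R}, forall A, m' A = r%:E * m A.
Proof. by move=> r0; exists (mscale (NngNum r0) m). Qed.

End measure_helpers.

(** * Volume and packing of directions *)

Section volume.
Context {R : realType}.

Lemma lebesgue_affine (c z : R) (A : set R) : 0 < c -> measurable A ->
  (c%:E * lebesgue_measure ((fun x : R => (c * x + z)%R) @^-1` A))%E = lebesgue_measure A.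
Proof.
move=> c0 mA.
have mf : measurable_fun setT (fun x : measurableTypeR R => (c * x + z : measurableTypeR R)%R).
  exact: measurable_funD.
have [m mE] := pushforward_pack lebesgue_measure mf.
have [m' m'E] := scale_pack m (ltW c0).
have -> : lebesgue_measure A = m' A.
  apply: lebesgue_measure_unique => //= _ [[a b] _ <-].
  rewrite m'E mE /=.
  rewrite (_ : _ @^-1` _ = [set` `](a - z) / c, (b - z) / c] ] :> set (measurableTypeR R)); last first.
    apply/seteqP; split => x /=; rewrite !in_itv /= ltr_pdivrMr // ler_pdivlMr //;
      by rewrite ltrBlDr lerBrDr (mulrC x).
  rewrite !lebesgue_measure_itv /= !lte_fin ltr_pM2r ?invr_gt0 // ltrD2r.
  case: ifPn => _; last by rewrite mule0.
  by rewrite -!EFinD -EFinM; congr EFin; field; rewrite gt_eqF.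
by rewrite m'E mE.
Qed.

Definition affine_tuple d (c : R) (z : 'I_d -> R) (t : d.-tuple R) : d.-tuple R :=
  [tuple c * tnth t i + z i | i < d].

Lemma measurable_affine_tuple d c (z : 'I_d -> R) :
  measurable_fun setT (affine_tuple c z).
Proof.
apply/measurable_fun_tnthP => i.
rewrite (_ : _ \o _ = fun t => (c * tnth t i + z i)%R); last first.
  by apply/funext => t /=; rewrite tnth_mktuple.
apply: measurable_funD => //; apply: measurable_funM => //.
exact: measurable_tnth.
Qed.

(** Lebesgue measure on tuples, built by induction as a product with the real line. The mass of the
    cube and the effect of dilations and translations are what packing and averaging ask of
    volume. *)
Lemma volume_exists d : exists m : {sigma_finite_measure set (d.-tuple R) -> \bar R},
  m [set t | forall i, `|tnth t i| <= 1] = (2 ^+ d)%:E /\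
  forall c (z : 'I_d -> R) B, 0 < c -> measurable B ->
    ((c ^+ d)%:E * m (affine_tuple c z @^-1` B))%E = m B.
Proof.
elim: d => [|d [m [m1 mA]]].
  have sf : sigma_finite setT (dirac [tuple] : {measure set (0.-tuple R) -> \bar R}).
    by apply: fin_num_fun_sigma_finite; [rewrite measure0|exact: fin_num_measure].
  have [m mE] := sigma_finite_pack sf.
  exists m; split; first by rewrite mE /= diracE mem_set // => -[].
  move=> c z B _ _; rewrite expr0 mul1e; congr (m _).
  by apply/seteqP; split => t /=; rewrite (tuple0 (affine_tuple _ _ _)) (tuple0 t).
pose leb : {sigma_finite_measure set (measurableTypeR R) -> \bar R} := lebesgue_measure.
pose T := (measurableTypeR R * d.-tuple R)%type.
pose C (xt : T) : d.+1.-tuple R := [the d.+1.-tuple R of xt.1 :: xt.2].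
pose D (t : d.+1.-tuple R) : T := (tnth t ord0, [tuple of behead t]).
have CK xt : D (C xt) = xt.
  by case: xt => x t; congr pair; apply: val_inj.
have mC : measurable_fun setT C by apply: measurable_cons.
have mD : measurable_fun setT D.
  by apply: measurable_fun_pair; [exact: measurable_tnth|exact: measurable_behead].
have [m' m'E] := pushforward_pack (leb \x m)%E mC.
have sf : sigma_finite setT m'.
  have /sigma_finiteP[F [TF ndF Foo]] := sigma_finiteT leb.
  have /sigma_finiteP[G [TG ndG Goo]] := sigma_finiteT m.
  have mFG k : measurable (F k `*` G k).
    by apply: measurableX; [exact: (Foo k).1|exact: (Goo k).1].
  exists (fun k => D @^-1` (F k `*` G k)).
    apply/seteqP; split => // t _.
    have [j _ Fj] : (\bigcup_i F i) (D t).1 by rewrite -TF.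
    have [k _ Gk] : (\bigcup_i G i) (D t).2 by rewrite -TG.
    exists (maxn j k) => //; split.
      by move: Fj; exact/subsetPset/ndF/leq_maxl.
    by move: Gk; exact/subsetPset/ndG/leq_maxr.
  move=> k; split; first by rewrite -[X in measurable X]setTI; apply: mD => //; exact: mFG.
  rewrite m'E (_ : _ @^-1` _ = F k `*` G k).
    have [? ?] := Foo k; have [? ?] := Goo k.
    by rewrite /= product_measure1E// lte_mul_pinfty// ge0_fin_numE.
  by apply/funext => xt; exact: (congr1 _ (CK xt)).
have [m2 m2E] := sigma_finite_pack sf.
exists m2; split.
  have mcube : measurable [set t : d.-tuple R | forall i, `|tnth t i| <= 1].
    rewrite (_ : [set _ | _] =
        \bigcap_(i in [set: 'I_d]) ((fun t : d.-tuple R => tnth t i) @^-1` `[-1, 1])).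
      apply: fin_bigcap_measurable => [|i _]; first exact: finite_finset.
      by rewrite -[X in measurable X]setTI; apply: measurable_tnth.
    apply/seteqP; split => t /=; first by move=> h i _; rewrite /= in_itv /= -ler_norml.
    by move=> h i; rewrite ler_norml; have := h i I; rewrite /= in_itv.
  rewrite m2E m'E (_ : _ @^-1` _ = `[-1, 1] `*` [set t | forall i, `|tnth t i| <= 1]).
    rewrite [LHS]product_measure1E //= m1 lebesgue_measure_itv /= lte_fin gtrN //.
    by rewrite -EFinD -EFinM opprK exprS.
  apply/seteqP; split => -[x t] /=.
    move=> h; split; first by have := h ord0; rewrite in_itv /= -ler_norml.
    by move=> i; have := h (lift ord0 i); rewrite tnthS.
  rewrite in_itv /= -ler_norml => -[hx ht] i.
  by case: (unliftP ord0 i) => [j|] ->; rewrite ?tnthS.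
move=> c z B c0 mB.
pose z' i := z (lift ord0 i).
pose G (xt : T) : T := (c * xt.1 + z ord0, affine_tuple c z' xt.2).
have mG : measurable_fun setT (G : T -> T).
  apply: measurable_fun_pair; first by apply: measurable_funD => //; apply: measurable_funM.
  by apply: measurableT_comp => //; exact: measurable_affine_tuple.
have [p pE] := pushforward_pack (leb \x m)%E mG.
have [q qE] := scale_pack p (exprn_ge0 d.+1 (ltW c0)).
have mCB : measurable (C @^-1` B) by rewrite -[X in measurable X]setTI; exact: mC.
(* Uniqueness of product measures reduces the scaling law to rectangles, where it is the
   one-dimensional law times the induction hypothesis. *)
have qm X : measurable X -> (leb \x m)%E X = q X.
  apply: (@product_measure_unique _ _ _ _ _ leb m q) => A1 A2 mA1 mA2; rewrite qE pE.
  rewrite (_ : _ @^-1` _ = (fun x => c * x + z ord0) @^-1` A1 `*` (affine_tuple c z' @^-1` A2)) //.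
  rewrite [X in (_ * X)%E = _](@product_measure1E _ _ _ _ _ leb m) //.
  - rewrite -[X in (_ = X * _)%E](lebesgue_affine (z ord0) c0 mA1) -(mA _ z' _ c0 mA2).
    by rewrite exprS EFinM muleACA.
  - rewrite -[X in measurable X]setTI.
    by apply: (measurable_funD (f := fun x => c * x)) => //; apply: measurable_funM.
  - by rewrite -[X in measurable X]setTI; apply: measurable_affine_tuple.
rewrite !m2E !m'E [RHS](qm _ mCB) qE pE; congr (_ * (_ \x _) _)%E; apply/seteqP.
have e xt : affine_tuple c z (C xt) = C (G xt).
  apply: eq_from_tnth => i; rewrite tnth_mktuple.
  by case: (unliftP ord0 i) => [j|] ->; rewrite /C /= ?tnthS ?tnth_mktuple.
by split => xt /=; rewrite e.
Qed.


End volume.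

Section row_measurability.
Context {R : realType}.

Lemma eball_open d (x : 'rV[R]_d) r : open (eball x r).
Proof.
rewrite openE => y /= xy; apply/nbhs_ballP.
have e0 : 0 < (r - enorm (y - x)) / d.+1%:R by rewrite divr_gt0 ?subr_gt0.
exists ((r - enorm (y - x)) / d.+1%:R) => //= z.
rewrite -ball_normE /= => yz; apply: (le_lt_trans (ler_enormB _ y _)).
rewrite -ltrBrDr enormB; apply: (le_lt_trans (enorm_le_mx_norm _)).
apply: (@le_lt_trans _ _ (d.+1%:R * `|y - z|)).
  by rewrite ler_wpM2r // ler_nat.
by rewrite mulrC -ltr_pdivlMr.
Qed.

Definition tuple_row d (t : d.-tuple R) : 'rV[R]_d := \row_i tnth t i.

Lemma tuple_row_affine d c (z : 'rV[R]_d) (t : d.-tuple R) :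
  tuple_row (affine_tuple c (z 0) t) = c *: tuple_row t + z.
Proof. by apply/rowP => i; rewrite !mxE tnth_mktuple. Qed.

Lemma measurable_tuple_row d (G : set 'rV[R]_d) : open G ->
  measurable (@tuple_row d @^-1` G).
Proof.
move=> oG; pose F (i : 'rV[rat]_d * nat) : set (d.-tuple R) :=
  if `[< rat_ball i `<=` G >] then @tuple_row d @^-1` rat_ball i else set0.
rewrite (_ : _ @^-1` _ = \bigcup_i F i).
  apply: countable_bigcupT_measurable => [|i]; first exact: countableP.
  rewrite /F; case: ifP => _ //.
  rewrite (_ : _ @^-1` _ = \bigcap_(j in [set: 'I_d])
     ((fun t : d.-tuple R => tnth t j) @^-1` ball (ratr (i.1 0 j) : R) (i.2.+1%:R^-1))).
    apply: fin_bigcap_measurable => [|j _]; first exact: finite_finset.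
    rewrite -[X in measurable X]setTI; apply: measurable_tnth => //.
    exact: measurable_ball.
  have k0 : 0 < (i.2.+1%:R : R)^-1 by rewrite invr_gt0.
  apply/seteqP; split => t /=.
    by move=> [_ h] j _; have := h 0 j; rewrite !mxE.
  by move=> h; split => // a j; rewrite (ord1 a) !mxE; exact: h.
apply/seteqP; split => t /=.
  move=> Gt; have [i ti iG] := rat_ball_nbhs (open_nbhs_nbhs (conj oG Gt)).
  by exists i => //; rewrite /F; case: asboolP.
by move=> [i _]; rewrite /F; case: asboolP => //= h /h.
Qed.

End row_measurability.

Section packing.
Context {R : realType} {n : nat}.
Local Notation d := n.+1.
Local Notation E := ('rV[R]_d).

Lemma vol_ball (V : {measure set (d.-tuple R) -> \bar R}) :
  (forall c (z : 'I_d -> R) B, 0 < c -> measurable B ->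
    ((c ^+ d)%:E * V (affine_tuple c z @^-1` B))%E = V B) ->
  forall x r, 0 < r ->
    V (@tuple_row R d @^-1` eball x r) =
      ((r ^+ d)%:E * V (@tuple_row R d @^-1` eball 0 1))%E.
Proof.
move=> VA x r r0.
rewrite -(VA _ (x 0) _ r0 (measurable_tuple_row (@eball_open _ _ _ _))).
congr (_ * V _)%E; rewrite /eball; apply/seteqP; split => t /=.
  rewrite tuple_row_affine addrK enormZ gtr0_norm // subr0.
  by rewrite -{2}(mulr1 r) ltr_pM2l.
by rewrite tuple_row_affine addrK enormZ gtr0_norm // subr0 -{2}(mulr1 r) ltr_pM2l.
Qed.

(** The ball lies in the cube, which gives finiteness, and its dilation by d + 1 contains the cube,
    which gives positivity. *)
Lemma vol_unit_ball (V : {measure set (d.-tuple R) -> \bar R}) :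
  V [set t | forall i, `|tnth t i| <= 1] = (2 ^+ d)%:E ->
  (forall c (z : 'I_d -> R) B, 0 < c -> measurable B ->
    ((c ^+ d)%:E * V (affine_tuple c z @^-1` B))%E = V B) ->
  exists2 k : R, 0 < k & V (@tuple_row R d @^-1` eball 0 1) = k%:E.
Proof.
move=> V1 VA.
have mB x r := measurable_tuple_row (@eball_open R d x r).
have mC : measurable [set t : d.-tuple R | forall i, `|tnth t i| <= 1].
  rewrite (_ : [set _ | _] =
      \bigcap_(i in [set: 'I_d]) ((fun t : d.-tuple R => tnth t i) @^-1` `[-1, 1])).
    apply: fin_bigcap_measurable => [|i _]; first exact: finite_finset.
    by rewrite -[X in measurable X]setTI; apply: measurable_tnth.
  apply/seteqP; split => t /=; first by move=> h i _; rewrite /= in_itv /= -ler_norml.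
  by move=> h i; rewrite ler_norml; have := h i I; rewrite /= in_itv.
have le2 : (V (@tuple_row R d @^-1` eball 0 1) <= (2 ^+ d)%:E)%E.
  rewrite -V1 le_measure ?inE //.
  rewrite /eball => t /= h i; apply: le_trans (ltW h); rewrite subr0.
  by have := coord_le_enorm (tuple_row t) i; rewrite mxE.
have ge : ((2 ^+ d)%:E <= ((d.+1%:R ^+ d)%:E * V (@tuple_row R d @^-1` eball 0 1)))%E.
  rewrite -V1 -(vol_ball VA 0) // le_measure ?inE //.
  rewrite /eball => t /= h; rewrite subr0.
  apply: (@le_lt_trans _ _ (d%:R * 1)); last by rewrite mulr1 ltr_nat.
  by apply: enorm_le_coord => i; rewrite mxE.
have : (0 <= V (@tuple_row R d @^-1` eball 0 1))%E by exact: measure_ge0.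
move: le2 ge; case: (V _) => [k _|//|//].
rewrite -EFinM lee_fin => h _; exists k => //.
have : 0 < (d.+1%:R ^+ d) * k by apply: lt_le_trans h; rewrite exprn_gt0.
by rewrite pmulr_rgt0 // exprn_gt0.
Qed.

Lemma sub_expn_le (t : R) : 0 <= t <= 1 ->
  (1 + t) ^+ d - (1 - t) ^+ d <= 2 ^+ d * t.
Proof.
move=> /andP[t0 t1].
(* [h m] is the sum of (1 + t)^j (1 - t)^(m - j) over j <= m, the quotient of a difference of powers
   by 2 t. *)
pose h := fix h m : R := if m is m'.+1 then (1 + t) * h m' + (1 - t) ^+ m'.+1 else 1.
have hge m : (1 - t) ^+ m <= h m /\ h m <= 2 ^+ m.
  elim: m => [|m [ih1 ih2]] /=; first by rewrite !expr0.
  have p0 : 0 <= (1 - t) ^+ m by rewrite exprn_ge0 // subr_ge0.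
  rewrite !exprS; split; first by rewrite lerDr; nra.
  have : 0 <= (1 - t) * (h m - (1 - t) ^+ m) by rewrite mulr_ge0 // subr_ge0.
  nra.
have hE m : (1 + t) ^+ m.+1 - (1 - t) ^+ m.+1 = 2 * t * h m.
  elim: m => [|m ih] /=; first by rewrite !expr1; ring.
  rewrite exprS (exprS (1 - t)).
  have -> : (1 + t) ^+ m.+1 = 2 * t * h m + (1 - t) ^+ m.+1 by rewrite -ih subrK.
  by rewrite !exprS; ring.
rewrite hE exprS; have [_ h2] := hge n; nra.
Qed.

(* The [2 N] balls of radius [s / 2] around the points [e i] and [- e i] are
   disjoint and lie between the spheres of radii [1 - s / 2] and [1 + s / 2]. *)
Lemma packing (N : nat) (e : 'I_N -> E) (s : R) : 0 < s < 1 ->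
  (forall i, enorm (e i) = 1) ->
  (forall i j, i != j -> dot (e i) (e j) ^+ 2 <= 1 - s ^+ 2) ->
  N%:R <= (4 / s) ^+ n.
Proof.
move=> /andP[s0 s1] e1 es.
have [V V1 VA] : exists2 V : {measure set (d.-tuple R) -> \bar R},
    V [set t | forall i, `|tnth t i| <= 1] = (2 ^+ d)%:E &
    forall c (z : 'I_d -> R) B, 0 < c -> measurable B ->
      ((c ^+ d)%:E * V (affine_tuple c z @^-1` B))%E = V B.
  by have [V [V1 VA]] := @volume_exists R d; exists V.
have [k k0 kE] := vol_unit_ball V1 VA.
have mB x r := measurable_tuple_row (@eball_open R d x r).
have VB x r : 0 < r -> V (@tuple_row R d @^-1` eball x r) = (r ^+ d * k)%:E.
  by move=> r0; rewrite (vol_ball VA) // kE EFinM.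
pose t := s / 2.
have t0 : 0 < t by rewrite divr_gt0.
have t1 : t < 1 by rewrite /t; lra.
have ee i : dot (e i) (e i) = 1 by rewrite -sqr_enorm e1 expr1n.
(* The sign [b] selects [e j] or its antipode; [b = false] with [i = j] separates [e i] from
   [- e i]. With x = dot (e i) (e j) the reason is 2 - 2 |x| >= 1 - x^2 >= s^2. *)
have far i j (b : bool) : i != j \/ b = false ->
    s <= enorm (e i - (-1) ^+ b *: - e j).
  move=> ij; rewrite -(@ler_pXn2r _ 2) ?nnegrE ?enorm_ge0 ?(ltW s0) // sqr_enorm.
  rewrite dotDl !dotDr !dotNl !dotNr !dotZl !dotZr !dotNl !dotNr !ee (dotC (e j)).
  case: b ij => ij; rewrite ?expr0 ?expr1.
    case: ij => // /es; set x := dot _ _ => h; have := sqr_ge0 (1 - x); lra.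
  have [ij'|ij'] := eqVneq i j; first by rewrite ij' ee; nra.
  by have := es _ _ ij'; set x := dot _ _ => h; have := sqr_ge0 (1 + x); lra.
have disj x y r r' : r + r' <= enorm (x - y) ->
    (@tuple_row R d @^-1` eball x r) `&` (@tuple_row R d @^-1` eball y r') = set0.
  move=> xy; rewrite /eball; apply/seteqP; split => // u [/= h1 h2].
  have := ler_enormB x (tuple_row u) y; rewrite (enormB x (tuple_row u)) => h; lra.
pose F i := (@tuple_row R d @^-1` eball (e i) t) `|` (@tuple_row R d @^-1` eball (- e i) t).
have mF i : measurable (F i) by apply: measurableU; exact: mB.
have VF i : V (F i) = (2 * (t ^+ d * k))%:E.
  have dF : (@tuple_row R d @^-1` eball (e i) t) `&` (@tuple_row R d @^-1` eball (- e i) t) = set0.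
    by apply: disj; have := far i i false (or_intror erefl); rewrite expr0 scale1r /t; lra.
  by rewrite measureU //= !VB // -EFinD; congr EFin; ring.
have tF : trivIset setT F.
  apply/trivIsetP => i j _ _ ij; rewrite /F setIUl !setIUr.
  have h b := far i j b (or_introl ij).
  have := (h true, h false); rewrite expr0 expr1 scale1r scaleN1r !opprK => -[ha hb].
  have hc : enorm (- e i - e j) = enorm (e i + e j) by rewrite -opprD enormN.
  have hd : enorm (- e i + e j) = enorm (e i - e j) by rewrite addrC enormB.
  by rewrite !disj ?setU0 // ?opprK /t ?hc ?hd; lra.
have UF : V (\big[setU/set0]_(i < N) F i) = (N%:R * (2 * (t ^+ d * k)))%:E.
  rewrite measure_bigsetU_ord //=.
  rewrite (eq_bigr (fun=> (2 * (t ^+ d * k))%:E)) => [|i _]; last exact: VF.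
  by rewrite sumEFin sumr_const card_ord (mulr_natl _ N).
have : (V ((\big[setU/set0]_(i < N) F i) `|` (@tuple_row R d @^-1` eball 0 (1 - t))) <=
        V (@tuple_row R d @^-1` eball 0 (1 + t)))%E.
  have mU' : measurable ((\big[setU/set0]_(i < N) F i) `|` (@tuple_row R d @^-1` eball 0 (1 - t))).
    by apply: measurableU; [exact: bigsetU_measurable|exact: mB].
  rewrite le_measure ?inE //.
  rewrite /F /eball => u [|/= h]; last by lra.
  rewrite -bigcup_seq => -[i _ [|]] /= h; rewrite subr0.
    by have := ler_enormD (tuple_row u - e i) (e i); rewrite subrK e1; lra.
  by have := ler_enormD (tuple_row u - - e i) (- e i); rewrite subrK enormN e1; lra.
have dU : (\big[setU/set0]_(i < N) F i) `&` (@tuple_row R d @^-1` eball 0 (1 - t)) = set0.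
  rewrite /F /eball; apply/seteqP; split => // u [] /=.
  rewrite -bigcup_seq => -[i _ [|]] /= h; rewrite subr0 => h'.
    by have := ler_enormB (e i) (tuple_row u) 0; rewrite !subr0 e1 enormB; lra.
  by have := ler_enormB (- e i) (tuple_row u) 0; rewrite !subr0 enormN e1 enormB; lra.
have mU : measurable (\big[setU/set0]_(i < N) F i) by exact: bigsetU_measurable.
rewrite measureU //= UF !VB ?subr_gt0 ?addr_gt0 // -EFinD lee_fin => h.
have h2 : N%:R * (2 * t ^+ d) <= (1 + t) ^+ d - (1 - t) ^+ d.
  by rewrite -(ler_pM2r k0); lra.
(* That is, N <= (2 / t)^n, which is the claim for t = s / 2. *)
have h3 : N%:R * (2 * t ^+ d) <= 2 ^+ d * t.
  by apply: (le_trans h2); apply: sub_expn_le; rewrite !ltW.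
have p : 0 < 2 * t ^+ d by rewrite mulr_gt0 // exprn_gt0.
rewrite -(ler_pM2r p) (le_trans h3) // /t !exprS !expr_div_n.
rewrite (_ : 4 = 2 * 2) ?exprMn; last by ring.
rewrite le_eqVlt; apply/orP; left; apply/eqP; field.
by rewrite !expf_neq0 // gt_eqF.
Qed.

End packing.

Section line_measurability.
Context {R : realType} {n : nat}.
Local Notation d := n.+1.
Local Notation E := ('rV[R]_d).
Implicit Types (u l : line R d).

Lemma dot_continuous : continuous (fun pq : E * E => dot pq.1 pq.2).
Proof.
rewrite /dot; apply: (continuous_big (@add_continuous R^o)) => i _ pq; apply: cvgM.
  by apply: (continuous_comp (f := fst) (g := fun M : E => M 0 i));
    [exact: cvg_fst|exact: coord_continuous].
by apply: (continuous_comp (f := snd) (g := fun M : E => M 0 i));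
  [exact: cvg_snd|exact: coord_continuous].
Qed.

Lemma dot_continuous2 (T : topologicalType) (f g : T -> E) :
  continuous f -> continuous g -> continuous (fun t => dot (f t) (g t)).
Proof.
move=> cf cg t.
apply: (continuous_comp (f := fun t => (f t, g t)) (g := fun pq => dot pq.1 pq.2)).
  exact: (cvg_pair (cf t) (cg t)).
exact: dot_continuous.
Qed.

Lemma measurable_near_dir s :
  measurable [set uu : line R d * line R d | near_dir s uu.1 uu.2].
Proof.
pose W : set (E * E) := [set pq | (1 - s ^+ 2) * (dot pq.1 pq.1 * dot pq.2 pq.2) <
  dot pq.1 pq.2 ^+ 2].
rewrite (_ : [set _ | _] = [set uu : line R d * line R d |
    exists p q, [/\ p \on uu.1, q \on uu.2 & W (p, q)]]) //.
apply: (measurable_hit2 (h1 := @line_set R d) (h2 := @line_set R d)).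
- by move=> G; exact: measurable_hitting.
- by move=> G; exact: measurable_hitting.
pose f (pq : E * E) := dot pq.1 pq.2 ^+ 2 - (1 - s ^+ 2) * (dot pq.1 pq.1 * dot pq.2 pq.2).
rewrite (_ : W = f @^-1` [set x | 0 < x]); last first.
  by apply/seteqP; split => pq; rewrite /W /f /= subr_gt0.
apply: open_comp; last exact: open_gt.
have c1 : continuous (@fst E E) by move=> ?; exact: cvg_fst.
have c2 : continuous (@snd E E) by move=> ?; exact: cvg_snd.
move=> pq _; apply: cvgB.
  by rewrite /GRing.exp /=; apply: cvgM; exact: dot_continuous.
apply: cvgM; first exact: cvg_cst.
by apply: cvgM; [exact: (dot_continuous2 c1 c1)|exact: (dot_continuous2 c2 c2)].
Qed.

Lemma measurable_dir : measurable_fun setT (@dir R d).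
Proof.
apply: measurable_to_line => G oG.
have := measurable_hit2 (h1 := @line_set R d) (h2 := @line_set R d)
  (W := (fun pq : E * E => pq.2 - pq.1) @^-1` G) (@measurable_hitting R n)
  (@measurable_hitting R n).
have oW : open ((fun pq : E * E => pq.2 - pq.1) @^-1` G).
  by apply: open_comp => // pq _; apply: cvgB; [exact: cvg_snd|exact: cvg_fst].
move=> /(_ oW) mW.
have mdiag : measurable_fun setT (fun l : line R d => (l, l)).
  exact: measurable_fun_pair.
have := mdiag measurableT _ mW; rewrite setTI; congr measurable.
apply/seteqP; split => l /=.
  by move=> [p [q [lp lq /= Gpq]]]; exists (q - p); split => //; exists p, q.
by move=> [z [[p [q [lp lq ->]]] Gz]]; exists p, q.
Qed.

(** Joint measurability in the translation vector and the line, needed to integrate over both. *)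
Lemma measurable_shift_pair :
  measurable_fun setT (fun tl : d.-tuple R * line R d => line_shift (tuple_row tl.1) tl.2).
Proof.
apply: measurable_to_line => G oG.
have oW : open ((fun pq : E * E => pq.1 + pq.2) @^-1` G).
  by apply: open_comp => // pq _; apply: cvgD; [exact: cvg_fst|exact: cvg_snd].
have m1 (H : set E) : open H ->
    measurable [set t : d.-tuple R | [set tuple_row t] `&` H !=set0].
  move=> oH; have := measurable_tuple_row oH; congr measurable.
  apply/seteqP; split => t /= => [Ht|[p [-> //]]].
  by exists (tuple_row t).
have := measurable_hit2 m1 (@measurable_hitting R n) oW; congr measurable.
apply/seteqP; split => -[t l] /=.
  by move=> [p [q [-> lq Gpq]]]; exists (tuple_row t + q); split => //; exists q.
by move=> [z [[q lq <-] Gz]]; exists (tuple_row t), q.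
Qed.

Lemma measurable_shift (z : E) : measurable_fun setT (@line_shift R d z).
Proof.
pose t : d.-tuple R := [tuple z 0 i | i < d].
have tz : tuple_row t = z by apply/rowP => i; rewrite !mxE tnth_mktuple.
rewrite (_ : line_shift z = (fun tl => line_shift (tuple_row tl.1) tl.2) \o
    (fun l : line R d => (t, l))); last by apply/funext => l /=; rewrite tz.
apply: measurableT_comp; first exact: measurable_shift_pair.
exact: measurable_fun_pair.
Qed.

Lemma measurable_thru0 : measurable (@thru0 R d).
Proof.
rewrite (_ : thru0 = \bigcap_k hitting (eball 0 (k.+1%:R^-1))).
  apply: bigcapT_measurable => k; apply: measurable_hitting; exact: eball_open.
apply/seteqP; split => l.
  by move=> /thru0P l0 k _; exists 0; split => //; rewrite /eball /= subr0 enorm0 invr_gt0.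
move=> h; apply/thru0P.
have [p lp] := line_neq0 l; have [v v0 lE] := lineP lp.
have vv : dot v v != 0 by rewrite dotxx_eq0.
(* Foot of the perpendicular from the origin: if it is not zero, the line misses every ball of
   smaller radius. *)
pose q := p - (dot p v / dot v v) *: v.
have lq : q \on l by rewrite lE; exists (- (dot p v / dot v v)) => //; rewrite scaleNr.
have qv : dot q v = 0 by rewrite dotDl dotNl dotZl divfK // subrr.
clearbody q; suff : q = 0 by move=> <-.
apply/eqP; rewrite -dotxx_eq0; apply/eqP/le_anti; rewrite dotxx_ge0 andbT.
rewrite leNgt; apply/negP => q0.
have qe : 0 < enorm q by rewrite enormE sqrtr_gt0.
have [k kP] : exists k : nat, (k.+1%:R : R)^-1 < enorm q.
  exists (Num.bound ((enorm q)^-1)).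
  rewrite invf_plt ?posrE // (lt_trans (archi_boundP _)) ?invr_ge0 ?(ltW qe) //.
  by rewrite ltr_nat.
have [y [ly]] := h k I; rewrite /eball /= subr0 => yk.
have := lt_trans yk kP; rewrite -(@ltr_pXn2r _ 2) ?nnegrE ?enorm_ge0 // !sqr_enorm.
apply/negP; rewrite -leNgt.
have dv : v \on dir l by rewrite /= (dir_setE lE); exists 1 => //; rewrite scale1r.
move: ly; rewrite (line_paramE lq dv v0) => -[t _ <-].
rewrite dotDl !dotDr !dotZl !dotZr (dotC v q) qv !mulr0 addr0 add0r lerDl.
by rewrite mulrA -expr2 mulr_ge0 ?sqr_ge0 ?dotxx_ge0.
Qed.

Lemma measurable_cap s u : measurable [set l | near_dir s l u].
Proof.
have := measurable_near_dir s.
have mp : measurable_fun setT (fun l : line R d => (l, u)).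
  by apply: measurable_fun_pair => //.
by move=> /(mp measurableT); rewrite setTI.
Qed.

End line_measurability.

Section caps.
Context {R : realType} {n : nat}.
Local Notation d := n.+1.
Local Notation E := ('rV[R]_d).
Implicit Types (u l : line R d).

Lemma is_line_mul (Q : 'M[R]_d) l : Q *m Q^T = 1%:M ->
  is_line [set p *m Q | p in l].
Proof.
move=> QQ; case: (line_setP l) => p [v [v0 lE]]; exists (p *m Q), (v *m Q); split.
  by rewrite -dotxx_eq0 dot_orth // dotxx_eq0.
rewrite lE; apply/seteqP; split => z /=.
  by move=> [_ [t _ <-] <-]; exists t => //; rewrite mulmxDl scalemxAl.
by move=> [t _ <-]; exists (p + t *: v); [exists t|rewrite mulmxDl scalemxAl].
Qed.

(** What the uniqueness argument retains of rotation invariance; it fits both [sigma] and the law of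
    directions derived from [mu]. *)
Definition equal_caps (m : set (line R d) -> \bar R) := forall s u u',
  thru0 u -> thru0 u' -> m [set l | near_dir s l u] = m [set l | near_dir s l u'].

Lemma rotation_equal_caps (m : set (line R d) -> \bar R) :
  (forall f B, Defs.rotation f -> measurable B -> m (line_preimage f B) = m B) ->
  equal_caps m.
Proof.
move=> mrot s u u' u0 u0'.
have [p up p0] := thru0_neq0 u0; have [q uq q0] := thru0_neq0 u0'.
have [Q [QQ Q1 [a pq]]] := rotation_exists p0 q0.
have Qinv : Q^T *m Q = 1%:M by exact: mulmx1C.
have uu' : u' = mulmx^~ Q @` u :> set E.
  have a0 : a != 0.
    apply: contra_neq p0 => a0; move: pq; rewrite a0 scale0r => pQ.
    by rewrite -(mulmx1 p) -QQ mulmxA pQ mul0mx.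
  apply/seteqP; split => z.
    move=> /(thru0_scale _ u0' uq q0)[t ->]; exists ((t / a) *: p).
      by apply/(thru0_scale _ u0 up p0); exists (t / a).
    by rewrite -scalemxAl pq scalerA divfK.
  move=> [_ /(thru0_scale _ u0 up p0)[t ->] <-].
  by apply/(thru0_scale _ u0' uq q0); exists (t * a); rewrite -scalemxAl pq scalerA.
rewrite -[RHS](mrot (mulmx^~ Q)); [|by exists Q|exact: measurable_cap].
congr (m _); apply/seteqP; split => l.
  move=> [x [y [lx uy h]]]; exists (Line (is_line_mul l QQ)) => //=.
  exists (x *m Q), (y *m Q); rewrite !dot_orth //; split => //; first by exists x.
  by rewrite uu'; exists y.
move=> [l' [x [y [lx uy h]]] l'E].
move: lx uy h; rewrite l'E uu' => -[x' lx' <-] [y' uy' <-]; rewrite !dot_orth // => h.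
by exists x', y'.
Qed.

Lemma span_cover (s : R) : 0 < s < 1 -> exists (N : nat) (u : 'I_N -> line R d),
  [/\ N%:R <= (4 / s) ^+ n, forall i, thru0 (u i) &
      thru0 `<=` \big[setU/set0]_(i < N) [set l | near_dir s l (u i)]].
Proof.
move=> s01; have /andP[s0 s1] := s01.
pose sep (es : seq E) := all (fun x => enorm x == 1) es &&
  pairwise (fun x y => dot x y ^+ 2 <= 1 - s ^+ 2) es.
have sepN es : sep es -> (size es)%:R <= (4 / s) ^+ n.
  move=> /andP[/allP e1 /(pairwiseP 0) ep].
  apply: (@packing _ _ _ (fun i : 'I_(size es) => nth 0 es i) _ s01).
    by move=> i; apply/eqP/e1/mem_nth.
  move=> i j; rewrite neq_ltn => /orP[] ij; last rewrite dotC; apply: ep => //;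
    by rewrite ?inE ltn_ord.
(* A maximal separated family exists because families that can always be extended would outgrow the
   packing bound. *)
have [es es_sep esmax] : exists2 es, sep es &
    forall x, enorm x = 1 -> ~ sep (x :: es).
  apply: contrapT => hno.
  have ext (k : nat) : exists2 es, sep es & size es = k.
    elim: k => [|k [es eP ek]]; first by exists [::].
    have [x x1 xes] : exists2 x, enorm x = 1 & sep (x :: es).
      apply: contrapT => hx; apply: hno; exists es => // x x1 xs.
      by apply: hx; exists x.
    by exists (x :: es) => //=; rewrite ek.
  have b0 : 0 <= (4 / s) ^+ n by rewrite exprn_ge0 // divr_ge0 // ltW.
  have [es eP ek] := ext (Num.bound ((4 / s) ^+ n)).
  by have := sepN _ eP; rewrite ek leNgt archi_boundP.
have /andP[/allP e1 _] := es_sep.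
have e0 (i : 'I_(size es)) : nth 0 es i != 0.
  by rewrite -enorm_gt0 (eqP (e1 _ (mem_nth 0 (ltn_ord i)))).
exists (size es), (fun i => span_line (e0 i)); split.
- exact: sepN.
- by move=> i; exact: thru0_span.
move=> l l0; have [p lp p0] := thru0_neq0 l0.
have np : enorm p != 0 by rewrite enorm_eq0.
pose x := (enorm p)^-1 *: p.
have x1 : enorm x = 1 by rewrite enormZ ger0_norm ?invr_ge0 ?enorm_ge0 // mulVf.
have lx : x \on l by apply/(thru0_scale _ l0 lp p0); exists (enorm p)^-1.
have x0 : x != 0 by rewrite -enorm_gt0 x1.
have := esmax x x1; move: es_sep; rewrite /sep /= x1 eqxx /= => /andP[-> ->].
rewrite andbT /= => /negP; rewrite -has_predC => /hasP[y yes /=].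
rewrite -ltNge => xy; rewrite -bigcup_seq.
have iy : (index y es < size es)%N by rewrite index_mem.
exists (Ordinal iy); first by rewrite /= mem_index_enum.
apply/(near_dirP _ l0 (thru0_span _) lx (span_line_id _) x0 (e0 (Ordinal iy))).
by rewrite /= nth_index // -!sqr_enorm x1 (eqP (e1 _ yes)) expr1n !mulr1.
Qed.

Lemma cap_ge (sigma : {measure set (line R d) -> \bar R}) s u :
  equal_caps sigma -> sigma thru0 = 1%E -> 0 < s < 1 -> thru0 u ->
  (((s / 4) ^+ n)%:E <= sigma [set l | near_dir s l u])%E.
Proof.
move=> eqc s1 s01 u0; have [N [v [N4 v0 cov]]] := span_cover s01.
have mc w : measurable [set l | near_dir s l w] := measurable_cap s w.
have : (sigma thru0 <= sigma (\big[setU/set0]_(i < N) [set l | near_dir s l (v i)]))%E.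
  rewrite le_measure ?inE //; first exact: measurable_thru0.
  by apply: bigsetU_measurable => i _; exact: mc.
rewrite s1 => h1.
have h2 : (sigma (\big[setU/set0]_(i < N) [set l | near_dir s l (v i)]) <=
    \sum_(i < N) sigma [set l | near_dir s l (v i)])%E.
  pose K (A : set (line R d)) (a : \bar R) := measurable A /\ (sigma A <= a)%E.
  suff [] : K (\big[setU/set0]_(i < N) [set l | near_dir s l (v i)])
    (\sum_(i < N) sigma [set l | near_dir s l (v i)])%E by [].
  elim/big_ind2 : _ => [|A a B b [mA hA] [mB hB]|//]; first by split => //; rewrite measure0.
  split; first exact: measurableU.
  by apply: (le_trans (measureU2 _ _ _)) => //; exact: leeD.
have := le_trans h1 h2; rewrite (eq_bigr (fun=> sigma [set l | near_dir s l u])); last first.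
  by move=> i _; exact: eqc.
have : (0 <= sigma [set l | near_dir s l u])%E by exact: measure_ge0.
case: (sigma [set l | near_dir s l u]) => [c|_ _|//]; last by rewrite leey.
rewrite sumEFin sumr_const card_ord !lee_fin -(mulr_natl c N) => c0 h.
have /andP[s0 s1'] := s01.
have p4 : 0 < (4 / s) ^+ n by rewrite exprn_gt0 // divr_gt0.
have e : (s / 4) ^+ n * (4 / s) ^+ n = 1.
  by rewrite -exprMn mulf_div (mulrC s) divff ?expr1n // mulf_neq0 // gt_eqF.
rewrite -(ler_pM2r p4) e (le_trans h) // mulrC.
exact: ler_wpM2l.
Qed.

End caps.

Lemma swap_sections d1 d2 (T1 : measurableType d1) (T2 : measurableType d2)
    (R : realType) (m1 : {sigma_finite_measure set T1 -> \bar R})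
    (m2 : {sigma_finite_measure set T2 -> \bar R}) (A : set (T1 * T2)) :
  measurable A ->
  (\int[m1]_x m2 (xsection A x) = \int[m2]_y m1 (ysection A y))%E.
Proof.
move=> mA; have := indic_fubini_tonelli m1 m2 mA.
by rewrite indic_fubini_tonelli_FE // indic_fubini_tonelli_GE.
Qed.

(** * Uniqueness of the uniform measure on directions *)

Section direction_measures.
Context {R : realType} {n : nat}.
Local Notation d := n.+1.
Local Notation E := ('rV[R]_d).
Local Notation L := (line R d).
Implicit Types (u l : L).

Lemma near_dir_le s s' u u' : 0 <= s <= s' -> near_dir s u u' -> near_dir s' u u'.
Proof.
move=> /andP[s0 ss] [p [q [up uq h]]]; exists p, q; split => //.
apply: le_lt_trans h; apply: ler_wpM2r; first by rewrite mulr_ge0 ?dotxx_ge0.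
by rewrite lerB // ler_pXn2r // nnegrE // (le_trans s0).
Qed.

(** Openness among directions, expressed by caps. The measurable sets of this kind are stable under
    intersection and generate the sigma-algebra, so agreement on them is enough. *)
Definition open_dir (U : set L) := forall u, thru0 u -> U u ->
  exists2 s, 0 < s & forall u', thru0 u' -> near_dir s u u' -> U u'.

Lemma open_dir_hitting (G : set E) : open G -> open_dir (hitting G).
Proof.
move=> oG u u0 [p [up Gp]].
have [p0|p0] := eqVneq p 0.
  by exists 1 => // u' /thru0P u0' _; exists 0; split => //; rewrite -p0.
have /nbhs_ballP[e /= e0 eG] := open_nbhs_nbhs (conj oG Gp).
have np : 0 < enorm p by rewrite enorm_gt0.
have s0 : 0 < e / enorm p by rewrite divr_gt0.
exists (e / enorm p) => // u' u0' /(near_dir_close (ltW s0) u0 u0' up p0)[q uq].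
rewrite divfK ?gt_eqF // => pq; exists q; split => //; apply: eG.
rewrite -ball_normE /=; apply: le_lt_trans (mx_norm_le_enorm _) _.
by rewrite enormB.
Qed.

Lemma open_dirI (U V : set L) : open_dir U -> open_dir V -> open_dir (U `&` V).
Proof.
move=> oU oV u u0 [Uu Vu].
have [s s0 sU] := oU u u0 Uu; have [s' s0' sV] := oV u u0 Vu.
have m0 : 0 < Num.min s s' by rewrite lt_min s0.
exists (Num.min s s') => // u' u0' h; split; [apply: sU|apply: sV] => //;
  by apply: near_dir_le h; rewrite (ltW m0) /= ge_min lexx ?orbT.
Qed.

Lemma thru0_exists : exists u0 : L, thru0 u0.
Proof. by exists (dir point); exact: thru0_dir. Qed.

Section compare.
Variables m1 m2 : {finite_measure set L -> \bar R}.
Hypothesis m1c : equal_caps m1.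
Hypothesis m2c : equal_caps m2.
Hypothesis m10 : m1 (~` thru0) = 0%E.
Hypothesis m20 : m2 (~` thru0) = 0%E.

(** Measure in both orders the pairs of directions at sine less than [s], one in [V] and the other
    in [U]: the section over a point of [V] has the full mass of a cap by assumption, the section
    over a point of [U] at most that. *)
Lemma cap_swap s (U V : set L) u0 : thru0 u0 ->
  measurable U -> measurable V -> U `<=` thru0 -> V `<=` thru0 ->
  (forall u, V u -> m2 ([set l | near_dir s l u] `&` U) = m2 [set l | near_dir s l u0]) ->
  (m2 [set l | near_dir s l u0] * m1 V <= m1 [set l | near_dir s l u0] * m2 U)%E.
Proof.
move=> u00 mU mV U0 V0 h.
pose A := [set uu : L * L | near_dir s uu.1 uu.2] `&` (V `*` U).
have mA : measurable A.
  by apply: measurableI; [exact: measurable_near_dir|exact: measurableX].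
have mcap u := measurable_cap s u.
have <- : (\int[m1]_x m2 (xsection A x) = m2 [set l | near_dir s l u0] * m1 V)%E.
  rewrite -integral_cst // [RHS]integral_mkcond; apply: eq_integral => u _.
  rewrite patchE; case: ifPn => [|/negP] uV.
    rewrite -(h u (set_mem uV)); congr (m2 _); apply/seteqP; split => l /=.
      by rewrite /xsection /= inE => -[/= /near_dirC ? [? ?]].
    move=> [/near_dirC ? ?]; rewrite /xsection /= inE; split => //.
    by split => //; exact: set_mem.
  rewrite (_ : xsection A u = set0) ?measure0 //.
  apply/seteqP; split => // l; rewrite /xsection /= inE => -[_ [/= Vu _]].
  by apply: uV; exact: mem_set.
rewrite swap_sections // -integral_cst // [leRHS]integral_mkcond.
apply: ge0_le_integral => //.
- by apply: measurable_fun_ysection.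
- by apply/(measurable_restrictT _ mU); exact: measurable_cst.
move=> u _; rewrite patchE; case: ifPn => [|/negP] uU.
  rewrite (m1c s u00 (U0 _ (set_mem uU))) le_measure ?inE //.
    exact: measurable_ysection.
  by move=> l; rewrite /ysection /= inE => -[].
rewrite (_ : ysection A u = set0) ?measure0 //.
apply/seteqP; split => // l; rewrite /ysection /= inE => -[_ [_ /= Uu]].
by apply: uU; exact: mem_set.
Qed.

Lemma measure_thru0I (m : {measure set L -> \bar R}) (B : set L) :
  m (~` thru0) = 0%E -> measurable B -> m (B `&` thru0) = m B.
Proof.
move=> m0 mB; have mt := @measurable_thru0 R n.
rewrite -[in RHS](setIT B) -(setUv thru0) setIUr measureU0 //.
- exact: measurableI.
- by apply: measurableI => //; exact: measurableC.
- apply/eqP; rewrite -measure_le0 -m0 le_measure ?inE //.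
  + by apply: measurableI => //; exact: measurableC.
  + exact: measurableC.
Qed.

End compare.

Definition pos_caps (m : set L -> \bar R) := forall s u, 0 < s < 1 -> thru0 u ->
  (0 < m [set l | near_dir s l u])%E.

Lemma cap_mass (m1 m2 : {finite_measure set L -> \bar R}) s u0 :
  equal_caps m1 -> equal_caps m2 -> m1 (~` thru0) = 0%E -> m2 (~` thru0) = 0%E ->
  thru0 u0 ->
  (m2 [set l | near_dir s l u0] * m1 setT = m1 [set l | near_dir s l u0] * m2 setT)%E.
Proof.
move=> c1 c2 z1 z2 u00; have mt := @measurable_thru0 R n.
rewrite -(measure_thru0I z1 measurableT) -(measure_thru0I z2 measurableT) setTI.
apply/eqP; rewrite eq_le; apply/andP; split.
  apply: cap_swap => // u u1.
  by rewrite measure_thru0I //; [exact: c2|exact: measurable_cap].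
apply: cap_swap => // u u1.
by rewrite measure_thru0I //; [exact: c1|exact: measurable_cap].
Qed.

Lemma cross_cancel (a b v w x y : R) : 0 < b -> 0 <= y ->
  b * v <= a * w -> b * x = a * y -> v * y <= w * x.
Proof.
move=> b0 y0 h e; rewrite -(ler_pM2l b0) mulrA mulrCA e mulrCA [leRHS]mulrA.
exact: ler_wpM2r.
Qed.

(** By [cap_mass] the cap masses of the two measures are proportional. If almost all of the cap
    around each point of V lies in [U], [cap_swap] turns this into a comparison of V with [U]; such
    sets V exhaust an open [U] as the caps shrink. *)
Lemma compare_open (m1 m2 : {finite_measure set L -> \bar R}) U :
  equal_caps m1 -> equal_caps m2 -> m1 (~` thru0) = 0%E -> m2 (~` thru0) = 0%E ->
  pos_caps m2 -> measurable U -> open_dir U ->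
  (m1 U * m2 setT <= m2 U * m1 setT)%E.
Proof.
move=> c1 c2 z1 z2 p2 mU oU; have mt := @measurable_thru0 R n.
have [u0 u00] := thru0_exists.
pose s k : R := k.+2%:R^-1.
have s01 k : 0 < s k < 1 by rewrite invr_gt0 ltr0n /= invf_lt1 // ltr1n.
pose A k : set (L * L) := [set uu | near_dir (s k) uu.1 uu.2] `&` (setT `*` ~` U).
have mA k : measurable (A k).
  apply: measurableI; first exact: measurable_near_dir.
  by apply: measurableX => //; exact: measurableC.
(* Directions whose cap leaves [U] only on an [m2]-null set: unlike inclusion of the cap, this
   condition on section masses is measurable at once. *)
pose V k : set L := (thru0 `&` U) `&` [set u | m2 (xsection (A k) u) = 0%E].
have mV k : measurable (V k).
  apply: measurableI; first exact: measurableI.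
  rewrite -[X in measurable X]setTI.
  exact: (measurable_fun_xsection m2 (mA k) measurableT (emeasurable_set1 0%E)).
have mcap k u := measurable_cap (s k) u.
have VE k : (m1 (V k) * m2 setT <= m2 U * m1 setT)%E.
  have h : (m2 [set l | near_dir (s k) l u0] * m1 (V k) <=
            m1 [set l | near_dir (s k) l u0] * m2 (U `&` thru0))%E.
    apply: cap_swap => //.
    - exact: measurableI.
    - by move=> u [[]].
    move=> u [[u1 Uu] /= Vu].
    rewrite -(c2 (s k) u u0) // -[in RHS](measure_thru0I z2 (mcap k u)).
    have -> : [set l | near_dir (s k) l u] `&` thru0 =
        ([set l | near_dir (s k) l u] `&` (U `&` thru0)) `|`
        ([set l | near_dir (s k) l u] `&` (~` U `&` thru0)).
      by rewrite -setIUr -setIUl setUv setTI.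
    rewrite measureU0 //.
    - by apply: measurableI => //; exact: measurableI.
    - by apply: measurableI => //; apply: measurableI => //; exact: measurableC.
    apply/eqP; rewrite -measure_le0 -Vu le_measure ?inE //.
    - by apply: measurableI => //; apply: measurableI => //; exact: measurableC.
    - exact: measurable_xsection.
    by move=> l [/near_dirC lu [Ul _]]; rewrite /xsection /= inE.
  rewrite measure_thru0I // in h.
  have e := cap_mass (s k) c1 c2 z1 z2 u00.
  have := p2 (s k) u0 (s01 k) u00.
  move: h e.
  rewrite -[m1 (V k)]fineK ?fin_num_measure // -[m1 setT]fineK ?fin_num_measure //.
  rewrite -[m2 setT]fineK ?fin_num_measure // -[m2 U]fineK ?fin_num_measure //.
  have f1 : m1 [set l | near_dir (s k) l u0] \is a fin_num by exact: fin_num_measure.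
  have f2 : m2 [set l | near_dir (s k) l u0] \is a fin_num by exact: fin_num_measure.
  rewrite -(fineK f1) -(fineK f2) -!EFinM !lee_fin lte_fin => h [e] p.
  have t2 : 0 <= fine (m2 setT) by apply: fine_ge0; exact: measure_ge0.
  have hU : m2 U = (fine (m2 U))%:E by rewrite fineK // fin_num_measure.
  rewrite [X in (_ <= _ * X)%E]hU -EFinM lee_fin in h; exact: cross_cancel p t2 h e.
have Vn : nondecreasing_seq V.
  move=> i j ij; apply/subsetPset => u [[u1 Uu] /= h]; split; first by [].
  apply/eqP; rewrite -measure_le0 -h le_measure ?inE //; try exact: measurable_xsection.
  move=> l; rewrite /xsection /= !inE => -[/= lu ?]; split => //=.
  apply: near_dir_le lu; have /andP[/ltW -> _] /= := s01 j.
  by rewrite lef_pV2 ?posrE ?ltr0n // ler_nat.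
have UV : \bigcup_k V k = U `&` thru0.
  apply/seteqP; split => u; first by move=> [k _ [[]]].
  move=> [Uu u1]; have [e e0 eU] := oU u u1 Uu.
  have [k kP] : exists k, s k < e.
    exists (Num.bound (e^-1)).
    rewrite invf_plt ?posrE // (lt_trans (archi_boundP _)) ?invr_ge0 ?(ltW e0) //.
    by rewrite ltr_nat.
  exists k => //; split => //=.
  apply/eqP; rewrite -measure_le0 -z2 le_measure ?inE //.
  - exact: measurable_xsection.
  - exact: measurableC.
  move=> l; rewrite /xsection /= !inE => -[/= lu [_ Ul]] l0; apply: Ul; apply: eU => //.
  by apply: near_dir_le lu; have /andP[/ltW -> _] /= := s01 k; exact: ltW.
have cv : m1 (V k) @[k --> \oo] --> m1 (U `&` thru0).
  rewrite -UV; apply: nondecreasing_cvg_mu => //.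
  by rewrite UV; exact: measurableI.
rewrite measure_thru0I // in cv.
have cv2 : ((m1 (V k) * m2 setT) @[k --> \oo] --> m1 U * m2 setT)%E.
  by apply: cvgeMr => //; exact: fin_num_measure.
rewrite -(cvg_lim _ cv2) //; apply: lime_le; first by apply/cvg_ex; exists (m1 U * m2 setT)%E.
by apply: nearW => k; exact: VE.
Qed.

Lemma direction_measure_unique (m1 m2 : {finite_measure set L -> \bar R}) B :
  equal_caps m1 -> equal_caps m2 -> m1 (~` thru0) = 0%E -> m2 (~` thru0) = 0%E ->
  pos_caps m1 -> m2 setT != 0%E -> measurable B ->
  (m1 B * m2 setT = m2 B * m1 setT)%E.
Proof.
move=> c1 c2 z1 z2 p1 t2 mB.
(* Positivity passes from [m1] to [m2], since cap masses are proportional and [m2] has nonzero total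
   mass. *)
have p2 : pos_caps m2.
  move=> s u s01 u0; have := cap_mass s c1 c2 z1 z2 u0.
  have := p1 s u s01 u0.
  have /eqP := t2; have mc := measurable_cap s u.
  have : (0 <= m2 [set l | near_dir s l u])%E by exact: measure_ge0.
  have : (0 <= m2 setT)%E by exact: measure_ge0.
  rewrite -[m1 setT]fineK ?fin_num_measure // -[m2 setT]fineK ?fin_num_measure //.
  have f1 : m1 [set l | near_dir s l u] \is a fin_num by exact: fin_num_measure.
  have f2 : m2 [set l | near_dir s l u] \is a fin_num by exact: fin_num_measure.
  rewrite -(fineK f1) -(fineK f2) -!EFinM !lee_fin !lte_fin => t2_ge cap_ge h p [e].
  rewrite lt_def cap_ge andbT; apply/eqP => h0; move: e; rewrite h0 mul0r => /esym/eqP.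
  rewrite mulf_eq0 gt_eqF //= => /eqP h1; by rewrite h1 in h.
have [t1 t1E] := scale_pack m1 (fine_ge0 (measure_ge0 m2 setT)).
have [t3 t3E] := scale_pack m2 (fine_ge0 (measure_ge0 m1 setT)).
suff : t1 B = t3 B.
  rewrite t1E t3E !fineK ?fin_num_measure // => e.
  by rewrite muleC e muleC.
pose G := [set U : set L | measurable U /\ open_dir U].
apply: (measure_unique G (fun=> setT)) => //.
- apply/seteqP; split.
    apply: smallest_sub; first exact: smallest_sigma_algebra.
    move=> _ [K oK <-]; apply: sub_sigma_algebra; split; first exact: measurable_hitting.
    exact: open_dir_hitting.
  apply: smallest_sub; first exact: sigma_algebra_measurable.
  by move=> U [].
- by move=> U V [mU oU] [mV oV]; split; [exact: measurableI|exact: open_dirI].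
- by move=> _; split => // u _ _; exists 1.
- by rewrite bigcup_const //; exists 0%N.
- move=> U [mU oU]; rewrite t1E t3E !fineK ?fin_num_measure //.
  apply/eqP; rewrite eq_le; apply/andP; split; rewrite muleC [leRHS]muleC;
    exact: compare_open.
- by move=> _; rewrite t1E ltey_eq fin_numM // fin_num_measure.
Qed.

End direction_measures.

Lemma restr_pack d (T : measurableType d) (R : realType)
    (m : {measure set T -> \bar R}) (D : set T) :
  measurable D -> (m D < +oo)%E ->
  exists m' : {finite_measure set T -> \bar R}, forall A, m' A = m (A `&` D).
Proof.
move=> mD Doo; pose r : {measure set T -> \bar R} := mrestr m mD.
have ff : fin_num_fun r.
  move=> A mA; rewrite ge0_fin_numE ?measure_ge0 // /r /= /mrestr.
  apply: le_lt_trans Doo; rewrite le_measure ?inE //; exact: measurableI.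
have sf : sigma_finite setT r by apply: fin_num_fun_sigma_finite => //; rewrite measure0.
pose H1 := isFinite.Build _ _ _ _ ff.
pose H2 := isSFinite.Build _ _ _ _ (sfinite_measure_sigma_finite sf).
pose H3 := isSigmaFinite.Build _ _ _ _ sf.
pose r' := HB.pack_for (FiniteMeasure.type T R) (Measure.sort r) H1 H2 H3.
by exists r'.
Qed.

Lemma sphere_area_gt0 (R : realType) m : 0 < sphere_area R m.
Proof.
have pi0 := @pi_gt0 R.
(* Two consecutive dimensions at once, as the recursion descends by two. *)
suff : 0 < sphere_area R m /\ 0 < sphere_area R m.+1 by case.
elim: m => [|m [ih1 ih2]]; first by split => //=; rewrite mulr_gt0.
by split => //; rewrite /= mulr_gt0 // divr_gt0 // mulr_gt0.
Qed.

(** * From directions through a point to lines in space *)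

Section direction_law.
Context {R : realType} {n : nat}.
Local Notation d := n.+1.
Local Notation E := ('rV[R]_d).
Local Notation L := (line R d).
Implicit Types (u l : L).

Lemma isometry_trans (z : E) : Defs.isometry (fun p => z + p).
Proof. by move=> x y; rewrite opprD addrACA subrr add0r. Qed.

Lemma line_preimage_shift (z : E) (B : set L) :
  line_preimage (fun p => z + p) B = @line_shift R d z @^-1` B.
Proof.
apply/seteqP; split => l /=.
  by move=> [l' Bl' l'E]; rewrite (_ : line_shift z l = l') //; apply: line_inj; rewrite l'E.
by move=> Bl; exists (line_shift z l).
Qed.

Definition line_law (mu : {measure set L -> \bar R}) (h : R) (B : set L) : \bar R :=
  mu (@dir R d @^-1` B `&` hitting (eball 0 h)).

(** Rotations preserve the ball around the origin and commute with [dir], so the directions of the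
    lines hitting it have equal caps; the normalization of [mu] gives the total mass. *)
Lemma direction_law (mu : {measure set L -> \bar R}) (h : R) :
  is_invariant_line_measure mu -> 0 < h ->
  exists nu : {finite_measure set L -> \bar R}, [/\
    forall B, nu B = line_law mu h B,
    equal_caps nu, nu (~` thru0) = 0%E &
    nu setT = (sphere_area R n / 2 * h ^+ n)%:E].
Proof.
move=> [iso ball] h0.
have mhit : measurable (@hitting R d (eball 0 h)).
  by apply: measurable_hitting; exact: eball_open.
have [p pE] := pushforward_pack (mrestr mu mhit) (@measurable_dir R n).
have pT : p setT = (sphere_area R n / 2 * h ^+ n)%:E.
  by rewrite pE preimage_setT /= /mrestr setTI ball.
have [nu nuE] : exists m' : {finite_measure set L -> \bar R}, forall A, m' A = p (A `&` setT).
  by apply: restr_pack => //; rewrite pT ltry.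
have nuB B : nu B = line_law mu h B.
  by rewrite nuE setIT pE /= /mrestr.
exists nu; split => //; last by rewrite nuE setIT.
- apply: rotation_equal_caps => f B [Q [QQ Q1 fE]] mB.
  rewrite !nuB /line_law.
  have mX : measurable (@dir R d @^-1` B `&` hitting (eball 0 h)).
    apply: measurableI => //; rewrite -[X in measurable X]setTI.
    exact: measurable_dir.
  have isoQ := orth_isometry QQ.
  rewrite fE -[RHS](iso _ _ isoQ mX); congr (mu _); apply/seteqP.
  have QT : Q^T *m Q = 1%:M by exact: mulmx1C.
  have dirQ l (l' : L) : l' = mulmx^~ Q @` l :> set E ->
      dir l' = mulmx^~ Q @` dir l :> set E.
    move=> l'E; apply/seteqP; split => z /=.
      move=> [x [y []]]; rewrite l'E => -[x' lx' <-] [y' ly' <-] ->.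
      by exists (y' - x'); [exists x', y'|rewrite mulmxBl].
    move=> [_ [x [y [lx ly ->]]] <-]; exists (x *m Q), (y *m Q).
    by rewrite mulmxBl l'E; split => //; [exists x|exists y].
  have ballQ l (l' : L) : l' = mulmx^~ Q @` l :> set E ->
      hitting (eball 0 h) l' <-> hitting (eball 0 h) l.
    have eQ (x : E) : enorm (x *m Q) = enorm x by rewrite !enormE dot_orth.
    move=> l'E; split => -[x []]; rewrite ?l'E /eball /= subr0.
      by move=> [y ly <-]; rewrite eQ => yh; exists y; split => //; rewrite /eball /= subr0.
    move=> lx xh; exists (x *m Q); split; first by rewrite l'E; exists x.
    by rewrite /eball /= subr0 eQ.
  split => l.
    move=> [[u Bu uE] lh]; exists (Line (is_line_mul l QQ)) => //.
    have e := dirQ l (Line (is_line_mul l QQ)) erefl.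
    split; last exact/(ballQ l (Line (is_line_mul l QQ)) erefl).
    by rewrite /= (_ : dir _ = u) //; apply: line_inj; rewrite uE e.
  move=> [l' [Bl' l'h] l'E]; split; last by apply/(ballQ l l' l'E).
  by exists (dir l') => //; exact: dirQ.
- rewrite nuB /line_law (_ : _ @^-1` _ = set0) ?set0I ?measure0 //.
  by apply/seteqP; split => // l /= h1; apply: h1; exact: thru0_dir.
Qed.

(* Averaging the translates of [B] over a cube of side [4 h] turns the invariance of [mu]
   into a lower bound by the mass of the pairs (point, direction) describing lines of [B]. *)
Lemma translation_average (mu : {measure set L -> \bar R}) (sigma : probability L R)
    (a : E) (h c : R) (B : set L) :
  is_invariant_line_measure mu -> is_uniform_direction sigma ->
  0 < h -> 0 <= c -> measurable B ->
  (forall z : E, (forall i, `|z 0 i - a 0 i| <= h) -> (c%:E <= sigma (@line_shift R d z @^-1` B))%E) ->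
  ((sphere_area R n / 2 * h ^+ n * c / 2 ^+ d)%:E <= mu B)%E.
Proof.
move=> imu [s0 srot] h0 c0 mB cB.
have [nu [nuE nuc nu0 nuT]] := direction_law imu h0.
have sc : equal_caps sigma by exact: rotation_equal_caps.
have mthru := @measurable_thru0 R n.
have sC : sigma (~` thru0) = 0%E by rewrite probability_setC // s0 subee.
have sp : pos_caps sigma.
  move=> s u s01 u0; apply: lt_le_trans (cap_ge sc s0 s01 u0).
  by rewrite lte_fin exprn_gt0 // divr_gt0 //; case/andP : s01.
have m0 : 0 < sphere_area R n / 2 * h ^+ n.
  by rewrite mulr_gt0 ?exprn_gt0 ?divr_gt0 ?sphere_area_gt0.
set k := sphere_area R n / 2 * h ^+ n in nuT m0 *.
(* The link between the two given measures, by uniqueness. *)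
have nus C : measurable C -> nu C = (sigma C * k%:E)%E.
  move=> mC; have sT : sigma setT = 1%E by exact: probability_setT.
  have e : (sigma C * nu setT = nu C * sigma setT)%E.
    by apply: direction_measure_unique => //; rewrite nuT eqe gt_eqF.
  by rewrite -[LHS]mule1 -sT -e nuT.
have [V V1 VA] : exists2 V : {measure set (d.-tuple R) -> \bar R},
    V [set t | forall i, `|tnth t i| <= 1] = (2 ^+ d)%:E &
    forall c (z : 'I_d -> R) B, 0 < c -> measurable B ->
      ((c ^+ d)%:E * V (affine_tuple c z @^-1` B))%E = V B.
  by have [V [V1 VA]] := @volume_exists R d; exists V.
pose Q r := [set t : d.-tuple R | forall i, `|tnth t i| <= r].
have mQ r : measurable (Q r).
  rewrite (_ : Q r =
      \bigcap_(i in [set: 'I_d]) ((fun t : d.-tuple R => tnth t i) @^-1` `[- r, r])).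
    apply: fin_bigcap_measurable => [|i _]; first exact: finite_finset.
    by rewrite -[X in measurable X]setTI; apply: measurable_tnth.
  apply/seteqP; split => t /=; first by move=> e i _; rewrite /= in_itv /= -ler_norml.
  by move=> e i; rewrite ler_norml; have := e i I; rewrite /= in_itv.
have VQ r : 0 < r -> V (Q r) = ((2 * r) ^+ d)%:E.
  move=> r0; rewrite -(VA _ (fun=> 0) _ r0 (mQ r)) exprMn mulrC EFinM -V1.
  congr (_ * V _)%E; apply/seteqP; split => t /= e i; have := e i;
    by rewrite tnth_mktuple addr0 normrM (gtr0_norm r0) -{2}(mulr1 r) ler_pM2l.
have h20 : 0 < 2 * h by rewrite mulr_gt0.
have [V1h V1hE] : exists m' : {finite_measure set (d.-tuple R) -> \bar R},
    forall A, m' A = V (A `&` Q h) by apply: restr_pack => //; rewrite VQ // ltry.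
have [V2h V2hE] : exists m' : {finite_measure set (d.-tuple R) -> \bar R},
    forall A, m' A = V (A `&` Q (2 * h)) by apply: restr_pack => //; rewrite VQ // ltry.
have mhit : measurable (@hitting R d (eball 0 h)).
  by apply: measurable_hitting; exact: eball_open.
have [muh muhE] : exists m' : {finite_measure set L -> \bar R},
    forall A, m' A = mu (A `&` hitting (eball 0 h)).
  by apply: restr_pack => //; rewrite imu.2 // ltry.
pose S (tl : d.-tuple R * L) := line_shift (a + tuple_row tl.1) tl.2.
have mS : measurable_fun setT S.
  rewrite (_ : S = line_shift a \o (fun tl => line_shift (tuple_row tl.1) tl.2)); last first.
    by apply/funext => tl; rewrite /S /= shift_shift.
  by apply: measurableT_comp; [exact: measurable_shift|exact: measurable_shift_pair].
pose A1 := S @^-1` B.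
have mA1 : measurable A1 by rewrite /A1 -[X in measurable X]setTI; exact: mS.
pose A2 := (fun tl : d.-tuple R * L => S (tl.1, dir tl.2)) @^-1` B `&`
  (setT `*` hitting (eball 0 h)).
have mA2 : measurable A2.
  apply: measurableI; last exact: measurableX.
  rewrite -[X in measurable X]setTI.
  have mg : measurable_fun setT (fun tl : d.-tuple R * L => (tl.1, dir tl.2)); last first.
    exact: (measurableT_comp mS mg).
  by apply: measurable_fun_pair => //; apply: measurableT_comp => //; exact: measurable_dir.
(* Each translate of [B] has mass [mu B], and the cube of half-side 2 h has volume (4 h)^d. *)
have up : (\int[V2h]_t muh (xsection A1 t) <= mu B * ((4 * h) ^+ d)%:E)%E.
  have -> : (((4 * h) ^+ d)%:E = V2h setT)%E.
    by rewrite V2hE setTI VQ //; congr ((_ ^+ _)%:E); ring.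
  rewrite -integral_cst //; apply: ge0_le_integral => //.
    by apply: measurable_fun_xsection.
  move=> t _; rewrite muhE /cst -(imu.1 _ _ (isometry_trans (a + tuple_row t)) mB).
  rewrite line_preimage_shift le_measure ?inE //.
  - by apply: measurableI => //; exact: measurable_xsection.
  - by rewrite -[X in measurable X]setTI; exact: measurable_shift.
  by move=> l []; rewrite /xsection /= inE.
(* A line hitting the small ball at [p] is its direction shifted by [p]. Moving the translation
   vector by [p] therefore replaces the line by its direction, and takes the cube of half-side h
   into that of half-side 2 h. *)
have mid : (\int[V1h]_t muh (xsection A2 t) <= \int[V2h]_t muh (xsection A1 t))%E.
  rewrite !swap_sections //; apply: ge0_le_integral => //.
  - by apply: measurable_fun_ysection.
  - by apply: measurable_fun_ysection.
  move=> l _; rewrite [leLHS]V1hE [leRHS]V2hE.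
  have [[p [lp /=]]|nl] := pselect (hitting (eball 0 h) l); last first.
    rewrite (_ : ysection A2 l = set0) ?set0I ?measure0 //.
    by apply/seteqP; split => // t; rewrite /ysection /= inE => -[_ []].
  rewrite /eball /= subr0 => ph.
  have mY : measurable (ysection A2 l `&` Q h).
    by apply: measurableI => //; exact: measurable_ysection.
  rewrite -(VA 1 (p 0) _ ltr01 mY) expr1n mul1e le_measure ?inE //.
  - by rewrite -[X in measurable X]setTI; apply: measurable_affine_tuple.
  - by apply: measurableI => //; exact: measurable_ysection.
  move=> t [/=]; rewrite /ysection /= !inE => -[/= BS _] Qt; split.
    move: BS; rewrite /A1 /S /= tuple_row_affine scale1r addrA.
    by rewrite -(shift_shift (a + tuple_row t) p) (shift_dir lp).
  move=> i; have := Qt i; rewrite tnth_mktuple mul1r => e.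
  have := le_trans (coord_le_enorm p i) (ltW ph) => e2.
  have := ler_normB (tnth t i + p 0 i) (p 0 i); rewrite addrK; lra.
(* Over the smaller cube every translate satisfies the bound [c]; the ratio of the two cubes is the
   loss 2^d. *)
have low : ((k * c)%:E * ((2 * h) ^+ d)%:E <= \int[V1h]_t muh (xsection A2 t))%E.
  have -> : (((2 * h) ^+ d)%:E = V1h (Q h))%E by rewrite V1hE setIid VQ.
  rewrite -integral_cst // [leLHS]integral_mkcond; apply: ge0_le_integral => //.
  - by move=> t _; rewrite patchE; case: ifP => _ //; rewrite lee_fin mulr_ge0 // ltW.
  - by apply/(measurable_restrictT _ (mQ h)); exact: measurable_cst.
  - by apply: measurable_fun_xsection.
  move=> t _; rewrite patchE; case: ifPn => [tQ|_]; last exact: measure_ge0.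
  have Qt : Q h t by exact: set_mem tQ.
  have mz : measurable (@line_shift R d (a + tuple_row t) @^-1` B).
    by rewrite -[X in measurable X]setTI; exact: measurable_shift.
  apply: (@le_trans _ _ (nu (@line_shift R d (a + tuple_row t) @^-1` B))).
    rewrite nus // /cst EFinM muleC lee_pmul2r ?lte_fin ?fin_numE //.
    apply: cB => i; rewrite !mxE [a 0 i + _]addrC addrK; exact: Qt.
  rewrite nuE /line_law muhE le_eqVlt; apply/orP; left; apply/eqP; congr (mu _).
  apply/seteqP; split => l; first by move=> [Bl lh]; split => //; rewrite /xsection /= inE.
  by rewrite /xsection /= inE => -[[]].
have := le_trans low (le_trans mid up).
have : (0 <= mu B)%E by exact: measure_ge0.
case: (mu B) => [b|_ _|//]; last by rewrite leey.
rewrite -!EFinM !lee_fin => b0 e.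
rewrite ler_pdivrMr ?exprn_gt0 // -(ler_pM2r (exprn_gt0 d h20)) -[leRHS]mulrA -exprMn.
by rewrite (_ : 2 * (2 * h) = 4 * h) //; ring.
Qed.

End direction_law.

(** * Lines joining two small balls and avoiding F *)

Section good_lines.
Context {R : realType} {n : nat}.
Local Notation d := n.+1.
Local Notation E := ('rV[R]_d).
Local Notation L := (line R d).

Lemma good_lines (mu : {measure set L -> \bar R}) (sigma : probability L R)
    (F : set E) (Omega s h rho : R) (a b : E) :
  is_invariant_line_measure mu -> is_uniform_direction sigma ->
  mu_measurable mu (hitting F) ->
  0 < s < 1 -> 0 < h -> d%:R * h < rho -> Omega <= (s / 4) ^+ n ->
  (forall z : E, (forall i, `|z 0 i - a 0 i| <= h) -> (solid_angle sigma F z < Omega%:E)%E) ->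
  (forall z : E, (forall i, `|z 0 i - a 0 i| <= h) -> s * enorm (b - z) <= rho) ->
  exists B : set L, [/\ measurable B,
    B `<=` (hitting (eball a rho) `&` hitting (eball b rho)) `\` hitting F &
    ((sphere_area R n / 2 * h ^+ n * ((s / 4) ^+ n - Omega) / 2 ^+ d)%:E <= mu B)%E].
Proof.
move=> imu uni [C mC [Z [mZ Z0 CZ]]] s01 h0 hrho Os angle closeb.
have [s1 srot] := uni.
have sc : equal_caps sigma by exact: rotation_equal_caps.
have mthru := @measurable_thru0 R n.
have sC : sigma (~` thru0) = 0%E by rewrite probability_setC // s1 subee.
have mH x : measurable (@hitting R d (eball x rho)).
  by apply: measurable_hitting; exact: eball_open.
have rho0 : 0 < rho by apply: le_lt_trans hrho; rewrite mulr_ge0 // ltW.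
(* [hitting F] is replaced by the larger measurable set made of [C] and the null set [Z] covering
   the discrepancy. *)
pose B := (hitting (eball a rho) `&` hitting (eball b rho)) `\` (C `|` Z).
have mB : measurable B.
  by apply: measurableD; [exact: measurableI|exact: measurableU].
exists B; split => //.
  move=> l [ab nCZ]; split => // lF; apply: nCZ.
  by have [Cl|nC] := pselect (C l); [left|right; apply: CZ; left].
(* The null set is put back: it adds no [mu]-mass, whereas the directions of its lines through a
   given point may carry [sigma]-mass that the pointwise bound must not lose. *)
have -> : mu B = mu (B `|` Z) by rewrite measureU0.
apply: (translation_average (a := a) imu uni h0) => //; first by rewrite subr_ge0.
  exact: measurableU.
move=> z za.
have [u u0 uE] : exists2 u : L, thru0 u & b - z != 0 -> b - z \on u.
  have [e|bz] := eqVneq (b - z) 0; first by exists (dir point) => //; exact: thru0_dir.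
  by exists (span_line bz); [exact: thru0_span|move=> _; exact: span_line_id].
have msh : measurable (@line_shift R d z @^-1` (B `|` Z)).
  rewrite -[X in measurable X]setTI; apply: measurable_shift => //; exact: measurableU.
(* A line through [z] with direction in the cap passes near both centres; it belongs to [B] or [Z]
   unless it hits F. *)
have sub : [set l | near_dir s l u] `&` thru0 `<=`
    (@line_shift R d z @^-1` (B `|` Z)) `|` hitting (translate F (- z)).
  move=> l [lu l0].
  have [lF|nF] := pselect (hitting F (line_shift z l)).
    right; have [f [/shiftP lf Ff]] := lF; exists (f - z); split => //.
    by exists f.
  left => /=; have [Zl|nZ] := pselect (Z (line_shift z l)); [by right|left].
  split; last by move=> [Cl|//]; apply: nZ; apply: CZ; right.
  split.
    exists z; split; first by apply/shiftP; rewrite subrr; exact/thru0P.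
    rewrite /eball /=; apply: le_lt_trans hrho; apply: enorm_le_coord => i.
    by rewrite !mxE; exact: za.
  have [bz|bz] := eqVneq (b - z) 0.
    exists z; split; first by apply/shiftP; rewrite subrr; exact/thru0P.
    by rewrite /eball /= -enormN opprB bz enorm0.
  move: lu => /near_dirC /(near_dir_close _ u0 l0 (uE bz) bz) [|q lq qb].
    by case/andP : s01 => /ltW.
  exists (z + q); split; first by apply/shiftP; rewrite addrC addKr.
  rewrite /eball /= (_ : z + q - b = q - (b - z)).
    exact: lt_le_trans qb (closeb z za).
  by rewrite opprB addrCA addrA.
have cap := cap_ge sc s1 s01 u0.
have e : sigma ([set l | near_dir s l u] `&` thru0) = sigma [set l | near_dir s l u].
  have := measure_thru0I sC (measurable_cap s u); exact.
have mI : measurable ([set l | near_dir s l u] `&` thru0).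
  by apply: measurableI => //; exact: measurable_cap.
(* The directions hitting F may form a nonmeasurable set, hence subadditivity of the outer
   measure. *)
have : (mu_ext sigma ([set l | near_dir s l u] `&` thru0) <=
   mu_ext sigma (@line_shift R d z @^-1` (B `|` Z)) +
   mu_ext sigma (hitting (translate F (- z))))%E.
  apply: le_trans (le_mu_ext _ sub) _.
  exact: outer_measureU2.
have e1 : mu_ext sigma ([set l | near_dir s l u] `&` thru0) = sigma [set l | near_dir s l u].
  by rewrite measurable_mu_extE.
have e2 : mu_ext sigma (@line_shift R d z @^-1` (B `|` Z)) = sigma (@line_shift R d z @^-1` (B `|` Z)).
  by rewrite measurable_mu_extE.
rewrite e1 e2 => le1.
have le2 := le_trans cap le1.
have := angle z za; rewrite /solid_angle => ang.
have fs : sigma (@line_shift R d z @^-1` (B `|` Z)) \is a fin_num by exact: fin_num_measure.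
have : (((s / 4) ^+ n)%:E <= sigma (@line_shift R d z @^-1` (B `|` Z)) + Omega%:E)%E.
  by apply: le_trans le2 _; rewrite leeD2lE // ltW.
by rewrite -(fineK fs) -EFinD !lee_fin lerBlDr.
Qed.

End good_lines.

(** * Multiscale curves *)

Section curves.
Context {R : realType} {d : nat}.
Local Notation E := ('rV[R]_d).
Variables (Pi : set (line R d * R)) (A : set (line R d)).
Implicit Types (f g : R -> E) (a b c e v T : R).

Definition lip v a b f := forall s t, a <= s -> s <= t -> t <= b ->
  enorm (f t - f s) <= v * (t - s).

(* [e] bounds the total length of the time intervals on which nothing is known about [f]. *)
Inductive tame f : R -> R -> R -> Prop :=
| tame_rough a b : a <= b -> tame f a b (b - a)
| tame_straight a b p w : a <= b ->
    (forall t, a <= t <= b -> f t = p + (t - a) *: w) ->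
    (w = 0 \/ exists l v, [/\ Pi (l, v), A l, enorm w <= v & p \on l /\ w \on dir l]) ->
    tame f a b 0
| tame_cat a b c e e' : tame f a b e -> tame f b c e' -> tame f a c (e + e').

Lemma tame_le f a b e : tame f a b e -> a <= b.
Proof. by elim => // {a b e} a b c e e' _ ab _ bc; exact: le_trans bc. Qed.

Lemma tame_ge0 f a b e : tame f a b e -> 0 <= e.
Proof.
elim => // {a b e} [a b|a b c e e' _ e0 _ e1]; first by rewrite subr_ge0.
exact: addr_ge0.
Qed.

Lemma tame_ext f g a b e : (forall t, a <= t <= b -> f t = g t) ->
  tame f a b e -> tame g a b e.
Proof.
move=> + h; elim: h => {a b e} [a b ab _|a b p w ab fE pw fg|a b c e e' h1 ih1 h2 ih2 fg].
- exact: tame_rough.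
- by apply: (@tame_straight _ _ _ p w) => // t tab; rewrite -fg // fE.
apply: (@tame_cat _ _ b); [apply: ih1|apply: ih2] => t /andP[t1 t2]; apply: fg.
  by rewrite t1 (le_trans t2) // (tame_le h2).
by rewrite t2 (le_trans _ t1) // (tame_le h1).
Qed.

Lemma tame_shift f a b c e : tame f a b e ->
  tame (fun t => f (t - c)) (a + c) (b + c) e.
Proof.
elim => {a b e} [a b ab|a b p w ab fE pw|a b c' e e' _ ih1 _ ih2].
- by rewrite (_ : b - a = (b + c) - (a + c)); [apply: tame_rough; rewrite lerD2r|ring].
- apply: (@tame_straight _ _ _ p w); rewrite ?lerD2r // => t tab.
  rewrite fE; first by congr (_ + _ *: _); ring.
  by move: tab; rewrite lerBrDr lerBlDr.
exact: tame_cat ih1 ih2.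
Qed.

Lemma lip_le v v' a b f : v <= v' -> lip v a b f -> lip v' a b f.
Proof.
move=> vv fl s t h1 h2 h3; apply: le_trans (fl _ _ h1 h2 h3) _.
by apply: ler_wpM2r; rewrite ?subr_ge0.
Qed.

Definition glue T f g : R -> E := fun t => if t <= T then f t else g (t - T).

Section glue.
Variables (T : R) (f g : R -> E).
Hypothesis fg : f T = g 0.

Lemma glueL t : t <= T -> glue T f g t = f t.
Proof. by rewrite /glue => ->. Qed.

Lemma glueR t : T <= t -> glue T f g t = g (t - T).
Proof.
move=> Tt; rewrite /glue; case: ifPn => // tT.
by rewrite (le_anti (introT andP (conj tT Tt))) subrr.
Qed.

Lemma lip_glue v T' : 0 <= T -> 0 <= T' -> lip v 0 T f -> lip v 0 T' g ->
  lip v 0 (T + T') (glue T f g).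
Proof.
move=> T0 T0' fl gl s t s0 st tT.
have [tT1|Tt] := leP t T.
  by rewrite !glueL ?(le_trans st) //; exact: fl.
have [sT|Ts] := leP s T; last first.
  have Tt' := ltW Tt; have Ts' := ltW Ts; rewrite !glueR //.
  have -> : t - s = (t - T) - (s - T) by ring.
  by apply: gl; lra.
have Tt' := ltW Tt; rewrite (glueR Tt') glueL //.
apply: (le_trans (ler_enormB _ (f T) _)).
have h1 : enorm (f T - f s) <= v * (T - s) by apply: fl.
have h2 : enorm (g (t - T) - g 0) <= v * (t - T - 0) by apply: gl; lra.
rewrite -fg in h2; lra.
Qed.

Lemma tame_glue T' e e' : tame f 0 T e -> tame g 0 T' e' ->
  tame (glue T f g) 0 (T + T') (e + e').
Proof.
move=> h1 h2; apply: (@tame_cat _ _ T).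
  by apply: tame_ext h1 => t /andP[_ tT]; rewrite glueL.
have := tame_shift T h2; rewrite add0r (addrC T').
by apply: tame_ext => t /andP[Tt _]; rewrite glueR.
Qed.

End glue.

(** A limit of infinitely many refinements need not be a finite concatenation of straight pieces. It
    is one up to rough intervals of arbitrarily small total length, which suffices for the speed
    limits and for the support. *)
Definition curve v T x y f := [/\ 0 <= T, f 0 = x, f T = y, lip v 0 T f &
  forall e, 0 < e -> exists2 e', e' <= e & tame f 0 T e'].

Lemma curve_glue v T T' x y z f g : curve v T x y f -> curve v T' y z g ->
  curve v (T + T') x z (glue T f g).
Proof.
move=> [T0 f0 fT fl ft] [T0' g0 gT gl gt]; have fg : f T = g 0 by rewrite fT.
split.
- exact: addr_ge0.
- by rewrite glueL.
- by rewrite glueR ?lerDl // addrC addKr.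
- exact: lip_glue.
move=> e e0; have e20 : 0 < e / 2 by rewrite divr_gt0.
have [e1 e1e h1] := ft _ e20; have [e2 e2e h2] := gt _ e20.
by exists (e1 + e2); [rewrite [leRHS]splitr lerD|exact: tame_glue].
Qed.

Definition segment (x y : E) T : R -> E := fun t => x + (t / T) *: (y - x).

Lemma segment0 x y T : segment x y T 0 = x.
Proof. by rewrite /segment mul0r scale0r addr0. Qed.

Lemma segment1 x y T : T != 0 -> segment x y T T = y.
Proof. by move=> T0; rewrite /segment divff // scale1r addrC subrK. Qed.

Lemma lip_segment x y T v a b : 0 < T -> enorm (y - x) <= v * T -> lip v a b (segment x y T).
Proof.
move=> T0 xy s t _ st _.
rewrite /segment opprD addrACA subrr add0r -scalerBl -mulrBl enormZ.
have ts : 0 <= t - s by rewrite subr_ge0.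
rewrite ger0_norm; last by rewrite divr_ge0 // ltW.
rewrite mulrAC ler_pdivrMr // mulrAC mulrC.
exact: ler_wpM2r.
Qed.

End curves.

Section limits.
Context {R : realType}.

(** The intervals of radius 2 C / 2^n around [u n] are nested, and the supremum of their left ends
    lies in all of them. *)
Lemma geometric_limit (u : nat -> R) (C : R) :
  (forall n, `|u n - u n.+1| <= C / 2 ^+ n) ->
  exists l, forall n, `|u n - l| <= 2 * C / 2 ^+ n.
Proof.
move=> h.
have C2 n : C / 2 ^+ n = 2 * (C / 2 ^+ n.+1).
  by rewrite exprS; field; rewrite expf_neq0.
have step n : u n - 2 * (C / 2 ^+ n) <= u n.+1 - 2 * (C / 2 ^+ n.+1) /\
    u n.+1 + 2 * (C / 2 ^+ n.+1) <= u n + 2 * (C / 2 ^+ n).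
  by have := h n; rewrite ler_norml C2 => /andP[]; split; lra.
have up m n : (m <= n)%N -> u m - 2 * (C / 2 ^+ m) <= u n - 2 * (C / 2 ^+ n) /\
    u n + 2 * (C / 2 ^+ n) <= u m + 2 * (C / 2 ^+ m).
  move=> /subnK <-; elim: (n - m)%N => [//|k [ih1 ih2]].
  have [h1 h2] := step (k + m)%N.
  by rewrite addSn; split; [exact: le_trans h1|exact: le_trans h2 _].
have C0 n : 0 <= 2 * (C / 2 ^+ n) by rewrite mulr_ge0 // (le_trans _ (h n)).
have ub m n : u m - 2 * (C / 2 ^+ m) <= u n + 2 * (C / 2 ^+ n).
  have [mn|nm] := leqP m n.
    by have [h1 _] := up _ _ mn; have := C0 n; lra.
  by have [_ h1] := up _ _ (ltnW nm); have := C0 m; lra.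
pose S := [set u n - 2 * (C / 2 ^+ n) | n in [set: nat]].
have hS : has_sup S.
  split; first by exists (u 0%N - 2 * (C / 2 ^+ 0)); exists 0%N.
  by exists (u 0%N + 2 * (C / 2 ^+ 0)) => _ [m _ <-]; exact: ub.
exists (sup S) => n.
have h1 : u n - 2 * (C / 2 ^+ n) <= sup S by apply: sup_upper_bound => //; exists n.
have h2 : sup S <= u n + 2 * (C / 2 ^+ n).
  by apply: ge_sup; [exact: hS.1|move=> _ [m _ <-]; exact: ub].
by rewrite ler_norml -mulrA; apply/andP; split; lra.
Qed.

Lemma le_geometric (a b C : R) : (forall n, a <= b + C / 2 ^+ n) -> a <= b.
Proof.
move=> h; rewrite leNgt; apply/negP => ba.
have C0 : 0 < C by have := h 0%N; rewrite expr0 divr1; lra.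
have ab0 : 0 < a - b by rewrite subr_gt0.
pose n := Num.bound (C / (a - b)).
have nP : C / (a - b) < n%:R by apply: archi_boundP; rewrite divr_ge0 // ltW.
have n2 : n%:R <= 2 ^+ n :> R.
  by rewrite -natrX ler_nat ltnW // ltn_expl.
have := h n; rewrite leNgt => /negP; apply.
rewrite -ltrBrDl ltr_pdivrMr ?exprn_gt0 //.
move: nP; rewrite ltr_pdivrMr // => nP; apply: (lt_le_trans nP).
by rewrite mulrC; apply: ler_wpM2l => //; exact: ltW.
Qed.

End limits.

(** * Limits of hierarchical approximations *)

Section hierarchical_curve.
Context {R : realType} {d : nat}.
Local Notation E := ('rV[R]_d).
Variables (Pi : set (line R d * R)) (A : set (line R d)).
Variables (D v T : nat -> R) (W : nat -> set E).
Hypothesis D_gt0 : forall k, 0 < D k.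
Hypothesis D_dec : forall k, D k.+1 <= D k.
Hypothesis v_gt0 : forall k, 0 < v k.
Hypothesis v_dec : forall k, v k.+1 <= v k.
Hypothesis T_gt0 : forall k, 0 < T k.
Hypothesis TE : forall k, T k = T k.+1 + (3 * D k / v k + T k.+1).
Hypothesis T_small : forall k e, 0 < e -> exists n, 2 ^+ n * T (k + n) <= e.
Hypothesis W_inc : forall k, W k `<=` W k.+1.
Hypothesis connect : forall k x y, W k x -> W k y -> enorm (x - y) <= D k ->
  exists p q l u, [/\ Pi (l, u), A l, v k <= u, p \on l /\ q \on l &
    [/\ enorm (x - p) <= D k.+1, enorm (y - q) <= D k.+1, W k.+1 p & W k.+1 q]].

Definition good k x y := [/\ W k x, W k y & enorm (x - y) <= D k].

(** One choice of entry and exit points for all levels and pairs, so that approximations of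
    different depths refine each other. The distance travelled on the line is at most D (k + 1) + D
    k + D (k + 1), hence the factor 3. *)
Lemma entry_exit : exists pq : nat * E * E -> E * E, forall k x y, good k x y ->
  let p := (pq (k, x, y)).1 in let q := (pq (k, x, y)).2 in
  [/\ good k.+1 x p, good k.+1 q y, enorm (q - p) <= 3 * D k &
  exists l u, [/\ Pi (l, u), A l, v k <= u & p \on l /\ q \on l]].
Proof.
have /choice[pq pqP] : forall a : nat * E * E, exists pq : E * E,
    good a.1.1 a.1.2 a.2 ->
    [/\ good a.1.1.+1 a.1.2 pq.1, good a.1.1.+1 pq.2 a.2,
      enorm (pq.2 - pq.1) <= 3 * D a.1.1 &
      exists l u, [/\ Pi (l, u), A l, v a.1.1 <= u & pq.1 \on l /\ pq.2 \on l]].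
  move=> [[k x] y] /=.
  have [gd|] := pselect (good k x y); last by exists (0, 0).
  have [Wx Wy xy] := gd.
  have [p [q [l [u [lP lA vu pql [xp yq Wp Wq]]]]]] := connect Wx Wy xy.
  exists (p, q) => _ /=; split.
  - by split => //; exact: W_inc.
  - by split => //; [exact: W_inc|rewrite enormB].
  - have := ler_enormB q y p; have := ler_enormB y x p; have := D_dec k.
    by rewrite (enormB q y) (enormB y x); lra.
  - by exists l, u.
by exists pq => k x y; exact: (pqP (k, x, y)).
Qed.


Section construction.
Variable pq : nat * E * E -> E * E.
Hypothesis pqP : forall k x y, good k x y ->
  let p := (pq (k, x, y)).1 in let q := (pq (k, x, y)).2 in
  [/\ good k.+1 x p, good k.+1 q y, enorm (q - p) <= 3 * D k &
  exists l u, [/\ Pi (l, u), A l, v k <= u & p \on l /\ q \on l]].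

Let tau k := 3 * D k / v k.

Let tau_gt0 k : 0 < tau k.
Proof. by rewrite divr_gt0 // mulr_gt0. Qed.

Let assemble k x y (f g : R -> E) :=
  glue (T k.+1) f (glue (tau k) (segment (pq (k, x, y)).1 (pq (k, x, y)).2 (tau k)) g).

(** [n] is the number of levels still resolved. Unresolved pieces are segments of duration [T], not
    supported by a line; as the time schedule is common to all depths, depths n and n + 1 differ
    only on these pieces. *)
Fixpoint approx n k x y : R -> E :=
  if n is n'.+1 then
    assemble k x y (approx n' k.+1 x (pq (k, x, y)).1) (approx n' k.+1 (pq (k, x, y)).2 y)
  else segment x y (T k).

Let approxS n k x y : approx n.+1 k x y =
  assemble k x y (approx n k.+1 x (pq (k, x, y)).1) (approx n k.+1 (pq (k, x, y)).2 y).
Proof. by []. Qed.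

Let T_half k : T k.+1 <= T k / 2.
Proof. by have := TE k; have := tau_gt0 k; rewrite /tau; lra. Qed.

Let assemble_ends k x y f g : good k x y ->
  f 0 = x -> f (T k.+1) = (pq (k, x, y)).1 -> g 0 = (pq (k, x, y)).2 -> g (T k.+1) = y ->
  [/\ assemble k x y f g 0 = x, assemble k x y f g (T k) = y,
     glue (tau k) (segment (pq (k, x, y)).1 (pq (k, x, y)).2 (tau k)) g 0 =
       (pq (k, x, y)).1 &
     segment (pq (k, x, y)).1 (pq (k, x, y)).2 (tau k) (tau k) = g 0].
Proof.
move=> gd f0 fT g0 gT; have t0 := tau_gt0 k.
have s1 : segment (pq (k, x, y)).1 (pq (k, x, y)).2 (tau k) (tau k) = g 0.
  by rewrite segment1 ?gt_eqF.
have s0 : glue (tau k) (segment (pq (k, x, y)).1 (pq (k, x, y)).2 (tau k)) g 0 =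
    (pq (k, x, y)).1 by rewrite glueL ?(ltW t0) // segment0.
split => //; first by rewrite /assemble glueL // ltW.
rewrite /assemble (TE k); have T1 := T_gt0 k.+1.
have fgT : f (T k.+1) = glue (tau k) (segment (pq (k, x, y)).1 (pq (k, x, y)).2 (tau k)) g 0.
  by rewrite fT s0.
rewrite (glueR fgT) ?lerDl ?addr_ge0 ?(ltW t0) ?(ltW T1) // (addrC (T k.+1)) addrK.
by rewrite (glueR s1) ?lerDl ?(ltW T1) // addrC addKr.
Qed.

Let approx_ends n k x y : good k x y -> approx n k x y 0 = x /\ approx n k x y (T k) = y.
Proof.
elim: n k x y => [|n ih] k x y gd /=; first by rewrite segment0 segment1 // gt_eqF.
have [g1 g2 _ _] := pqP gd.
have [a0 a1] := ih _ _ _ g1; have [b0 b1] := ih _ _ _ g2.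
by have [] := assemble_ends gd a0 a1 b0 b1.
Qed.

Let segment_speed k x y : good k x y ->
  enorm ((pq (k, x, y)).2 - (pq (k, x, y)).1) <= v k * tau k.
Proof.
by move=> gd; have [_ _ h _] := pqP gd; rewrite /tau mulrC divfK // gt_eqF.
Qed.

Let approx_lip n k x y : good k x y -> lip (v k) 0 (T k) (approx n k x y).
Proof.
elim: n k x y => [|n ih] k x y gd /=.
  apply: lip_segment => //; have [_ _ xy] := gd; rewrite enormB; apply: (le_trans xy).
  have h : D k <= v k * tau k by rewrite /tau mulrC divfK ?gt_eqF //; have := D_gt0 k; lra.
  by apply: (le_trans h); rewrite ler_pM2l // (TE k); have := T_gt0 k.+1; rewrite /tau; lra.
have [g1 g2 _ _] := pqP gd.
have [a0 a1] := approx_ends n g1; have [b0 b1] := approx_ends n g2.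
have [_ _ s0 s1] := assemble_ends gd a0 a1 b0 b1.
rewrite (TE k) /assemble; have T1 := T_gt0 k.+1; have t0 := tau_gt0 k.
apply: lip_glue; rewrite ?a1 ?s0 ?addr_ge0 ?ltW //; first by exact: lip_le (ih _ _ _ g1).
apply: lip_glue; rewrite ?ltW //; last by exact: lip_le (ih _ _ _ g2).
by apply: lip_segment => //; exact: segment_speed.
Qed.

(** The discrepancy is confined to unresolved pieces, whose duration at least halves at each level
    while the speed does not increase. *)
Let approx_step n k x y t : good k x y -> 0 <= t <= T k ->
  enorm (approx n k x y t - approx n.+1 k x y t) <= 2 * (v k * T k) / 2 ^+ n.
Proof.
elim: n k x y t => [|n ih] k x y t gd /andP[t0 tT].
  rewrite expr0 divr1; have [a0 _] := approx_ends 0 gd; have [b0 _] := approx_ends 1 gd.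
  have := approx_lip 0 gd (lexx 0) t0 tT; have := approx_lip 1 gd (lexx 0) t0 tT.
  rewrite a0 b0 subr0 => h1 h2; apply: (le_trans (ler_enormB _ x _)).
  rewrite (enormB x); have : v k * t <= v k * T k by rewrite ler_pM2l.
  by lra.
have [g1 g2 _ _] := pqP gd.
have [a0 a1] := approx_ends n g1; have [b0 b1] := approx_ends n g2.
have [a0' a1'] := approx_ends n.+1 g1; have [b0' b1'] := approx_ends n.+1 g2.
have [_ _ s0 s1] := assemble_ends gd a0 a1 b0 b1.
have [_ _ s0' s1'] := assemble_ends gd a0' a1' b0' b1'.
have le : 2 * (v k.+1 * T k.+1) / 2 ^+ n <= 2 * (v k * T k) / 2 ^+ n.+1.
  rewrite [leRHS](_ : _ = 2 * (v k * (T k / 2)) / 2 ^+ n); last first.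
    by rewrite exprS; field; rewrite expf_neq0.
  apply: ler_wpM2r; first by rewrite invr_ge0 exprn_ge0.
  have : v k.+1 * T k.+1 <= v k * (T k / 2).
    exact: ler_pM (ltW (v_gt0 _)) (ltW (T_gt0 _)) (v_dec k) (T_half k).
  by lra.
have t0' := tau_gt0 k; have T1 := T_gt0 k.+1.
have bound0 : 0 <= 2 * (v k * T k) / 2 ^+ n.+1.
  by rewrite divr_ge0 ?exprn_ge0 // mulr_ge0 // mulr_ge0 // ltW.
have [tT1|/ltW Tt] := leP t (T k.+1).
  rewrite (approxS n) (approxS n.+1) /assemble !glueL //.
  by apply: le_trans le; apply: ih => //; rewrite t0.
rewrite (approxS n) (approxS n.+1) /assemble.
rewrite !(@glueR _ _ (T k.+1)) ?a1 ?a1' ?s0 ?s0' //.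
have [tT2|/ltW Tt2] := leP (t - T k.+1) (tau k).
  by rewrite !glueL // subrr enorm0.
rewrite !(@glueR _ _ (tau k)) //.
apply: le_trans le; apply: ih => //; move: tT; rewrite (TE k) -/(tau k); lra.
Qed.

Let limit_exists k x y t : good k x y -> 0 <= t <= T k ->
  exists z : E, forall n, enorm (approx n k x y t - z) <= d%:R * (4 * (v k * T k)) / 2 ^+ n.
Proof.
move=> gd tT; have /choice[z zP] : forall i : 'I_d, exists l, forall n,
    `|approx n k x y t 0 i - l| <= 2 * (2 * (v k * T k)) / 2 ^+ n.
  move=> i; apply: geometric_limit => n; apply: le_trans (approx_step n gd tT).
  by have := coord_le_enorm (approx n k x y t - approx n.+1 k x y t) i; rewrite !mxE.
exists (\row_i z i) => n; rewrite -mulrA; apply: enorm_le_coord => i; rewrite !mxE.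
by apply: (le_trans (zP i n)); rewrite mulrA (_ : 2 * 2 = 4) //; ring.
Qed.

Lemma limit_choice : exists X : nat * E * E * R -> E, forall k x y t, good k x y ->
  0 <= t <= T k -> forall n,
  enorm (approx n k x y t - X (k, x, y, t)) <= d%:R * (4 * (v k * T k)) / 2 ^+ n.
Proof.
have /choice[X XP] : forall a : nat * E * E * R, exists z : E,
    good a.1.1.1 a.1.1.2 a.1.2 -> 0 <= a.2 <= T a.1.1.1 -> forall n,
    enorm (approx n a.1.1.1 a.1.1.2 a.1.2 a.2 - z) <=
      d%:R * (4 * (v a.1.1.1 * T a.1.1.1)) / 2 ^+ n.
  move=> [[[k x] y] t] /=.
  have [[gd tT]|h] := pselect (good k x y /\ 0 <= t <= T k).
    by have [z zP] := limit_exists gd tT; exists z.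
  by exists 0 => gd tT; exfalso; apply: h.
by exists X => k x y t; exact: (XP (k, x, y, t)).
Qed.

Section limit.
Variable X : nat * E * E * R -> E.
Hypothesis XP : forall k x y t, good k x y -> 0 <= t <= T k -> forall n,
  enorm (approx n k x y t - X (k, x, y, t)) <= d%:R * (4 * (v k * T k)) / 2 ^+ n.

Let limit_unique k x y t z (C : R) : good k x y -> 0 <= t <= T k ->
  (forall n, enorm (approx n.+1 k x y t - z) <= C / 2 ^+ n) -> X (k, x, y, t) = z.
Proof.
move=> gd tT h; apply/eqP; rewrite -subr_eq0 -enorm_eq0; apply/eqP/le_anti.
rewrite enorm_ge0 andbT.
apply: (@le_geometric _ _ _ (d%:R * (4 * (v k * T k)) / 2 + C)) => n.
rewrite add0r mulrDl; apply: (le_trans (ler_enormB _ (approx n.+1 k x y t) _)).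
apply: lerD; last exact: h.
by rewrite enormB -mulrA -invfM -exprS; exact: XP.
Qed.

Let f k x y : R -> E := fun t => X (k, x, y, t).

Let f_ends k x y : good k x y -> f k x y 0 = x /\ f k x y (T k) = y.
Proof.
move=> gd; split; apply: (@limit_unique _ _ _ _ _ 0) => //; rewrite ?lexx ?ltW // => n;
  by have [e0 e1] := approx_ends n.+1 gd; rewrite ?e0 ?e1 subrr enorm0 mul0r.
Qed.

Let f_lip k x y : good k x y -> lip (v k) 0 (T k) (f k x y).
Proof.
move=> gd s t s0 st tT; pose C := d%:R * (4 * (v k * T k)).
apply: (@le_geometric _ _ _ (C + C)) => n.
have := approx_lip n gd s0 st tT; have := XP gd (introT andP (conj (le_trans s0 st) tT)) n.
have := XP gd (introT andP (conj s0 (le_trans st tT))) n.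
rewrite (mulrDl C C) -/C /f; set a := approx _ _ _ _ s; set b := approx _ _ _ _ t => h1 h2 h3.
have := ler_enormB (X (k, x, y, t)) b (X (k, x, y, s)).
by have := ler_enormB b a (X (k, x, y, s)); rewrite (enormB (X (k, x, y, t)) b); lra.
Qed.

(** The self-similarity of the approximations passes to the limit; it exposes the straight pieces of
    the limit curve. *)
Let f_assemble k x y t : good k x y -> 0 <= t <= T k ->
  f k x y t = assemble k x y (f k.+1 x (pq (k, x, y)).1) (f k.+1 (pq (k, x, y)).2 y) t.
Proof.
move=> gd tT; have [g1 g2 _ _] := pqP gd.
have [c0 c1] := f_ends g1; have [e0 e1] := f_ends g2.
have [_ _ s0' s1'] := assemble_ends gd c0 c1 e0 e1.
have /andP[t0 tT'] := tT; have t0' := tau_gt0 k; have T1 := T_gt0 k.+1.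
pose C := d%:R * (4 * (v k.+1 * T k.+1)).
have C0 : 0 <= C by rewrite !mulr_ge0 // ltW.
apply: (@limit_unique _ _ _ _ _ C) => // n.
have [a0 a1] := approx_ends n g1; have [b0 b1] := approx_ends n g2.
have [_ _ s0 s1] := assemble_ends gd a0 a1 b0 b1.
rewrite (approxS n) /assemble.
have [tT1|/ltW Tt] := leP t (T k.+1).
  by rewrite !glueL //; apply: XP => //; rewrite t0.
rewrite !(@glueR _ _ (T k.+1)) ?a1 ?c1 ?s0 ?s0' //.
have [tT2|/ltW Tt2] := leP (t - T k.+1) (tau k).
  by rewrite !glueL // subrr enorm0 divr_ge0 // exprn_ge0.
rewrite !(@glueR _ _ (tau k)) //; apply: XP => //.
by move: tT'; rewrite (TE k) -/(tau k); lra.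
Qed.

Let f_tame n k x y : good k x y -> tame Pi A (f k x y) 0 (T k) (2 ^+ n * T (k + n)).
Proof.
elim: n k x y => [|n ih] k x y gd.
  by rewrite expr0 mul1r addn0 -{2}(subr0 (T k)); apply: tame_rough; exact: ltW.
have [g1 g2 _ [l [u [lP lA vu [pl ql]]]]] := pqP gd.
have [c0 c1] := f_ends g1; have [e0 e1] := f_ends g2.
have [_ _ s0 s1] := assemble_ends gd c0 c1 e0 e1.
apply: (@tame_ext _ _ _ _ (assemble k x y (f k.+1 x (pq (k, x, y)).1)
    (f k.+1 (pq (k, x, y)).2 y))).
  by move=> t tT; rewrite -f_assemble.
rewrite (TE k) (_ : 2 ^+ n.+1 * _ = 2 ^+ n * T (k.+1 + n) + (0 + 2 ^+ n * T (k.+1 + n)));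
  last by rewrite addnS addSn exprS; ring.
apply: tame_glue; first by rewrite c1 s0.
  exact: ih.
apply: tame_glue => //; last exact: ih.
apply: (@tame_straight _ _ _ _ _ _ _ (pq (k, x, y)).1
  ((tau k)^-1 *: ((pq (k, x, y)).2 - (pq (k, x, y)).1))).
- exact: ltW.
- by move=> t _; rewrite /segment subr0 scalerA.
right; exists l, u; split => //.
  apply: le_trans vu; rewrite enormZ ger0_norm ?invr_ge0 ?(ltW (tau_gt0 k)) //.
  by rewrite mulrC ler_pdivrMr //; exact: segment_speed.
split => //; have /(dirP _ pl) := ql; rewrite /= => -[a [b [la lb ab]]].
have /lineP[w w0 lE] := pl; move: ql; rewrite lE => -[r _ <-].
rewrite addrC addKr scalerA; exists (pq (k, x, y)).1, ((pq (k, x, y)).1 + ((tau k)^-1 * r) *: w).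
by split => //; [rewrite lE; exists ((tau k)^-1 * r)|rewrite addrC addKr].
Qed.

Lemma limit_curve k x y : good k x y -> curve Pi A (v k) (T k) x y (f k x y).
Proof.
move=> gd; have [f0 f1] := f_ends gd.
split => //; [exact: ltW|exact: f_lip|move=> e e0].
by have [n nP] := T_small k e0; exists (2 ^+ n * T (k + n)) => //; exact: f_tame.
Qed.

End limit.
End construction.

Lemma hierarchical_curve x y : W 0 x -> W 0 y -> enorm (x - y) <= D 0 ->
  exists f, curve Pi A (v 0) (T 0) x y f.
Proof.
move=> Wx Wy xy; have [pq pqP] := entry_exit; have [X XP] := limit_choice pqP.
by eexists; exact: (limit_curve pqP XP).
Qed.

End hierarchical_curve.

(** * Limit curves are paths of the process *)

Section curve_path.
Context {R : realType} {d : nat}.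
Local Notation E := ('rV[R]_d).
Variables (Pi : set (line R d * R)) (A : set (line R d)).
Implicit Types (f : R -> E) (a b c e v T t : R).

Lemma affine_derive f t a p w : (\forall s \near t, f s = p + (s - a) *: w) ->
  derivable f t 1 /\ f^`()%classic t = w.
Proof.
move=> fE; pose g s : E := p + (s - a) *: w.
have gw : (h^-1 *: ((g \o shift t) (h *: (1 : R)) - g t)) @[h --> (0 : R)^'] --> w.
  apply: cvg_near_cst; near=> h.
  have h0 : h != 0 by near: h; exact: nbhs_dnbhs_neq.
  rewrite /g /= opprD addrACA subrr add0r -scalerBl scalerA.
  rewrite [X in X *: _](_ : _ = 1) ?scale1r //.
  by rewrite /GRing.scale /= mulr1; field.
have gd : is_derive t (1 : R) g w.
  split; first by apply/cvg_ex; exists w.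
  by rewrite /derive; exact: cvg_lim gw.
have fd : is_derive t (1 : R) f w.
  apply: near_eq_is_derive gd; near=> s; rewrite /g; apply/esym; near: s; exact: fE.
by rewrite derive1E; split; [exact: ex_derive|exact: derive_val].
Unshelve. all: by end_near. Qed.

Definition moving f t : Prop := derivable f t 1 /\
  (f^`()%classic t = 0 \/ exists (l : line R d) (v : R),
     [/\ Pi (l, v), enorm (f^`()%classic t) <= v &
         l = [set f t + s *: f^`()%classic t | s in setT] :> set _]).

Lemma tame_moving f a b e : tame Pi A f a b e ->
  exists B, [/\ measurable B, (lebesgue_measure B <= e%:E)%E &
    forall t, a <= t <= b -> ~ B t -> moving f t].
Proof.
elim => {a b e} [a b ab|a b p w ab fE pw|a b c e e' h1 [B [mB Be Bm]] h2 [B' [mB' Be' Bm']]].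
- exists `[a, b]%classic; split => //.
    rewrite lebesgue_measure_itv /= lte_fin; case: ifP => _; first by rewrite -EFinD.
    by rewrite lee_fin subr_ge0.
(* A straight piece has a derivative in its interior; its two ends are exceptional. *)
- exists ([set a] `|` [set b]); split; first exact: measurableU.
    apply: (le_trans (measureU2 _ _ _)) => //.
    by rewrite [X in (X + _)%E]lebesgue_measure_set1 [X in (_ + X)%E]lebesgue_measure_set1 adde0.
  move=> t /andP[at_ tb] /= nab.
  have at' : a < t by rewrite lt_neqAle at_ andbT; apply/eqP => e; apply: nab; left.
  have tb' : t < b by rewrite lt_neqAle tb andbT; apply/eqP => e; apply: nab; right.
  have [] := @affine_derive f t a p w.
    near=> s; apply: fE; apply/andP; split; apply: ltW; near: s.
      exact: lt_nbhsr.
    exact: lt_nbhsl.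
  move=> fd fw; split => //; rewrite fw; have [w0|w0] := eqVneq w 0; [by left|right].
  case: pw => [w0'|[l [v [lP lA wv [pl wl]]]]]; first by rewrite w0' eqxx in w0.
  exists l, v; split => //; rewrite fE ?at_ //.
  apply: (line_paramE _ wl w0).
  by rewrite (line_paramE pl wl w0); exists (t - a).
exists (B `|` B'); split; first exact: measurableU.
  by apply: (le_trans (measureU2 _ _ _)) => //; rewrite EFinD leeD.
move=> t /andP[at_ tc] nB; have [tb|/ltW bt] := leP t b.
  by apply: Bm; [rewrite at_|move=> Bt; apply: nB; left].
by apply: Bm'; [rewrite bt|move=> Bt; apply: nB; right].
Unshelve. all: by end_near. Qed.

Lemma diam_le (X : set E) c : 0 <= c ->
  (forall x y, X x -> X y -> enorm (x - y) <= c) -> (diam X <= c%:E)%E.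
Proof.
move=> c0 h; apply: ge_ereal_sup => _ [->|[x Xx [y Xy <-]]]; first by rewrite lee_fin.
by rewrite lee_fin h.
Qed.

Lemma diam_ge0 (X : set E) : (0 <= diam X)%E.
Proof. by apply: ereal_sup_ubound; left. Qed.

Lemma line_eq2 (l l' : line R d) x y : x != y ->
  x \on l -> y \on l -> x \on l' -> y \on l' -> l = l'.
Proof.
move=> xy lx ly lx' ly'; have yx0 : y - x != 0 by rewrite subr_eq0 eq_sym.
apply: line_inj; rewrite (line_paramE lx _ yx0); last exact/(dirP _ lx).
by rewrite (line_paramE lx' _ yx0) //; exact/(dirP _ lx').
Qed.

(* A line outside [A] meets a straight piece in at most one point, so only the rough
   pieces contribute to the length. *)
Lemma tame_cover f v a b e (l : line R d) : 0 <= v -> ~ A l ->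
  tame Pi A f a b e -> lip v a b f ->
  exists U : seq (set E), l `&` f @` [set t | a <= t <= b] `<=` \bigcup_i nth set0 U i /\
    (\sum_(X <- U) diam X <= (v * e)%:E)%E.
Proof.
move=> v0 nA; elim => {a b e} [a b ab|a b p w ab fE pw|a b c e e' h1 ih1 h2 ih2] fl.
- exists [:: f @` [set t | a <= t <= b]]; split; first by move=> x [_ fx]; exists 0%N.
  rewrite big_seq1; apply: diam_le; first by rewrite mulr_ge0 // subr_ge0.
  move=> _ _ [s /andP[s1 s2] <-] [t /andP[t1 t2] <-].
  wlog st : s t s1 s2 t1 t2 / t <= s.
    by move=> hw; have [st|/ltW st] := leP t s; [exact: hw|rewrite enormB; exact: hw].
  apply: (le_trans (fl _ _ t1 st s2)); apply: ler_wpM2l => //; lra.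
- exists [:: l `&` f @` [set t | a <= t <= b]]; split; first by move=> x h; exists 0%N.
  rewrite big_seq1; apply: diam_le; first by rewrite mulr0.
  move=> x y [lx [s sab sx]] [ly [t tab ty]]; rewrite mulr0.
  have [->|xy] := eqVneq x y; first by rewrite subrr enorm0.
  exfalso; move: sx ty; rewrite !fE // => sx ty.
  case: pw => [w0|[l' [u [_ lA _ [pl wl]]]]].
    by move: xy; rewrite -sx -ty w0 !scaler0 eqxx.
  have w0 : w != 0 by apply: contra_neq xy => w0; rewrite -sx -ty w0 !scaler0.
  apply: nA; rewrite (@line_eq2 l l' x y) //.
    by rewrite (line_paramE pl wl w0) -sx; exists (s - a).
  by rewrite (line_paramE pl wl w0) -ty; exists (t - a).
have ab := tame_le h1; have bc := tame_le h2.
have [U [UP Ue]] : exists U : seq (set E),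
    l `&` f @` [set t | a <= t <= b] `<=` \bigcup_i nth set0 U i /\
    (\sum_(X <- U) diam X <= (v * e)%:E)%E.
  by apply: ih1 => s t s1 st tb; apply: fl => //; exact: le_trans bc.
have [U' [UP' Ue']] : exists U : seq (set E),
    l `&` f @` [set t | b <= t <= c] `<=` \bigcup_i nth set0 U i /\
    (\sum_(X <- U) diam X <= (v * e')%:E)%E.
  by apply: ih2 => s t s1 st tb; apply: fl => //; exact: le_trans s1.
exists (U ++ U'); split; last by rewrite big_cat mulrDr EFinD leeD.
move=> x [lx [t /andP[at_ tc] tx]]; have [tb|/ltW bt] := leP t b.
  have [i _ Ui] : (\bigcup_i nth set0 U i) x.
    by apply: UP; split => //; exists t => //=; rewrite at_.
  exists i => //; rewrite nth_cat; case: ltnP => // iU.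
  by move: Ui; rewrite nth_default.
have [i _ Ui] : (\bigcup_i nth set0 U' i) x.
  by apply: UP'; split => //; exists t => //=; rewrite bt.
by exists (size U + i)%N => //; rewrite nth_cat ltnNge leq_addr /= addKn.
Qed.

Lemma sum_nth_le (U : seq (set E)) n :
  (\sum_(0 <= i < n) diam (nth set0 U i) <= \sum_(X <- U) diam X)%E.
Proof.
have d0 : diam (set0 : set E) = 0%E.
  by apply/eqP; rewrite eq_le diam_ge0 andbT; exact: diam_le.
elim: U n => [|X U ih] n.
  by rewrite big_nil big1 // => i _; rewrite nth_nil.
case: n => [|n]; first by rewrite big_nil; apply: sume_ge0 => Y _; exact: diam_ge0.
by rewrite big_nat_recl // big_cons leeD2l.
Qed.

Lemma curve_hausdorff v T x y f (l : line R d) : 0 <= v -> ~ A l ->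
  curve Pi A v T x y f -> hausdorff1 (l `&` f @` `[0, T]%classic) = 0%E.
Proof.
move=> v0 nA [T0 _ _ fl ft].
have sum_ge0 (U : nat -> set E) : (0 <= \sum_(0 <= i <oo) diam (U i))%E.
  by apply: nneseries_ge0 => i _ _; exact: diam_ge0.
apply/eqP; rewrite eq_le; apply/andP; split; last first.
  apply: le_ereal_sup_tmp; eexists; first by exists 1 => //=.
  by apply: le_ereal_inf_tmp => _ [U _ <-].
apply: ge_ereal_sup => _ [delta /= delta0 <-]; apply/lee_addgt0Pr => e e0; rewrite add0e.
(* A total diameter of at most [m] makes every piece admissible for [delta] and the sum at most [e].
   Below, [v + 1] replaces [v], which may vanish, as a divisor. *)
pose m := Num.min delta e.
have m0 : 0 < m by rewrite lt_min delta0.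
have v1 : 0 < v + 1 by rewrite ltr_wpDl.
have [e' ee h] := ft _ (divr_gt0 m0 v1).
have [U [UP Ue]] := tame_cover v0 nA h fl.
have Um : (\sum_(X <- U) diam X <= m%:E)%E.
  apply: (le_trans Ue); rewrite lee_fin.
  apply: (@le_trans _ _ ((v + 1) * (m / (v + 1)))); last by rewrite mulrC divfK // gt_eqF.
  by apply: ler_pM => //; rewrite ?(tame_ge0 h) // lerDl.
apply: (@le_trans _ _ (\sum_(0 <= i <oo) diam (nth set0 U i))%E); last first.
  apply: lime_le; first by apply: is_cvg_nneseries => i _ _; exact: diam_ge0.
  apply: nearW => n; apply: (le_trans (sum_nth_le _ _)); apply: (le_trans Um).
  by rewrite lee_fin ge_min lexx orbT.
apply: ereal_inf_lbound; exists (nth set0 U) => //; split.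
  move=> z [lz [t]]; rewrite /= in_itv /= => tT fz; apply: UP; exact: (conj lz (ex_intro2 _ _ t tT fz)).
move=> i; apply: (@le_trans _ _ m%:E); last by rewrite lee_fin ge_min lexx.
apply: le_trans Um; apply: le_trans (sum_nth_le _ i.+1).
by rewrite big_nat_recr //= leeDr // sume_ge0 // => j _; exact: diam_ge0.
Qed.

Lemma curve_path_times v T x y f : 0 <= v -> curve Pi A v T x y f ->
  path_times Pi A x y T.
Proof.
move=> v0 fc; have [T0 f0 f1 fl ft] := fc.
exists f; split => //; last first.
  move=> l [_ hl]; apply: contrapT => nA.
  by move: hl; rewrite (curve_hausdorff v0 nA fc) ltxx.
split => //.
  move=> t tT; exists setT; first exact: filterT.
  apply: (@klipschitzW _ _ _ v); first by apply: (globally_properfilter (a := (t, t))).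
  move=> [s u] [[/= hs _] [/= hu _]].
  move: hs hu; rewrite !in_itv /= => /andP[s0 sT] /andP[u0 uT].
  apply: (le_trans (mx_norm_le_enorm _)).
  wlog su : s u s0 sT u0 uT / u <= s.
    move=> hw; have [us|/ltW su] := leP u s; first exact: hw.
    by rewrite enormB distrC; exact: hw.
  by rewrite ger0_norm ?subr_ge0 //; exact: fl.
(* One exceptional set for each tolerance 1 / (n + 1). A time outside any one of them is good, so
   the bad times lie in the intersection, which is null. *)
have /choice[B BP] : forall n : nat, exists B, [/\ measurable B,
    (lebesgue_measure B <= (n.+1%:R^-1 : R)%:E)%E &
    forall t, 0 <= t <= T -> ~ B t -> moving f t].
  move=> n; have n0 : 0 < (n.+1%:R : R)^-1 by rewrite invr_gt0.
  have [e' ee h] := ft _ n0; have [B [mB Be Bm]] := tame_moving h.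
  by exists B; split => //; apply: (le_trans Be); rewrite lee_fin.
exists (\bigcap_n B n); split.
- by apply: bigcapT_measurable => n; have [] := BP n.
- apply/eqP; rewrite eq_le measure_ge0 andbT; apply/lee_addgt0Pr => e e0.
  rewrite add0e.
  have [n nP] : exists n : nat, (n.+1%:R : R)^-1 < e.
    exists (Num.bound (e^-1)).
    rewrite invf_plt ?posrE // (lt_trans (archi_boundP _)) ?invr_ge0 ?(ltW e0) //.
    by rewrite ltr_nat.
  have [mBn Bn _] := BP n.
  apply: (@le_trans _ _ (lebesgue_measure (B n))).
    rewrite le_measure ?inE //; last by move=> t; exact.
    by apply: bigcapT_measurable => k; have [] := BP k.
  by apply: (le_trans Bn); rewrite lee_fin ltW.
move=> t /= nt n _; apply: contrapT => nB; apply: nt; rewrite in_itv /= => t0T.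
by have [_ _ h] := BP n; exact: h.
Qed.

End curve_path.

(** * Chaining over the grids *)

(** The part of [A] in cells reachable from a cell of [x] is relatively closed, and relatively open
    because the other cells are also finitely many and closed; so it is all of [A]. A path without
    repetition is shorter than the number of cells. *)
Lemma connected_chain (T : topologicalType) (A : set T) (I : finType) (C : I -> set T) x y :
  connected A -> (forall i, closed (C i)) -> A `<=` \bigcup_i C i -> A x -> A y ->
  exists (i : I) (p : seq I), [/\ C i x, C (last i p) y,
    path (fun j k => `[< A `&` (C j `&` C k) !=set0 >]) i p & (size p < #|I|)%N].
Proof.
move=> cA cC AC Ax Ay; set e := (X in path X).
have [i _ Cx] := AC x Ax.
have cU (P : pred I) : closed (\big[setU/set0]_(j | P j) C j).
  by elim/big_ind : _ => [|U V|j _]; [exact: closed0|exact: closedU|exact: cC].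
have inU (P : pred I) z : (\big[setU/set0]_(j | P j) C j) z <-> exists2 j, P j & C j z.
  rewrite -bigcup_seq_cond; split => [[j /= /andP[_ Pj] Cz]|[j Pj Cz]]; first by exists j.
  by exists j => //=; rewrite mem_index_enum.
pose B := A `&` \big[setU/set0]_(j | connect e i j) C j.
have BA : B = A.
  apply: cA.
  - by exists x; split => //; apply/inU; exists i => //; exact: connect0.
  - exists (~` (\big[setU/set0]_(j | ~~ connect e i j) C j)); first exact/closed_openC.
    apply/seteqP; split => z [Az].
      move=> /inU[j ij Cz]; split => // /inU[k ik Ck]; move: ik; apply/negP; rewrite negbK.
      by apply: (connect_trans ij); apply: connect1; apply/asboolP; exists z.
    have [j _ Cz] := AC z Az => nz; split => //; apply/inU; exists j => //.
    by apply: contrapT => /negP nij; apply: nz; apply/inU; exists j.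
  - by exists (\big[setU/set0]_(j | connect e i j) C j).
have [_ /inU[j /connectP[p ep ->] Cy]] : B y by rewrite BA.
case/shortenP: ep Cy => q eq uq _ Cy.
exists i, q; split => //.
by have := card_uniqP uq => /= <-; exact: max_card.
Qed.

Section grids.
Context {R : realType} {d : nat}.
Local Notation E := ('rV[R]_d).

Definition grid_point (c : E) (r s : R) m (z : {ffun 'I_d -> 'I_m}) : E :=
  \row_j (c 0 j - r + (z j)%:R * s).

Lemma grid_cover (c x : E) (r s : R) m : 0 < s -> 2 * r / s < m%:R ->
  (forall j, `|x 0 j - c 0 j| <= r) ->
  exists z : {ffun 'I_d -> 'I_m}, forall j, `|x 0 j - grid_point c r s z 0 j| <= s.
Proof.
move=> s0 rm xc.
have h j : exists k : 'I_m, `|x 0 j - (c 0 j - r + k%:R * s)| <= s.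
  have := xc j; rewrite ler_norml => /andP[x1 x2].
  pose y := (x 0 j - c 0 j + r) / s.
  have y0 : 0 <= y by rewrite divr_ge0 ?(ltW s0) //; lra.
  have yE : x 0 j - c 0 j + r = y * s by rewrite divfK // gt_eqF.
  have /andP[t1 t2] := truncn_itv y0.
  have tm : (Num.truncn y < m)%N.
    rewrite -(ltr_nat R); apply: (le_lt_trans t1); apply: le_lt_trans rm.
    by rewrite ler_pM2r ?invr_gt0 //; lra.
  exists (Ordinal tm) => /=; rewrite -natr1 in t2.
  have -> : x 0 j - (c 0 j - r + (Num.truncn y)%:R * s) = (y - (Num.truncn y)%:R) * s.
    by rewrite mulrBl -yE; ring.
  rewrite normrM (gtr0_norm s0) ger0_norm ?subr_ge0 // -[leRHS]mul1r ler_pM2r //; lra.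
have /choice[z zP] := h.
by exists [ffun j => z j] => j; rewrite mxE ffunE; exact: zP.
Qed.

End grids.

Section deterministic.
Context {R : realType} {n : nat}.
Local Notation d := n.+1.
Local Notation E := ('rV[R]_d).
Variables (Pi : set (line R d * R)) (A F : set E) (r alpha al beta v0 : R) (N : nat).
Variable c : 'I_N -> E.
Hypothesis r0 : 0 < r.
Hypothesis al2 : 2 < al.
Hypothesis alalpha : al < alpha.
Hypothesis beta0 : 0 < beta.
Hypothesis beta1 : beta < 1.
Hypothesis albeta : 2 < al * beta.
Hypothesis v00 : 0 < v0.
Hypothesis cA : connected A.
Hypothesis AN : A `<=` \bigcup_i closed_eball (c i) r.

(** Less than r / (alpha - 1), so that curves between points of [A] stay where the angle is
    controlled, and at most r, so that grids over balls of radius 2 r cover them. *)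
Definition scale0 := r / (4 * alpha).
Definition scale k := scale0 / al ^+ k.
Definition speed k := v0 * beta ^+ k.
(** A quarter of the gap, so that 1 / al = 1 / alpha + 4 mesh: one share is taken off in [radius],
    the other three absorb the rounding of the points to be linked. *)
Definition mesh := (al^-1 - alpha^-1) / 4.
(** The next scale less the rounding error: a point this close to a node is within the next scale of
    every point rounded to that node. *)
Definition radius k := scale k * (al^-1 - mesh).
(** The division by d keeps the Euclidean radius of the cube at most [mesh * scale k]. *)
Definition halfside k := mesh * scale k / d%:R.
(** Solution of time k = 2 time (k + 1) + 3 scale k / speed k, both kinds of term shrinking by the
    factor [al * beta] per level. *)
Definition time k := 3 * scale k / speed k / (1 - 2 / (al * beta)).
Definition net_size k := (Num.truncn (2 * (2 * r) / halfside k)).+1.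
(** Cells of half-side scale0 / (2 d) have Euclidean diameter at most [scale0], the distance that
    one hierarchical curve bridges. *)
Definition cell_size := (Num.truncn (2 * r / (scale0 / (2 * d%:R)))).+1.
Definition net_index k := ('I_N * {ffun 'I_d -> 'I_(net_size k)})%type.
Definition net k (i : net_index k) : E := grid_point (c i.1) (2 * r) (halfside k) i.2.

(** Excludes nodes far from [A], where the solid angle of [F] is not controlled. The cube around [a]
    is the region over which translates are averaged; the inclusion of the ball makes each linking
    line hit the thickening. *)
Definition valid k (a b : E) :=
  (forall z : E, (forall i, `|z 0 i - a 0 i| <= halfside k) ->
     thickening A (r / (alpha - 1)) z /\ alpha^-1 * enorm (b - z) <= radius k) /\
  eball a (radius k) `<=` thickening A (r / (alpha - 1)).

Hypothesis lines : forall k (i j : net_index k), valid k (net i) (net j) ->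
  exists l v, [/\ Pi (l, v), speed k <= v, hitting (eball (net i) (radius k)) l,
     hitting (eball (net j) (radius k)) l & ~ hitting F l].

Let alpha0 : 0 < alpha. Proof. by apply: lt_trans alalpha; apply: lt_trans al2. Qed.
Let al0 : 0 < al. Proof. exact: lt_trans al2. Qed.
Let scale00 : 0 < scale0. Proof. by rewrite divr_gt0 // mulr_gt0. Qed.
Let scale_gt0 k : 0 < scale k. Proof. by rewrite divr_gt0 // exprn_gt0. Qed.
Let speed_gt0 k : 0 < speed k. Proof. by rewrite mulr_gt0 // exprn_gt0. Qed.
Let invs : 0 < alpha^-1 /\ alpha^-1 < al^-1 /\ al^-1 < 2^-1.
Proof. by rewrite invr_gt0 !ltf_pV2 ?posrE. Qed.
Let mesh_gt0 : 0 < mesh. Proof. by rewrite /mesh; have [? [? ?]] := invs; lra. Qed.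
Let halfside_gt0 k : 0 < halfside k.
Proof. by rewrite /halfside divr_gt0 // mulr_gt0. Qed.
Let scaleS k : scale k.+1 = scale k * al^-1.
Proof. by rewrite /scale exprSr invfM mulrA. Qed.
Let dhalf k : d%:R * halfside k = mesh * scale k.
Proof. by rewrite /halfside mulrC divfK // pnatr_eq0. Qed.

Let scale_half k : 2 * scale k.+1 <= scale k.
Proof.
rewrite scaleS mulrCA -[leRHS]mulr1; apply: ler_wpM2l; first exact: ltW.
by have [_ [_ ?]] := invs; lra.
Qed.

Let scale_le0 k : scale k <= scale0.
Proof.
elim: k => [|k ih]; first by rewrite /scale expr0 divr1.
by apply: le_trans ih; have := scale_half k; have := scale_gt0 k.+1; lra.
Qed.

Let scale0_lt : scale0 < r / (alpha - 1).
Proof. by rewrite /scale0 ltr_pM2l // ltf_pV2 ?posrE; have := lt_trans al2 alalpha; lra. Qed.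

(** Contains the entry and exit points reached down to level k: their drift, scale 1 + ... + scale
    k, is at most scale0 - scale k because each scale is at least twice the next. *)
Let W k : set E := [set x | exists2 a, A a & enorm (x - a) <= scale0 - scale k].

Let in_thickening a z : A a -> enorm (z - a) < r / (alpha - 1) ->
  thickening A (r / (alpha - 1)) z.
Proof.
by move=> Aa h; exists a => //; exists (z - a); [rewrite /eball /= subr0|rewrite addrC subrK].
Qed.

Let cube_norm (x z : E) k : (forall i, `|x 0 i - z 0 i| <= halfside k) ->
  enorm (x - z) <= mesh * scale k.
Proof.
by move=> h; rewrite -dhalf; apply: enorm_le_coord => i; rewrite !mxE; exact: h.
Qed.

Let net_cover k x : W k x -> exists i : net_index k,
  forall j, `|x 0 j - net i 0 j| <= halfside k.
Proof.
move=> [a Aa xa]; have [i _ ai] := AN Aa.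
have xi : enorm (x - c i) <= 2 * r.
  have := ler_enormB x a (c i); move: ai; rewrite /closed_eball /= => ai.
  have := scale_gt0 k; have : scale0 <= r.
    rewrite /scale0 ler_pdivrMr ?mulr_gt0 // -[leLHS]mulr1 ler_pM2l //.
    by have := lt_trans al2 alalpha; lra.
  by lra.
have [z zP] : exists z : {ffun 'I_d -> 'I_(net_size k)}, forall j,
    `|x 0 j - grid_point (c i) (2 * r) (halfside k) z 0 j| <= halfside k.
  apply: grid_cover => //; first exact: truncnS_gt.
  by move=> j; apply: le_trans xi; have := coord_le_enorm (x - c i) j; rewrite !mxE.
by exists (i, z).
Qed.

Let connect_step k x y : W k x -> W k y -> enorm (x - y) <= scale k ->
  exists p q l u, [/\ Pi (l, u),
    (hitting (thickening A (r / (alpha - 1))) `\` hitting F) l,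
    speed k <= u, p \on l /\ q \on l &
    [/\ enorm (x - p) <= scale k.+1, enorm (y - q) <= scale k.+1,
        W k.+1 p & W k.+1 q]].
Proof.
move=> Wx Wy xy; have [i iP] := net_cover Wx; have [j jP] := net_cover Wy.
have [a Aa xa] := Wx; have [b Ab yb] := Wy.
have [ia [aal al2']] := invs.
have hx := cube_norm iP; have hy := cube_norm jP.
have sk := scale_gt0 k; have m0 := mesh_gt0.
have mE : al^-1 = alpha^-1 + 4 * mesh by rewrite /mesh; lra.
have radE : radius k = scale k.+1 - mesh * scale k by rewrite /radius scaleS; ring.
have sh := scale_half k.
have m4 : 4 * mesh <= 2^-1 by lra.
have ms : 4 * (mesh * scale k) <= 2^-1 * scale k by rewrite mulrA ler_pM2r.
have vld : valid k (net i) (net j).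
  split => [z zP|z].
    have hz := cube_norm zP; split.
      apply: (in_thickening Aa); apply: le_lt_trans scale0_lt.
      have := ler_enormB z (net i) a; have := ler_enormB (net i) x a.
      by rewrite (enormB (net i) x); lra.
    (* Three roundings: of [z] and [x] to the first node, of [y] to the second. After division by
       [alpha] > 2 they fit in the three shares left in [radius]. *)
    have hb : enorm (net j - z) <= scale k + 3 * (mesh * scale k).
      have := ler_enormB (net j) y z; have := ler_enormB y x z.
      have := ler_enormB x (net i) z.
      by rewrite (enormB (net j) y) (enormB y x) (enormB (net i) z); lra.
    apply: (@le_trans _ _ (alpha^-1 * (scale k + 3 * (mesh * scale k)))).
      by apply: ler_wpM2l hb; exact: ltW.
    rewrite (_ : _ * _ = scale k * (alpha^-1 * (1 + 3 * mesh))); last by ring.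
    rewrite /radius; apply: ler_wpM2l; first exact: ltW.
    have : alpha^-1 * mesh <= 2^-1 * mesh by apply: ler_wpM2r; lra.
    by rewrite mE; lra.
  rewrite /eball /= radE => za; apply: (in_thickening Aa); apply: le_lt_trans scale0_lt.
  have := ler_enormB z (net i) a; have := ler_enormB (net i) x a.
  by rewrite (enormB (net i) x); lra.
have [l [v [lP vP [p [lp pi]] [q [lq qj]] lF]]] := lines vld.
have := pi; have := qj; rewrite /eball /= => qj' pi'.
have hxp : enorm (x - p) <= scale k.+1.
  by have := ler_enormB x (net i) p; rewrite (enormB (net i) p); lra.
have hyq : enorm (y - q) <= scale k.+1.
  by have := ler_enormB y (net j) q; rewrite (enormB (net j) q); lra.
exists p, q, l, v; split => //.
  by split => //; exists p; split => //; apply: vld.2.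
split => //.
  by exists a => //; have := ler_enormB p x a; rewrite (enormB p x); lra.
by exists b => //; have := ler_enormB q y b; rewrite (enormB q y); lra.
Qed.

Let q2 : 0 < 1 - 2 / (al * beta).
Proof. by rewrite subr_gt0 ltr_pdivrMr ?mul1r // mulr_gt0. Qed.

Let time_gt0 k : 0 < time k.
Proof. by rewrite /time divr_gt0 // divr_gt0 // mulr_gt0. Qed.

Let timeS k : time k.+1 = time k / (al * beta).
Proof.
rewrite /time /speed scaleS exprSr; field.
by rewrite !gt_eqF ?subr_gt0 ?exprn_gt0.
Qed.

Let timeE k : time k = time k.+1 + (3 * scale k / speed k + time k.+1).
Proof.
have -> : 3 * scale k / speed k = time k * (1 - 2 / (al * beta)).
  by rewrite /time divfK // gt_eqF.
by rewrite timeS; field; rewrite !gt_eqF.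
Qed.

Let time_small k e : 0 < e -> exists m, 2 ^+ m * time (k + m) <= e.
Proof.
move=> e0; set q := 2 / (al * beta).
have q0 : 0 < q by rewrite divr_gt0 // mulr_gt0.
have q1 : q < 1 by rewrite -subr_gt0.
have tq m : 2 ^+ m * time (k + m) = time k * q ^+ m.
  elim: m => [|m ih]; first by rewrite !expr0 addn0 mul1r mulr1.
  have -> : 2 ^+ m.+1 * time (k + m.+1) = (2 ^+ m * time (k + m)) * q.
    by rewrite addnS timeS exprS /q; ring.
  by rewrite ih exprSr -[LHS]mulrA.
have := cvg_geometric (time k) (_ : `|q| < 1).
rewrite gtr0_norm // => /(_ q1) /cvgrPdist_lt /(_ e e0) [m _ mP].
by exists m; rewrite tq; apply: ltW; have := mP m (leqnn m); rewrite /= sub0r normrN => h;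
  apply: le_lt_trans h; exact: ler_norm.
Qed.

Let local_curve x y : A x -> A y -> enorm (x - y) <= scale0 ->
  exists f, curve Pi (hitting (thickening A (r / (alpha - 1))) `\` hitting F) (speed 0)
    (time 0) x y f.
Proof.
move=> Ax Ay xy.
have W0 z : A z -> W 0 z.
  by move=> Az; exists z => //; rewrite subrr enorm0 /scale expr0 divr1 subrr.
apply: (hierarchical_curve (D := scale) (v := speed) (T := time) (W := W)) => //.
- by move=> k; have := scale_half k; have := scale_gt0 k.+1; lra.
- by move=> k; rewrite /speed exprSr mulrA; apply: ler_piMr; [exact: ltW (speed_gt0 k)|exact: ltW].
- move=> k z [a Aa za]; exists a => //; apply: (le_trans za).
  by have := scale_half k; have := scale_gt0 k.+1; lra.
- exact: W0.
- exact: W0.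
- by rewrite /scale expr0 divr1.
Qed.

Lemma time_diameter_le :
  (time_diameter Pi (hitting (thickening A (r / (alpha - 1))) `\` hitting F) A <=
    ((N * cell_size ^ d)%:R * time 0)%:E)%E.
Proof.
apply: ge_ereal_sup => _ [x Ax [y Ay <-]].
pose I := ('I_N * {ffun 'I_d -> 'I_cell_size})%type.
pose s := scale0 / (2 * d%:R).
have s0 : 0 < s by rewrite divr_gt0 // mulr_gt0.
pose C (i : I) : set E := [set z | forall j, `|z 0 j - grid_point (c i.1) r s i.2 0 j| <= s].
have Cclosed i : closed (C i).
  rewrite (_ : C i = \bigcap_(j in [set: 'I_d])
    ((fun z : E => z 0 j) @^-1` [set t | `|t - grid_point (c i.1) r s i.2 0 j| <= s])); last first.
    by apply/seteqP; split => z h j; [move=> _|]; exact: h.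
  apply: closed_bigI => j _; apply: closed_comp; first by move=> z _; exact: coord_continuous.
  rewrite (_ : [set t | _] = closed_ball_ Num.norm (grid_point (c i.1) r s i.2 0 j) s).
    exact: closed_closed_ball_.
  by apply/seteqP; split => t; rewrite /closed_ball_ /= distrC.
have AC : A `<=` \bigcup_i C i.
  move=> z Az; have [i _ zi] := AN Az.
  have [g gP] : exists g : {ffun 'I_d -> 'I_cell_size}, forall j,
      `|z 0 j - grid_point (c i) r s g 0 j| <= s.
    apply: grid_cover => //; first exact: truncnS_gt.
    by move=> j; apply: le_trans zi; have := coord_le_enorm (z - c i) j; rewrite !mxE.
  by exists (i, g).
have Cdiam i z z' : C i z -> C i z' -> enorm (z - z') <= scale0.
  move=> h h'; rewrite (_ : scale0 = d%:R * (s + s)); last first.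
    by rewrite /s invfM mulrA mulrDr !(mulrC d%:R) !divfK ?pnatr_eq0 // -splitr.
  apply: enorm_le_coord => j; rewrite !mxE.
  set g := grid_point (c i.1) r s i.2 0 j.
  have -> : z 0 j - z' 0 j = (z 0 j - g) - (z' 0 j - g) by ring.
  by apply: (le_trans (ler_normB _ _)); apply: lerD; [exact: h|exact: h'].
have [i [p [Cx Cy ep sp]]] := connected_chain cA Cclosed AC Ax Ay.
have [f fc] : exists f, curve Pi (hitting (thickening A (r / (alpha - 1))) `\` hitting F)
    (speed 0) ((size p).+1%:R * time 0) x y f.
  (* Consecutive cells share a point of [A], at which two curves are glued. *)
  clear sp; elim: p i x Ax Cx Cy ep => [|k p ih] i x Ax Cx Cy ep.
    by rewrite mul1r; apply: local_curve => //; exact: (Cdiam i).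
  have /andP[/asboolP[z [Az [Cz Ck]]] kp] := ep.
  have [f fP] := ih k z Az Ck Cy kp.
  have [g gP] := local_curve Ax Az (Cdiam i _ _ Cx Cz).
  exists (glue (time 0) g f).
  rewrite (_ : (size (k :: p)).+1%:R * time 0 = time 0 + (size p).+1%:R * time 0).
    exact: curve_glue gP fP.
  by rewrite /= -[in LHS]natr1; ring.
apply: (@le_trans _ _ ((size p).+1%:R * time 0)%:E).
  apply: ereal_inf_lbound; exists ((size p).+1%:R * time 0) => //.
  by apply: curve_path_times fc; exact: ltW.
rewrite lee_fin ler_pM2r // ler_nat.
by move: sp; rewrite card_prod card_ffun !card_ord.
Qed.

End deterministic.

(** * Probability estimates *)

Section poisson_estimates.
Local Open Scope ereal_scope.
Context {R : realType}.

(** On this interval of length v the decreasing density is at least its value at the right end 2 v;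
    the bound is of order v^(1 - gamma) times the mass of [B]. *)
Lemma intensity_ge n (mu : {measure set (line R n.+1) -> \bar R}) (gamma v : R)
    (B : set (line R n.+1)) : (1 < gamma)%R -> (0 < v)%R -> measurable B ->
  ((gamma - 1) * (2 * v) `^ (- gamma) * v)%:E * mu B <=
  marked_line_intensity mu gamma (B `*` `[v, (2 * v)%R]).
Proof.
move=> g1 v0 mB.
pose w x := ((gamma - 1) * x `^ (- gamma))%R.
have w0 x : (0 <= w x)%R by rewrite mulr_ge0 ?powR_ge0 // subr_ge0 ltW.
pose K := \int[lebesgue_measure]_(x in `]0%R, +oo[)
  (\1_(`[v, (2 * v)%R]%classic : set R) x * w x)%:E.
have K0 : 0 <= K by apply: integral_ge0 => x _; rewrite lee_fin mulr_ge0.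
have inner l : \int[lebesgue_measure]_(x in `]0%R, +oo[)
    (\1_(B `*` `[v, (2 * v)%R]) (l, x) * w x)%:E = (\1_B l)%:E * K.
  have e x : \1_(B `*` `[v, (2 * v)%R]) (l, x) =
      (\1_B l * \1_(`[v, (2 * v)%R]%classic : set R) x)%R :> R.
    by rewrite !indicE in_setX -natrM mulnb.
  rewrite [\1_B l]indicE; case: (boolP (l \in B)) => lB.
    rewrite mul1e; apply: eq_integral => x _.
    by rewrite e indicE lB mul1r.
  rewrite mul0e integral0_eq // => x _.
  by rewrite e indicE (negbTE lB) !mul0r.
rewrite /marked_line_intensity (eq_integral (fun l => (\1_B l)%:E * K)); last first.
  by move=> l _; exact: inner.
rewrite ge0_integralZr //; last exact: measurableT_comp.
rewrite integral_indic // setIT muleC.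
apply: lee_wpmul2l; first exact: measure_ge0.
have mI : measurable (`[v, (2 * v)%R]%classic : set R) by [].
have -> : ((gamma - 1) * (2 * v) `^ (- gamma) * v)%:E =
    \int[lebesgue_measure]_(x in `]0%R, +oo[)
    ((\1_(`[v, (2 * v)%R]%classic : set R) x)%:E * ((gamma - 1) * (2 * v) `^ (- gamma))%:E).
  rewrite ge0_integralZr //; last 2 first.
  - by apply/measurable_EFinP; exact: measurable_indic.
  - by rewrite lee_fin mulr_ge0 ?powR_ge0 // subr_ge0 ltW.
  rewrite integral_indic // (_ : _ `&` _ = `[v, (2 * v)%R]%classic); last first.
    apply/seteqP; split => x /=; rewrite !in_itv /= ?andbT; first by case.
    by move=> /andP[vx xv]; rewrite vx xv (lt_le_trans v0).
  have lI : lebesgue_measure (`[v, (2 * v)%R]%classic : set R) = v%:E.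
    rewrite lebesgue_measure_itv /= lte_fin ifT; last by lra.
    by rewrite -EFinD; congr EFin; ring.
  by rewrite [X in _ = X * _]lI EFinM muleC.
apply: ge0_le_integral => //.
- by move=> x _; rewrite -EFinM lee_fin mulr_ge0 // mulr_ge0 ?powR_ge0 // subr_ge0 ltW.
- apply: emeasurable_funM => //; apply/measurable_EFinP.
  by apply: measurable_funTS; exact: measurable_indic.
- apply/measurable_EFinP; apply: measurable_funM.
    by apply: measurable_funTS; exact: measurable_indic.
  apply: measurable_funM => //; apply: measurable_funTS; exact: measurable_powR.
move=> x; rewrite /= in_itv /= andbT => x0; rewrite -EFinM lee_fin indicE.
case: (boolP (x \in _)) => [|_]; last by rewrite !mul0r.
rewrite inE /= in_itv /= => /andP[vx xv]; rewrite !mul1r /w.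
apply: ler_wpM2l; first by rewrite subr_ge0 ltW.
rewrite !powRN lef_pV2 ?posrE ?powR_gt0 //; last by rewrite mulr_gt0.
by apply: ge0_ler_powR => //; rewrite ?nnegrE ?ltW // ?mulr_gt0 // (lt_trans _ g1).
Qed.

(** The void probability is exp (- Lambda B); if Lambda B is infinite, the count is almost surely
    infinite and the bound holds as well. *)
Lemma no_point dS (S : measurableType dS) (P : probability S R)
    dT (T : measurableType dT) (Pi : S -> set T) (Lambda : set T -> \bar R)
    (B : set T) (x : R) :
  is_poisson_process P Pi Lambda -> measurable B -> x%:E <= Lambda B ->
  measurable (point_count Pi B @^-1` [set (0 : \bar R)]) /\
  P (point_count Pi B @^-1` [set (0 : \bar R)]) <= (expR (- x))%:E.
Proof.
move=> [mcount Pfin Pinf _] mB xL.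
have mpre (y : \bar R) : measurable (point_count Pi B @^-1` [set y]).
  by rewrite -[X in measurable X]setTI; exact: (mcount _ mB measurableT _ (emeasurable_set1 y)).
split; first exact: mpre.
case: (Lambda B) (Pfin B 0%N mB) (Pinf B mB) xL => [y| |//].
  move=> /(_ isT) -> _; rewrite expr0 fact0 divr1 mul1r !lee_fin => xy.
  by rewrite ler_expR lerN2.
move=> _ /(_ erefl) P1 _; apply: (@le_trans _ _ 0); last by rewrite lee_fin expR_ge0.
have P0 : P (~` (point_count Pi B @^-1` [set (+oo : \bar R)])) = 0.
  by rewrite probability_setC // P1 subee.
rewrite -[leRHS]P0 le_measure ?inE //; first exact: measurableC.
by move=> w /= ->.
Qed.

Lemma counting_point (T : choiceType) (X : set T) :
  counting X != 0 :> \bar R -> X !=set0.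
Proof.
move=> X0; apply/set0P; apply: contra X0 => /eqP ->.
by rewrite /counting asboolT // fset_set0.
Qed.

Lemma nneseries_geometric_le (u : nat -> \bar R) (a q : R) :
  (0 <= a)%R -> (0 <= q < 1)%R -> (forall k, 0 <= u k <= (a * q ^+ k)%:E) ->
  \sum_(0 <= k <oo) u k <= (a / (1 - q))%:E.
Proof.
move=> a0 /andP[q0 q1] uq.
apply: lime_le.
  by apply: is_cvg_nneseries => k _ _; have /andP[] := uq k.
apply: nearW => m.
apply: (@le_trans _ _ (\sum_(0 <= k < m) (a * q ^+ k)%:E)).
  by apply: lee_sum => k _; have /andP[] := uq k.
rewrite sumEFin lee_fin.
have q10 : (0 < 1 - q)%R by rewrite subr_gt0.
suff -> : (\sum_(0 <= k < m) a * q ^+ k = a / (1 - q) * (1 - q ^+ m))%R.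
  rewrite -[leRHS]mulr1; apply: ler_wpM2l; first by rewrite divr_ge0 // ltW.
  by rewrite gerBl exprn_ge0.
elim: m => [|m ih]; first by rewrite big_nil expr0 subrr mulr0.
by rewrite big_nat_recr //= ih exprSr; field; rewrite gt_eqF.
Qed.

(* The stretched exponential tail is discretized along the levels [eps = expR (- k)]. *)
Lemma upper_expectation_lt_pinfty dS (S : measurableType dS) (P : probability S R)
    (X : S -> \bar R) (T p e0 delta : R) :
  (0 < T)%R -> (0 < p)%R -> (0 < e0)%R -> (forall w, 0 <= X w) ->
  (forall eps : R, (0 < eps < e0)%R ->
     (1 - eps / e0)%:E <= inner_probability P
       [set w | X w <= (T * ln (1 / eps) `^ (1 / p))%:E]) ->
  (delta < T `^ (- p))%R ->
  upper_expectation P (fun w => expeR (delta%:E * X w `^ p)) < +oo.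
Proof.
move=> T0 p0 e00 X0 tail dT.
have [d0|d0] := leP delta 0%R.
  apply: (@le_lt_trans _ _ (\int[P]_w cst 1 w)).
    apply: ereal_inf_lbound; exists (cst 1) => //; split => // w.
    by rewrite -expeR0 lee_expeR mule_le0_ge0 ?poweR_ge0 // lee_fin.
  by rewrite integral_cst // mul1e; apply: le_lt_trans (probability_le1 _ _) _ => //; rewrite ltry.
(* The assumption on [delta] is exactly [c] < 1: the growth exp (c k) of the integrand is beaten by
   the tail exp (- k). *)
pose c := (delta * T `^ p)%R.
have c0 : (0 < c)%R by rewrite mulr_gt0 // powR_gt0.
have c1 : (c < 1)%R.
  by move: dT; rewrite powRN -(ltr_pM2r (powR_gt0 p T0)) mulVf // gt_eqF // powR_gt0.
(* From index [K] on, exp (- k) is an admissible eps. *)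
pose K := (Num.bound `|ln e0^-1|).+1.
have Ke k : (expR (- (K + k)%:R) < e0)%R.
  rewrite -ltr_ln ?posrE ?expR_gt0 // expRK ltrNl -lnV ?posrE //.
  have h : (ln e0^-1 <= (Num.bound `|ln e0^-1|)%:R)%R.
    apply: (le_trans (ler_norm _)); apply: ltW.
    by apply: archi_boundP; exact: normr_ge0.
  by apply: (le_lt_trans h); rewrite ltr_nat /K addSn ltnS leq_addr.
pose Ev k := [set w | X w <= (T * (K + k)%:R `^ (1 / p))%:E].
(* The inner probability is a supremum that may not be attained; a further loss of exp (- (K + k))
   allows a measurable event. *)
have /choice[D DP] : forall k, exists D, [/\ measurable D, D `<=` Ev k &
    P (~` D) <= ((e0^-1 + 1) * expR (- (K + k)%:R))%:E].
  move=> k; have ek : (0 < expR (- (K + k)%:R : R) < e0)%R by rewrite expR_gt0 Ke.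
  have := tail _ ek; rewrite div1r -expRN opprK expRK => h.
  have : ((1 - expR (- (K + k)%:R) / e0) - expR (- (K + k)%:R))%:E <
      inner_probability P (Ev k).
    by apply: lt_le_trans h; rewrite lte_fin gtrBl expR_gt0.
  move=> /ereal_sup_gtP[_ [D [mD DE] <-] PD]; exists D; split => //.
  rewrite probability_setC //.
  have fD : P D \is a fin_num by exact: fin_num_measure.
  move: PD; rewrite -(fineK fD) -EFinB lee_fin lte_fin; lra.
have mD k : measurable (~` D k) by apply: measurableC; have [] := DP k.
pose g k w : \bar R := (expR (c * (K + k).+1%:R) * \1_(~` D k) w)%:E.
have g0 k w : 0 <= g k w by rewrite lee_fin mulr_ge0 ?expR_ge0.
have mg k : measurable_fun setT (g k).
  by apply/measurable_EFinP; apply: measurable_funM => //; exact: measurable_indic.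
(* A measurable majorant. If m + 1 is the least index of an event [D] containing w, then w is
   outside [D m] and the term [g m] is large enough; index 0 is covered by the constant, and outside
   all events the series diverges. *)
pose Y w := (expR (c * K%:R))%:E + \sum_(0 <= k <oo) g k w.
have mY : measurable_fun setT (fun w => \sum_(0 <= k <oo) g k w).
  by apply: (@ge0_emeasurable_sum _ _ _ _ g xpredT).
have sum0 w : 0 <= \sum_(0 <= k <oo) g k w by apply: nneseries_ge0.
have XY w : expeR (delta%:E * X w `^ p) <= Y w.
  have bound k : Ev k w -> expeR (delta%:E * X w `^ p) <= (expR (c * (K + k)%:R))%:E.
    rewrite /Ev /=; have := X0 w; case: (X w) => [x| |//]; last by rewrite leye_eq.
    rewrite !lee_fin => x0 xle; rewrite ler_expR /c -mulrA.
    rewrite ler_pM2l //.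
    have := ge0_ler_powR (ltW p0) _ _ xle; rewrite !nnegrE => /(_ x0).
    rewrite powRM ?powR_ge0 ?(ltW T0) // -powRrM div1r mulVf ?gt_eqF // powRr1 //.
    by apply; rewrite mulr_ge0 ?powR_ge0 ?(ltW T0).
  have [[k Dk]|nD] := pselect (exists k, D k w); last first.
    suff -> : Y w = +oo by rewrite leey.
    rewrite /Y (_ : \sum_(0 <= k <oo) g k w = +oo) ?addey //.
    apply/eqyP => A A0.
    apply: (@le_trans _ _ (\sum_(0 <= k < Num.bound A) g k w)); last first.
      by apply: nneseries_lim_ge.
    apply: (@le_trans _ _ (\sum_(0 <= k < Num.bound A) 1%:E)).
      rewrite sumEFin lee_fin big_const_nat subn0 iter_addr_0 ltW //.
      by apply: (archi_boundP (ltW A0)).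
    apply: lee_sum => k _; rewrite lee_fin indicE mem_set ?mulr1.
      by rewrite -expR0 ler_expR mulr_ge0 // ltW.
    by move=> Dk; apply: nD; exists k.
  have exk : exists k, `[< D k w >] by exists k; apply/asboolP.
  case: (ex_minnP exk) => m /asboolP Dm mmin.
  have Em : Ev m w by have [_ DE _] := DP m; exact: DE.
  apply: (le_trans (bound m Em)).
  case: m Dm mmin Em => [|m] Dm mmin Em; first by rewrite addn0 leeDl.
  apply: (@le_trans _ _ (g m w)).
    rewrite lee_fin indicE mem_set ?mulr1 ?addnS //.
    by move=> Dm'; have := mmin m (asboolT Dm'); rewrite ltnn.
  rewrite /Y; apply: (@le_trans _ _ (\sum_(0 <= k <oo) g k w)).
    apply: le_trans (nneseries_lim_ge m.+1 _) => //.
    by rewrite big_nat_recr //= leeDr // sume_ge0.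
  by rewrite leeDr // lee_fin expR_ge0.
apply: (@le_lt_trans _ _ (\int[P]_w Y w)).
  by apply: ereal_inf_lbound; exists Y => //; split => //; exact: emeasurable_funD.
rewrite ge0_integralD //.
rewrite integral_cst // integral_nneseries //.
apply: lte_add_pinfty.
  rewrite [X in _ * X](_ : _ = 1); last exact: probability_setT.
  by rewrite mule1 ltry.
pose a := ((e0^-1 + 1) * expR (c * K.+1%:R - K%:R))%R.
apply: (@le_lt_trans _ _ (a / (1 - expR (c - 1)))%:E); last by rewrite ltry.
apply: nneseries_geometric_le.
- by rewrite mulr_ge0 ?expR_ge0 // addr_ge0 // invr_ge0 ltW.
- by rewrite expR_ge0 expR_lt1 subr_lt0.
move=> k; apply/andP; split; first by apply: integral_ge0 => w _; exact: g0.
rewrite /g; under eq_integral do rewrite EFinM.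
rewrite ge0_integralZl //; last first.
  by apply/measurable_EFinP; exact: measurable_indic.
rewrite integral_indic // setIT.
have [_ _ PD] := DP k.
apply: (@le_trans _ _ ((expR (c * (K + k).+1%:R))%:E * ((e0^-1 + 1) * expR (- (K + k)%:R))%:E)).
  by apply: lee_wpmul2l => //; rewrite lee_fin expR_ge0.
rewrite -EFinM lee_fin /a mulrCA -[leRHS]mulrA; apply: ler_wpM2l.
  by rewrite addr_ge0 // invr_ge0 ltW.
rewrite -expRM_natl -!expRD ler_expR -!natr1 !natrD; lra.
Qed.

End poisson_estimates.

Lemma exponents (R : realType) m (d := m.+1) (gamma Omega alpha : R) : (0 < m)%N ->
  d%:R < gamma -> let alpha_min := 2 `^ ((gamma - 1) / (gamma - d%:R)) in
  0 < Omega -> alpha_min < alpha < Omega `^ (- (1 / (d%:R - 1))) / 4 ->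
  Omega < (alpha^-1 / 4) ^+ m /\
  exists al beta : R, [/\ 2 < al < alpha, 0 < beta < 1, 2 < al * beta &
    al ^+ m < beta `^ (1 - gamma)].
Proof.
move=> m0 dg amin O0 /andP[a1 a2].
have D0 : (0 < m%:R :> R) by rewrite ltr0n.
have dE : d%:R = m%:R + 1 :> R by rewrite /d -natr1.
have g1 : 0 < gamma - 1 by lra.
have gd : 0 < gamma - d%:R by lra.
have e0 : 0 < (gamma - 1) / (gamma - d%:R) by rewrite divr_gt0.
have e1 : 1 < (gamma - 1) / (gamma - d%:R) by rewrite ltr_pdivlMr //; lra.
have amin2 : 2 < amin.
  rewrite -[X in X < _](@powRr1 R 2) // /amin /powR.
  by rewrite !ifF ?gt_eqF // ltr_expR ltr_pM2r // ln_gt0 // ltr1n.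
have alpha0 : 0 < alpha by lra.
split.
  have : 4 * alpha < Omega `^ (- (1 / (d%:R - 1))) by lra.
  have -> : d%:R - 1 = m%:R :> R by rewrite dE; ring.
  move=> /(fun h => gt0_ltr_powR D0 (x := _) _ _ h).
  rewrite !nnegrE powR_ge0 => /(_ _ isT).
  rewrite -powRrM div1r mulNr mulVf ?gt_eqF // powR_inv1 ?(ltW O0) // powR_mulrn; last by lra.
  rewrite mulr_ge0 // ?ltW // => /(_ isT) h.
  have p0 : 0 < (4 * alpha) ^+ m by rewrite exprn_gt0 // mulr_gt0.
  rewrite -invfM exprVn [alpha * 4]mulrC -[X in X < _]invrK.
  by rewrite ltf_pV2 // posrE ?invr_gt0.
pose al := (amin + alpha) / 2.
have al1 : amin < al by rewrite /al; lra.
have al2 : 2 < al by lra.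
have al0 : 0 < al by lra.
(* The value of [beta] at which beta^(1 - gamma) would equal al^m. Since al * x = al^((gamma - d) /
   (gamma - 1)) exceeds its value 2 at [amin], the window from 2 / al to x is not empty. *)
pose x := al `^ (- (m%:R / (gamma - 1))).
have x0 : 0 < x by rewrite powR_gt0.
have xx : 2 < al * x.
  have -> : al * x = al `^ ((gamma - d%:R) / (gamma - 1)).
    rewrite -{1}(@powRr1 _ al) ?(ltW al0) // /x -powRD; last by rewrite (gt_eqF al0) implybT.
    by congr (_ `^ _); rewrite dE; field; rewrite gt_eqF.
  have aE : amin `^ ((gamma - d%:R) / (gamma - 1)) = 2.
    rewrite /amin -powRrM (_ : _ * _ = 1) ?powRr1 //.
    by field; rewrite !gt_eqF.
  rewrite -[X in X < _]aE.
  by rewrite gt0_ltr_powR ?divr_gt0 // ?nnegrE ?powR_ge0 ?ltW.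
have x1 : x < 1.
  rewrite /x powRN invf_lt1 ?powR_gt0 //.
  have : 1 `^ (m%:R / (gamma - 1)) < al `^ (m%:R / (gamma - 1)).
    by rewrite gt0_ltr_powR ?divr_gt0 ?nnegrE ?(ltW al0) //; lra.
  by rewrite powR1.
have x2 : 2 / al < x by rewrite ltr_pdivrMr // mulrC.
pose beta := (2 / al + x) / 2.
have b0 : 0 < beta by rewrite /beta; have := divr_gt0 (ltr0n R 2 : 0 < 2) al0; lra.
have bx : beta < x by rewrite /beta; lra.
exists al, beta; split.
- by apply/andP; split => //; rewrite /al; lra.
- by rewrite b0 /=; lra.
- have : 2 / al < beta by rewrite /beta; lra.
  by rewrite ltr_pdivrMr // mulrC.
have <- : x `^ (1 - gamma) = al ^+ m.
  rewrite /x -powRrM -powR_mulrn ?(ltW al0) //; congr (_ `^ _).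
  by field; rewrite gt_eqF.
rewrite -opprB !powRN ltf_pV2 ?posrE ?powR_gt0 //.
by rewrite gt0_ltr_powR // ?nnegrE ?ltW.
Qed.

Lemma exp2_unbounded (R : realType) (x : R) : exists j : nat, x <= 2 ^+ j.
Proof.
exists (Num.bound `|x|); apply: (le_trans (ler_norm _)).
apply: (le_trans (ltW (archi_boundP (normr_ge0 x)))).
by rewrite -natrX ler_nat ltnW // ltn_expl.
Qed.

(* With at most [(C al^k)^e] choices per coordinate and factor, the union bound over the
   level [k] is beaten by the superexponential decay in [k] of the failure probability. *)
Lemma level_tail (R : realType) (C al kappa : R) (e : nat) :
  0 <= C -> 1 <= al -> 1 < kappa -> exists2 M : R, 0 < M &
  forall (N size : R) (eps : R) k, 0 < eps <= 1 / 2 -> 0 <= N <= 1 / eps ->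
    0 <= size <= C * al ^+ k ->
    (N * size ^+ e) ^+ 2 * expR (- (M * ln (1 / eps) * kappa ^+ k)) <=
    eps / 2 * 2^-1 ^+ k.
Proof.
move=> C0 al1 k1.
have [j jC] := exp2_unbounded (2 * (C ^+ e) ^+ 2).
have [i ij] := exp2_unbounded (2 * (al ^+ e) ^+ 2).
pose b := Num.bound (kappa - 1)^-1.
have bk : 1 <= b%:R * (kappa - 1).
  rewrite -ler_pdivrMr ?subr_gt0 // div1r ltW //; apply: archi_boundP.
  by rewrite invr_ge0 subr_ge0 ltW.
(* Three powers of eps: two pay for N^2 and one remains. As eps <= 1 / 2, [j] more bring C^(2 e)
   below 1 / 2, and [i] factors 1 / 2 per level beat al^(2 e); [b] obtains these from kappa^k >= 1 +
   k (kappa - 1). *)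
pose M := (3 + j + b * i)%N.
have ME : M%:R = (3 + j)%:R + (b * i)%:R :> R by rewrite -natrD.
have M0 : (0 < M)%N by [].
clearbody M; exists M%:R; first by rewrite ltr0n.
move=> N size eps k /andP[eps0 eps2] /andP[N0 Neps] /andP[s0 sC].
have x0 : 0 <= ln (1 / eps) by rewrite ln_ge0 // ler_pdivlMr //; lra.
have E1 : expR (- ln (1 / eps)) = eps.
  by rewrite div1r lnV ?posrE // opprK lnK ?posrE.
have kk : 1 + k%:R * (kappa - 1) <= kappa ^+ k.
  elim: k {sC} => [|k ih]; first by rewrite mul0r addr0 expr0.
  rewrite exprS -natr1; apply: le_trans (ler_wpM2l _ ih); last by lra.
  have : 0 <= k%:R * (kappa - 1) ^+ 2 by rewrite mulr_ge0 // sqr_ge0.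
  by rewrite expr2; lra.
have tail : expR (- (M%:R * ln (1 / eps) * kappa ^+ k)) <= eps ^+ (3 + j) * 2^-1 ^+ (i * k).
  apply: (@le_trans _ _ (expR (- ln (1 / eps) *+ ((3 + j) + i * k)))).
    rewrite ler_expR mulNrn lerN2 -(mulr_natl (ln _)) [leRHS]mulrAC ler_wpM2r //.
    apply: (@le_trans _ _ (M%:R * (1 + k%:R * (kappa - 1)))); last by rewrite ler_wpM2l.
    have h1 : 0 <= (3 + j)%:R * (k%:R * (kappa - 1)).
      by rewrite mulr_ge0 // mulr_ge0 // subr_ge0 ltW.
    have h2 : (i * k)%:R <= (b * i)%:R * (k%:R * (kappa - 1)).
      rewrite !natrM (_ : b%:R * _ * _ = (i%:R * k%:R) * (b%:R * (kappa - 1))); last by ring.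
      by rewrite -[leLHS]mulr1 ler_wpM2l // mulr_ge0.
    have h3 : 0 <= (b * i)%:R :> R by [].
    rewrite ME [X in X <= _]natrD; move: h1 h2 h3.
    move: ((3 + j)%:R : R) ((b * i)%:R : R) (k%:R * _) ((i * k)%:R : R) => a1 a2 a3 a4; lra.
  rewrite -(mulr_natl (- ln _)) expRM_natl E1 exprD; apply: ler_pM => //; rewrite ?exprn_ge0 ?(ltW eps0) //.
  by apply: lerXn2r; rewrite ?nnegrE ?(ltW eps0) // -div1r.
have c1 : (N * size ^+ e) ^+ 2 <= (1 / eps) ^+ 2 * ((C ^+ e) ^+ 2 * ((al ^+ e) ^+ 2) ^+ k).
  rewrite exprMn; apply: ler_pM; rewrite ?exprn_ge0 //.
    by apply: lerXn2r; rewrite ?nnegrE // divr_ge0 // ltW.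
  rewrite -!exprM.
  have -> : C ^+ (e * 2) * al ^+ (e * (2 * k)) = (C * al ^+ k) ^+ (e * 2).
    by rewrite exprMn -exprM mulnA [(k * _)%N]mulnC.
  by apply: lerXn2r; rewrite ?nnegrE //; apply: (le_trans s0).
apply: (le_trans (ler_pM _ _ c1 tail)); rewrite ?expR_ge0 ?exprn_ge0 // ?mulr_ge0 ?exprn_ge0 //.
rewrite exprM.
have e1 : (1 / eps) ^+ 2 * eps ^+ (3 + j) = eps * eps ^+ j.
  by rewrite addnC exprD; field; rewrite gt_eqF.
pose U := (C ^+ e) ^+ 2; pose V := (al ^+ e) ^+ 2.
rewrite -/U -/V in jC ij *.
have -> : (1 / eps) ^+ 2 * (U * V ^+ k) * (eps ^+ (3 + j) * (2^-1 ^+ i) ^+ k) =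
   eps * (U * eps ^+ j) * (V * 2^-1 ^+ i) ^+ k.
  rewrite [(V * _) ^+ k]exprMn.
  transitivity (eps * eps ^+ j * (U * (V ^+ k * 2^-1 ^+ i ^+ k))); last by ring.
  by rewrite -e1; ring.
have half (z : R) l : 2 * z <= 2 ^+ l -> z * 2^-1 ^+ l <= 2^-1.
  move=> h; rewrite exprVn ler_pdivrMr ?exprn_gt0 //; lra.
have U0 : 0 <= U by rewrite sqr_ge0.
have V0 : 0 <= V by rewrite sqr_ge0.
apply: ler_pM.
- by rewrite !mulr_ge0 ?exprn_ge0 // ltW.
- by rewrite exprn_ge0 // mulr_ge0 // exprn_ge0.
- rewrite ler_pM2l //; apply: le_trans (half _ _ jC); apply: ler_wpM2l => //.
  by apply: lerXn2r; rewrite ?nnegrE ?(ltW eps0) // -div1r.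
- by apply: lerXn2r; rewrite ?nnegrE ?(half _ _ ij) ?mulr_ge0 ?exprn_ge0 ?invr_ge0 //; lra.
Qed.

Lemma probability_bigcup_fin_le (R : realType) dS (S : measurableType dS)
    (P : probability S R) (I : finType) (bad : I -> set S) (x : R) :
  (forall i, measurable (bad i)) -> (forall i, (P (bad i) <= x%:E)%E) ->
  measurable (\bigcup_i bad i) /\ (P (\bigcup_i bad i) <= (#|I|%:R * x)%:E)%E.
Proof.
move=> mbad Pbad.
have -> : \bigcup_i bad i = \big[setU/set0]_(i <- enum I) bad i.
  by rewrite -bigcup_seq; apply: eq_bigcupl; split => i //= _; rewrite mem_enum.
split; first by apply: bigsetU_measurable.
rewrite cardE; elim: (enum I) => [|i s ih]; first by rewrite big_nil measure0 mul0r.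
rewrite big_cons; apply: (le_trans (measureU2 _ (mbad i) _)); first exact: bigsetU_measurable.
by rewrite /= -natr1 mulrDl mul1r addrC EFinD; apply: leeD.
Qed.

(** * Poisson means of the levels and the union bound *)

Section levels.
Context {R : realType} {m : nat}.
Local Notation d := m.+1.
Local Notation E := ('rV[R]_d).
Local Notation L := (line R d).

Definition density (gamma Omega alpha al : R) : R :=
  (gamma - 1) * 2 `^ (- gamma) *
  (sphere_area R m / 2 * (mesh alpha al / d%:R) ^+ m * ((alpha^-1 / 4) ^+ m - Omega) / 2 ^+ d).

(** Lower bound for the Poisson mean of the lines linking one valid pair, of order v_k^(1 - gamma)
    scale_k^m, with the dependence on k isolated in a single geometric factor. *)
Definition level_mass (gamma Omega r alpha al beta v0 : R) k : R :=
  density gamma Omega alpha al * scale0 r alpha ^+ m * v0 `^ (1 - gamma) *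
  (beta `^ (1 - gamma) / al ^+ m) ^+ k.

Variables (mu : {measure set L -> \bar R}) (sigma : probability L R).
Variables (gamma Omega alpha al beta v0 r : R) (A F : set E).
Hypothesis imu : is_invariant_line_measure mu.
Hypothesis uni : is_uniform_direction sigma.
Hypothesis mF : mu_measurable mu (hitting F).
Hypothesis gamma1 : 1 < gamma.
Hypothesis r0 : 0 < r.
Hypothesis al2 : 2 < al.
Hypothesis alalpha : al < alpha.
Hypothesis beta0 : 0 < beta.
Hypothesis v00 : 0 < v0.
Hypothesis Omega_small : Omega < (alpha^-1 / 4) ^+ m.
Hypothesis angle : forall x, thickening A (r / (alpha - 1)) x ->
  (solid_angle sigma F x < Omega%:E)%E.

Let alpha0 : 0 < alpha. Proof. by apply: lt_trans alalpha; apply: lt_trans al2. Qed.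
Let al0 : 0 < al. Proof. exact: lt_trans al2. Qed.
Let invs : 0 < alpha^-1 /\ alpha^-1 < al^-1.
Proof. by split; [rewrite invr_gt0|rewrite ltf_pV2]. Qed.
Let mesh0 : 0 < mesh alpha al. Proof. rewrite /mesh; have := invs; lra. Qed.
Let scale0_gt0 : 0 < scale0 r alpha. Proof. by rewrite divr_gt0 // mulr_gt0. Qed.

Lemma level_lines k (a b : E) : valid A r alpha al k a b ->
  exists B : set L, [/\ measurable B,
    B `<=` (hitting (eball a (radius r alpha al k)) `&` hitting (eball b (radius r alpha al k)))
      `\` hitting F &
    ((level_mass gamma Omega r alpha al beta v0 k)%:E <= marked_line_intensity mu gamma
      (B `*` `[speed beta v0 k, (2 * speed beta v0 k)%R]))%E].
Proof.
move=> [vab _].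
have scale_gt0 : 0 < scale r alpha al k by rewrite divr_gt0 // exprn_gt0.
have h0 : 0 < @halfside R m r alpha al k by rewrite divr_gt0 // mulr_gt0.
have s01 : 0 < alpha^-1 < 1 by rewrite invr_gt0 alpha0 /= invf_lt1 // (lt_trans _ (lt_trans al2 alalpha)) // ltr1n.
have hrad : d%:R * @halfside R m r alpha al k < radius r alpha al k.
  rewrite /halfside mulrCA divff ?mulr1 ?pnatr_eq0 // /radius mulrC ltr_pM2l //.
  by rewrite /mesh; have := invs; lra.
have [B [mB BF muB]] := good_lines imu uni mF s01 h0 hrad (ltW Omega_small)
  (fun z zh => angle (vab z zh).1) (fun z zh => (vab z zh).2).
exists B; split => //.
have v0k : 0 < speed beta v0 k by rewrite mulr_gt0 // exprn_gt0.
apply: le_trans (intensity_ge mu gamma1 v0k mB).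
have c0 : 0 <= (gamma - 1) * (2 * speed beta v0 k) `^ (- gamma) * speed beta v0 k.
  by rewrite mulr_ge0 ?(ltW v0k) // mulr_ge0 ?powR_ge0 // subr_ge0 ltW.
apply: (le_trans _ (lee_wpmul2l _ muB)) => //.
rewrite -EFinM lee_fin le_eqVlt; apply/orP; left; apply/eqP.
rewrite powRM ?(ltW v0k) //.
have -> : (gamma - 1) * (2 `^ (- gamma) * speed beta v0 k `^ (- gamma)) * speed beta v0 k =
    (gamma - 1) * 2 `^ (- gamma) * (v0 `^ (1 - gamma) * (beta `^ (1 - gamma)) ^+ k).
  rewrite -!mulrA; do 2 congr (_ * _).
  rewrite -{2}(@powRr1 _ (speed beta v0 k)) ?(ltW v0k) // -powRD; last by rewrite (gt_eqF v0k) implybT.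
  rewrite addrC powRM ?exprn_ge0 ?(ltW v00) ?(ltW beta0) //; congr (_ * _).
  by rewrite -(powR_mulrn k (ltW beta0)) -powRrM mulrC powRrM powR_mulrn ?powR_ge0.
rewrite /level_mass /density /halfside /scale.
have -> : (mesh alpha al * (scale0 r alpha / al ^+ k) / d%:R) ^+ m =
    (mesh alpha al / d%:R) ^+ m * scale0 r alpha ^+ m * (al ^+ m)^-1 ^+ k.
  rewrite [(al ^+ m)^-1 ^+ k](_ : _ = (al ^+ k)^-1 ^+ m); last first.
    by rewrite -!exprVn -!exprM mulnC.
  rewrite -!exprMn; congr (_ ^+ _).
  by move: (al ^+ k)^-1 (d%:R^-1 : R) => u w; ring.
rewrite [(beta `^ _ / _) ^+ k]exprMn.
by ring.
Qed.

Variables (dS : measure_display) (S : measurableType dS) (P : probability S R).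
Variables (Pi : S -> set (line R d * R)) (N : nat) (c : 'I_N -> E) (eps : R).
Hypothesis poisson : is_poisson_process P Pi (marked_line_intensity mu gamma).
Hypothesis beta1 : beta < 1.
Hypothesis albeta : 2 < al * beta.
Hypothesis cA : connected A.
Hypothesis AN : A `<=` \bigcup_i closed_eball (c i) r.
Hypothesis eps0 : 0 <= eps.
Hypothesis tail : forall k,
  (N%:R * (@net_size R m r alpha al k)%:R ^+ d) ^+ 2 *
    expR (- level_mass gamma Omega r alpha al beta v0 k) <= eps / 2 * 2^-1 ^+ k.

Lemma time_diameter_probability :
  ((1 - eps)%:E <= inner_probability P [set w |
     time_diameter (Pi w) (hitting (thickening A (r / (alpha - 1))) `\` hitting F) A <=
     ((N * @cell_size R m r alpha ^ d)%:R * time r alpha al beta v0 0)%:E])%E.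
Proof.
pose I k := (@net_index R m r alpha al N k * @net_index R m r alpha al N k)%type.
pose node k (i : @net_index R m r alpha al N k) : E := net c i.
have /choice[B BP] : forall p : {k : nat & I k}, exists B : set L,
    valid A r alpha al (tag p) (node _ (tagged p).1) (node _ (tagged p).2) ->
    [/\ measurable B,
    B `<=` (hitting (eball (node _ (tagged p).1) (radius r alpha al (tag p))) `&`
      hitting (eball (node _ (tagged p).2) (radius r alpha al (tag p)))) `\` hitting F &
    ((level_mass gamma Omega r alpha al beta v0 (tag p))%:E <= marked_line_intensity mu gamma
      (B `*` `[speed beta v0 (tag p), (2 * speed beta v0 (tag p))%R]))%E].
  move=> p.
  have [v|nv] := pselect (valid A r alpha al (tag p) (node _ (tagged p).1) (node _ (tagged p).2)).
    by have [B BP] := level_lines v; exists B.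
  by exists set0 => /nv.
pose box k (p : I k) := B (existT _ k p) `*` `[speed beta v0 k, (2 * speed beta v0 k)%R].
pose ok k (p : I k) := valid A r alpha al k (node _ p.1) (node _ p.2).
(* An invalid pair is never bad, since no line is required for it. *)
pose bad k (p : I k) : set S :=
  if `[< ok k p >] then point_count Pi (box k p) @^-1` [set (0 : \bar R)] else set0.
have badP k p : measurable (bad k p) /\
    (P (bad k p) <= (expR (- level_mass gamma Omega r alpha al beta v0 k))%:E)%E.
  rewrite /bad; case: asboolP => [okp|_]; last by rewrite measure0 lee_fin expR_ge0.
  have [mB _ mass] := BP (existT _ k p) okp.
  by apply: (no_point poisson _ mass); exact: measurableX.
pose Bad k := \bigcup_p bad k p.
have BadP k : measurable (Bad k) /\ (P (Bad k) <= (eps / 2 * 2^-1 ^+ k)%:E)%E.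
  have [mBad PBad] := probability_bigcup_fin_le (fun p => (badP k p).1) (fun p => (badP k p).2).
  split => //; apply: (le_trans PBad); rewrite lee_fin; apply: le_trans (tail k).
  by rewrite ler_wpM2r ?expR_ge0 // !card_prod card_ffun !card_ord natrM -expr2 natrM natrX.
have mD : measurable (~` \bigcup_k Bad k).
  by apply: measurableC; apply: bigcup_measurable => k _; have [] := BadP k.
apply: ereal_sup_ge; exists (P (~` \bigcup_k Bad k)).
  exists (~` \bigcup_k Bad k) => //; split => // w nBad /=.
  apply: (@time_diameter_le R m _ _ F _ _ _ _ _ _ c) => // k i j vij.
  have okp : ok k (i, j) by [].
  have [_ BF _] := BP (existT _ k (i, j)) okp.
  have : (box k (i, j) `&` Pi w) !=set0.
    rewrite setIC; apply: (@counting_point R); apply/eqP => zero; apply: nBad; exists k => //.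
    by exists (i, j) => //; rewrite /bad asboolT.
  move=> [[l v] [[/= Bl]]]; rewrite /= in_itv /= => /andP[lv _] Plv.
  by have [[li lj] lF] := BF l Bl; exists l, v.
rewrite probability_setC; last by apply: bigcup_measurable => k _; have [] := BadP k.
rewrite EFinB; apply: leeB => //.
have sub := @measure_sigma_subadditive _ _ _ P (\bigcup_k Bad k) Bad (fun k => (BadP k).1).
apply: (le_trans (sub _ _)) => //; first by apply: bigcup_measurable => k _; have [] := BadP k.
apply: (@le_trans _ _ (eps / 2 / (1 - 2^-1))%:E).
  apply: nneseries_geometric_le; [by rewrite divr_ge0|lra|].
  by move=> k; rewrite measure_ge0 /=; have [] := BadP k.
by rewrite lee_fin le_eqVlt; apply/orP; left; apply/eqP; field.
Qed.

End levels.

(** * Choice of the constants and conclusion *)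

Lemma time_diameter_ge0 (R : realType) d (Pi : set (line R d * R)) (L : set (line R d))
    (A : set 'rV[R]_d) : A !=set0 -> (0 <= time_diameter Pi L A)%E.
Proof.
move=> [x Ax]; apply: (@le_trans _ _ (ereal_inf [set T%:E | T in path_times Pi L x x])).
  by apply: le_ereal_inf_tmp => _ [T [xi [[T0 _ _] _ _ _]] <-]; rewrite lee_fin.
by apply: ereal_sup_ubound; exists x => //; exists x.
Qed.

Lemma time_diameter_set0 (R : realType) d (Pi : set (line R d * R)) (L : set (line R d)) :
  time_diameter Pi L set0 = -oo%E.
Proof.
rewrite /time_diameter (_ : [set _ | x in set0 & y in set0] = set0) ?ereal_sup0 //.
by apply/seteqP; split => // _ [x []].
Qed.

(** Origin of the exponents in the final bound: with x = ln (1 / eps), a length t divided by a speed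
    of order (t^m / x)^(1 / (gamma - 1)) gives t^((gamma - d) / (gamma - 1)) x^(1 / (gamma - 1)).
    The exponent of t is positive, so r may replace t. *)
Lemma crossing_scaling (R : realType) m (gamma dens M x t r : R) : m.+1%:R < gamma ->
  0 < dens -> 0 < M -> 0 < x -> 0 < t -> t <= r ->
  t / (dens * t ^+ m / (M * x)) `^ (1 / (gamma - 1)) <=
  (M / dens) `^ (1 / (gamma - 1)) * x `^ (1 / (gamma - 1)) *
    r `^ ((gamma - m.+1%:R) / (gamma - 1)).
Proof.
move=> dg D0 M0 x0 t0 tr; set p := 1 / (gamma - 1).
have g1 : 0 < gamma - 1.
  by rewrite subr_gt0; apply: le_lt_trans dg; rewrite ler1n.
have p0 : 0 < p by rewrite divr_gt0.
have tm0 : 0 < t ^+ m by rewrite exprn_gt0.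
have -> : dens * t ^+ m / (M * x) = (M / dens)^-1 * x^-1 * t ^+ m.
  by field; rewrite !gt_eqF.
have inv (z : R) : 0 < z -> (z^-1 `^ p)^-1 = z `^ p.
  by move=> z0; rewrite -(powR_inv1 (ltW z0)) -powRrM mulN1r powRN invrK.
have MD : 0 < M / dens by rewrite divr_gt0.
move: (M / dens) MD => y MD.
rewrite !powRM ?mulr_ge0 ?invr_ge0 ?(ltW MD) ?(ltW x0) ?(ltW tm0) //.
rewrite !invfM (inv _ MD) (inv _ x0) mulrCA; apply: ler_wpM2l.
  by rewrite mulr_ge0 ?powR_ge0.
rewrite -powR_mulrn ?(ltW t0) // -powRrM -powRN -{1}(@powRr1 _ t) ?(ltW t0) //.
rewrite -powRD; last by rewrite (gt_eqF t0) implybT.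
have -> : 1 + - (m%:R * p) = (gamma - m.+1%:R) / (gamma - 1).
  by rewrite /p -natr1; field; rewrite gt_eqF.
apply: ge0_ler_powR; rewrite ?nnegrE ?(ltW t0) ?(le_trans (ltW t0) tr) //.
by rewrite divr_ge0 ?(ltW g1) // subr_ge0 ltW.
Qed.

Lemma density_gt0 (R : realType) m (gamma Omega alpha al : R) : 1 < gamma -> 0 < al < alpha ->
  Omega < (alpha^-1 / 4) ^+ m -> 0 < @density R m gamma Omega alpha al.
Proof.
move=> g1 /andP[al0 ala] small.
have mesh0 : 0 < mesh alpha al.
  by rewrite divr_gt0 // subr_gt0 ltf_pV2 ?posrE // (lt_trans al0).
rewrite mulr_gt0 // ?mulr_gt0 ?powR_gt0 ?subr_gt0 // ?divr_gt0 ?sphere_area_gt0 //.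
by rewrite exprn_gt0 // divr_gt0.
Qed.

(** The radius cancels in the ratio of ball to mesh, which makes the tail estimate uniform in
    [r]. *)
Lemma net_size_le (R : realType) m (r alpha al : R) k : 0 < r -> 0 < al < alpha -> 1 <= al ->
  (@net_size R m r alpha al k)%:R <= (16 * alpha * m.+1%:R / mesh alpha al + 1) * al ^+ k.
Proof.
move=> r0 /andP[al0 ala] al1.
have a0 : 0 < alpha by apply: lt_trans ala.
have mesh0 : 0 < mesh alpha al.
  by rewrite divr_gt0 // subr_gt0 ltf_pV2 ?posrE.
have E : 2 * (2 * r) / @halfside R m r alpha al k = 16 * alpha * m.+1%:R / mesh alpha al * al ^+ k.
  rewrite /halfside /scale /scale0; field.
  by rewrite !gt_eqF ?exprn_gt0.
rewrite /net_size E -[leLHS]natr1 [leRHS]mulrDl mul1r; apply: lerD; last exact: exprn_ege1.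
set y := _ * al ^+ k; suff /truncn_itv/andP[] : 0 <= y by [].
by rewrite mulr_ge0 ?exprn_ge0 ?(ltW al0) // divr_ge0 ?(ltW mesh0) // !mulr_ge0 // ltW.
Qed.

Lemma cell_sizeE (R : realType) m (r alpha : R) : 0 < r -> 0 < alpha ->
  @cell_size R m r alpha = (Num.truncn (16 * alpha * m.+1%:R)).+1.
Proof.
move=> r0 a0; rewrite /cell_size /scale0; congr (Num.truncn _).+1.
by field; rewrite !gt_eqF.
Qed.

Theorem theorem3p1 (R : realType) (n : nat) (d := n.+2) (gamma Omega alpha : R) :
  d%:R < gamma ->
  let alpha_min := 2 `^ ((gamma - 1) / (gamma - d%:R)) in
  let Omega_max := (4 * alpha_min) `^ (1 - d%:R) in
  let alpha_max := Omega `^ (- (1 / (d%:R - 1))) / 4 in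
  0 < Omega < Omega_max ->
  alpha_min < alpha < alpha_max ->
  exists2 T1 : R, 0 < T1 &
  forall (mu : {measure set (line R d) -> \bar R})
         (sigma : probability (line R d) R),
  is_invariant_line_measure mu ->
  is_uniform_direction sigma ->
  forall (dS : measure_display) (S : measurableType dS) (P : probability S R)
         (Pi : S -> set (line R d * R)),
  is_poisson_process P Pi (marked_line_intensity mu gamma) ->
  forall (A F : set 'rV[R]_d) (r : R) (N : nat),
  0 < r ->
  mu_measurable mu (hitting F) ->
  connected A ->
  (forall x, thickening A (r / (alpha - 1)) x ->
     (solid_angle sigma F x < Omega%:E)%E) ->
  (exists c : 'I_N -> 'rV[R]_d, A `<=` \bigcup_i closed_eball (c i) r) ->
  let eps_max := 1 / (2 * N%:R * (2 * alpha + 1) ^+ d) in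
  let T_rN := N%:R * T1 * r `^ ((gamma - d%:R) / (gamma - 1)) in
  let T_AF w :=
    time_diameter (Pi w) (hitting (thickening A (r / (alpha - 1))) `\` hitting F) A in
  (forall eps : R, 0 < eps < eps_max ->
     ((1 - eps / eps_max)%:E <= inner_probability P
       [set w | T_AF w <= (T_rN * ln (1 / eps) `^ (1 / (gamma - 1)))%:E])%E) /\
  (forall delta : R, delta < T_rN `^ (- (gamma - 1)) ->
     (upper_expectation P
        (fun w => expeR (delta%:E * T_AF w `^ (gamma - 1))) < +oo)%E).
Proof.
move=> dg alpha_min Omega_max alpha_max /andP[ Omega0 _] alphaP.
pose m := n.+1.
have [small [al [beta [/andP[al2 ala] /andP[b0 b1] alb albeta]]]] :=
  exponents (m := m) isT dg Omega0 alphaP.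
have g1 : 0 < gamma - 1.
  by rewrite subr_gt0; apply: le_lt_trans dg; rewrite ler1n.
have al0 : 0 < al by apply: lt_trans al2.
have al1 : 1 <= al by apply: le_trans (ltW al2); rewrite ler1n.
have alpha0 : 0 < alpha by apply: lt_trans ala.
have alP : 0 < al < alpha by rewrite al0.
have dens0 : 0 < @density R m gamma Omega alpha al.
  by apply: density_gt0 => //; rewrite -subr_gt0.
set dens := density _ _ _ _ in dens0.
pose C := 16 * alpha * d%:R / mesh alpha al + 1.
have mesh0 : 0 < mesh alpha al.
  by rewrite divr_gt0 // subr_gt0 ltf_pV2 ?posrE.
have C0 : 0 <= C by rewrite addr_ge0 // divr_ge0 ?(ltW mesh0) // !mulr_ge0 // ltW.
pose kappa := beta `^ (1 - gamma) / al ^+ m.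
have kappa1 : 1 < kappa by rewrite ltr_pdivlMr ?mul1r // exprn_gt0.
have [M M0 tailP] := level_tail d C0 al1 kappa1.
pose cell := (Num.truncn (16 * alpha * d%:R)).+1.
have q0 : 0 < 1 - 2 / (al * beta).
  by rewrite subr_gt0 ltr_pdivrMr ?mul1r // mulr_gt0.
pose p := 1 / (gamma - 1).
have md0 : 0 < M / dens by rewrite divr_gt0.
(* Cells per ball, times the sum of the geometric series of one local curve, times the constant of
   [crossing_scaling]. *)
exists ((cell ^ d)%:R * (3 / (1 - 2 / (al * beta)) * (M / dens) `^ p)).
  by rewrite mulr_gt0 ?ltr0n ?expn_gt0 // mulr_gt0 ?powR_gt0 // divr_gt0.
set T1 := _ * (_ * _).
have T10 : 0 < T1.
  by rewrite mulr_gt0 ?ltr0n ?expn_gt0 // mulr_gt0 ?powR_gt0 // divr_gt0.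
move=> mu sigma imu uni dS S P Pi poisson A F r N r0 mF cA angle [c AN] eps_max T_rN T_AF.
have alpha1 : 1 <= 2 * alpha + 1 by rewrite lerDr mulr_ge0 // ltW.
have max_le : (0 < N)%N -> 0 < eps_max /\ forall eps, eps <= eps_max -> 2 * N%:R * eps <= 1.
  move=> N0; have a0 : 1 <= (2 * alpha + 1) ^+ d by rewrite exprn_ege1.
  have N1 : 0 < 2 * N%:R :> R by rewrite mulr_gt0 // ltr0n.
  have e0 : 0 < eps_max by rewrite divr_gt0 // mulr_gt0 // (lt_le_trans ltr01).
  split => // eps epsm; apply: (@le_trans _ _ (2 * N%:R * eps_max)).
    by rewrite ler_pM2l.
  rewrite mulrA mulr1 ler_pdivrMr ?mul1r ?ler_peMr ?(ltW N1) //.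
  by rewrite mulr_gt0 // (lt_le_trans ltr01).
have tail eps : 0 < eps < eps_max ->
    ((1 - eps / eps_max)%:E <= inner_probability P
       [set w | T_AF w <= (T_rN * ln (1 / eps) `^ p)%:E])%E.
  move=> /andP[eps0 epsm].
  (* For N = 0 the convention 1 / 0 = 0 makes [eps_max] zero and leaves no admissible eps. *)
  have N0 : (0 < N)%N.
    rewrite lt0n; apply/eqP => N0; move: (lt_trans eps0 epsm).
    by rewrite /eps_max N0 mulr0 mul0r invr0 mulr0 ltxx.
  have [max0 /[dup] eps2 /(_ _ (ltW epsm)) Neps] := max_le N0.
  have N1 : 1 <= N%:R :> R by rewrite ler1n.
  have eps_half : eps <= 1 / 2.
    have : 2 * 1 * eps <= 2 * N%:R * eps by rewrite ler_pM2r // ler_pM2l.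
    by lra.
  have Nle : N%:R <= 1 / eps.
    rewrite ler_pdivlMr //; have : 0 <= N%:R * eps by rewrite mulr_ge0 // ltW.
    by lra.
  pose x := ln (1 / eps).
  have x0 : 0 < x by rewrite ln_gt0 // ltr_pdivlMr //; lra.
  pose t := scale0 r alpha.
  have t0 : 0 < t by rewrite divr_gt0 // mulr_gt0.
  have tm0 : 0 < t ^+ m by rewrite exprn_gt0.
  have Mx0 : 0 < M * x by rewrite mulr_gt0.
  (* Chosen to make the level masses exactly M * ln (1 / eps) * kappa^k, the form that [level_tail]
     treats. *)
  pose v0 := (dens * t ^+ m / (M * x)) `^ p.
  have u0 : 0 < dens * t ^+ m / (M * x) by rewrite divr_gt0 // mulr_gt0.
  have v00 : 0 < v0 by rewrite powR_gt0.
  have mass k : level_mass (m := m) gamma Omega r alpha al beta v0 k = M * x * kappa ^+ k.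
    rewrite /level_mass -/kappa -/dens -/t; congr (_ * _).
    have -> : v0 `^ (1 - gamma) = (dens * t ^+ m / (M * x))^-1.
      rewrite -powR_inv1 ?(ltW u0) // /v0 -powRrM; congr (_ `^ _).
      by rewrite /p; field; rewrite gt_eqF.
    by field; rewrite !gt_eqF.
  have main := @time_diameter_probability R m mu sigma gamma Omega alpha al beta v0 r A F
    imu uni mF _ r0 al2 ala b0 v00 small angle dS S P Pi N c eps poisson b1 alb cA AN (ltW eps0).
  (* As [eps_max] is at most 1, a failure probability of eps is better than the one claimed. *)
  apply: (@le_trans _ _ (1 - eps)%:E).
    rewrite lee_fin lerD2l lerN2 ler_pdivlMr // ler_piMr ?(ltW eps0) //.
    have := eps2 _ (lexx _); have : 2 * 1 * eps_max <= 2 * N%:R * eps_max.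
      by rewrite ler_pM2r // ler_pM2l.
    by lra.
  apply: (le_trans (main _ _)).
  - by rewrite -subr_gt0.
  - move=> k; rewrite mass; apply: tailP; rewrite ?eps0 ?ler0n //=.
    exact: net_size_le.
  apply: le_ereal_sup => _ [D [mD DE] <-]; exists D => //; split => // w /DE /= h.
  apply: (le_trans h); rewrite lee_fin cell_sizeE // -/cell natrM /T_rN /T1 -!mulrA.
  apply: ler_wpM2l => //; apply: ler_wpM2l => //.
  have tr : t <= r.
    rewrite /t /scale0 ler_pdivrMr ?mulr_gt0 // ler_peMr ?(ltW r0) //; lra.
  have := crossing_scaling dg dens0 M0 x0 t0 tr.
  rewrite -/v0 /time /scale /speed !expr0 divr1 mulr1 -/t => h1.
  have -> : 3 * t / v0 / (1 - 2 / (al * beta)) = 3 / (1 - 2 / (al * beta)) * (t / v0).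
    by move: (1 - 2 / (al * beta)) => q; ring.
  rewrite [leRHS]mulrA; apply: ler_wpM2l; first by rewrite divr_ge0 // ltW.
  by apply: (le_trans h1); rewrite -/p -/x -mulrA [x `^ p * _]mulrC.
split; first exact: tail.
(* An empty [A] has time diameter -oo, whose power is 0 by convention, so the integrand is 1. *)
move=> delta deltaT; have [A0|nA0] := pselect (A !=set0); last first.
  have A0 : A = set0 by apply/eqP/negPn/negP => /set0P.
  apply: (@le_lt_trans _ _ (\int[P]_w cst 1%E w)%E).
    apply: ereal_inf_lbound; exists (cst 1%E) => //; split => // w.
    by rewrite /T_AF A0 time_diameter_set0 poweRNyr ?gt_eqF // mule0 expeR0.
  rewrite integral_cst // mul1e; apply: le_lt_trans (probability_le1 _ _) _ => //.
  exact: ltry.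
have N0 : (0 < N)%N.
  case: (N) c AN => // c AN; have [a Aa] := A0.
  by have [[]] := AN a Aa.
have [max0 _] := max_le N0.
apply: (upper_expectation_lt_pinfty _ g1 max0 _ tail deltaT).
  by rewrite mulr_gt0 ?powR_gt0 // mulr_gt0 // ltr0n.
by move=> w; exact: time_diameter_ge0.
Qed.
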